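(* Let $(\boldsymbol{\nu},\sigma)$ be flagged LLT indexing data of length $l$. Let $\mathcal{A}=\mathcal{A}^+\sqcup\mathcal{A}^-$ be a signed alphabet with subsets $\mathcal{A}_1<\cdots<\mathcal{A}_l$, and put $X_i^{\mathcal{A}}=\sum_{a\in\mathcal{A}_i^+}x_a-\sum_{b\in\mathcal{A}_i^-}x_b$, where $\mathcal{A}_i^{\pm}=\mathcal{A}_i\cap\mathcal{A}^{\pm}$. Then, specializing the formal alphabets $X_i$ of the flagged LLT polynomial to $X_i^{\mathcal{A}}$, $$\mathcal{G}_{\boldsymbol{\nu},\sigma}[X_1^{\mathcal{A}},\ldots,X_l^{\mathcal{A}};\,t]=\sum_{T\in \mathrm{FST}(\boldsymbol{\nu},\sigma,\mathcal{A})}(-1)^{m(T)}\,t^{\operatorname{inv}(T)}\,x^T,$$ where $x^T=\prod_{u\in\boldsymbol{\nu}}x_{T(u)}$ and $m(T)=|T^{-1}(\mathcal{A}^-)|$ is the number of negative entries in $T$.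
   Context: Plethystic notation. For a formal sum $Z=\sum_i a_i-\sum_j b_j$ of monomials in indeterminates (repetitions allowed, possibly infinite), $h_k[Z]$ is the coefficient of $u^k$ in $\prod_j(1-ub_j)/\prod_i(1-ua_i)$, and $f[Z]$ is the image of the symmetric function $f$ under the algebra homomorphism (linear over the coefficients) with $h_k\mapsto h_k[Z]$. A formal alphabet $X$ (an infinite set of variables) in such an expression stands for the sum of its variables; $f[Z_1,\dots,Z_l]$ for a multi-symmetric function $f(X_1,\dots,X_l)$ means evaluating each $X_i$ at $Z_i$. $\Omega=\sum_{k\ge 0}h_k$. Flagged LLT indexing data. For $\alpha,\beta\in\mathbb{Z}^r$ ($r\ge1$) with $\alpha_j\le\beta_j$, the diagram $\beta/\alpha$ is the set of boxes $(i,j)$ with $1\le j\le r$, $\alpha_j<i\le\beta_j$ (box $(i,j)$ is in column $i$ and row $j$; rows go upward); rows with $\alpha_j=\beta_j$ are empty but still counted. The content is $c(i,j)=i-j$. $\beta/\alpha$ is a ragged-right skew diagram if $\alpha_1\ge\cdots\ge\alpha_r$ and $\beta_{j+1}\le\beta_j+1$ for all $j$. The flag box of row $j$ is $(\beta_j+1,j)$. Let $\boldsymbol{\nu}=(\nu^{(1)},\dots,\nu^{(k)})$ be a tuple of ragged-right skew diagrams with a total of $l$ rows (boxes of different components are distinct). Number all rows $1,\dots,l$ consecutively ($\nu^{(1)}$ first, bottom to top in each component). If row $p$ of $\boldsymbol{\nu}$ is row $j$ of its component, with ends $\alpha_p,\beta_p$, put $\gamma_p=\alpha_p+1-j$ and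 $\eta_p=\beta_p+1-j$ (the content of its flag box). $\mathfrak{S}_{\mathbf r}\subseteq\mathfrak{S}_l$ is the Young subgroup preserving the set of row indices of each component. A permutation $\sigma\in\mathfrak{S}_l$ is compatible with $\boldsymbol{\nu}$ if $\eta_{\sigma(1)}\le\cdots\le\eta_{\sigma(l)}$ and $\sigma^{-1}(p)>\sigma^{-1}(p+1)$ whenever rows $p,p+1$ are in the same component. The flag number of row $p$ (and of its flag box) is then $l+1-\sigma^{-1}(p)$. Such a pair $(\boldsymbol{\nu},\sigma)$ is flagged LLT indexing data of length $l$. $\boldsymbol{\nu}'$ (with components $\nu'^{(j)}$) is $\boldsymbol{\nu}$ together with its flag boxes. Flagged LLT polynomial. $\mathfrak{S}_l$ acts on $\mathbb{Z}^l$ by $(w\lambda)_{w(i)}=\lambda_i$ and permutes variables; $s_i=(i\;i{+}1)$; $\ell(w)$ is the length. On $\mathbb{Q}(t)[z_1^{\pm1},\dots,z_l^{\pm1}]$ let $T_i=t\,s_i+\frac{1-t}{1-z_i/z_{i+1}}(s_i-1)$, and $\overline{T_w}=T_{i_1}^{-1}\cdots T_{i_k}^{-1}$ for $w=s_{i_1}\cdots s_{i_k}$ reduced. For $\lambda\in\mathbb{Z}^l$, $F_\lambda(z;t^{-1})=\overline{T_v}\,z^{\lambda_-}$, where $\lambda_-$ is the weakly increasing rearrangement of $\lambda$ and $v$ is the minimal length permutation with $v(\lambda_-)=\lambda$; these form a basis of the Laurent polynomial ring, and $\langle F_\lambda(z;t^{-1})\rangle g$ denotes the coefficient of $F_\lambda(z;t^{-1})$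 in the expansion of $g$. Let $h(\boldsymbol{\nu})$ be the number of pairs $(y,z)$ with $y\in\nu^{(i)}$, $z\in\nu'^{(j)}$, $i<j$, $c(y)=c(z)$ (equivalently, of triples $(x,y,z)$ with $x$ the box immediately left of $z$). Let $e(\boldsymbol{\nu},\sigma)$ be the number of pairs of rows $p<p'$ in different components with $\eta_p=\eta_{p'}$ and $\sigma^{-1}(p)>\sigma^{-1}(p')$. The flagged LLT polynomial is $$\mathcal{G}_{\boldsymbol{\nu},\sigma}(X_1,\dots,X_l;t)=t^{h(\boldsymbol{\nu})+e(\boldsymbol{\nu},\sigma)}\sum_{w\in\mathfrak{S}_{\mathbf r}}(-1)^{\ell(w)}\langle F_{w(\gamma)}(z;t^{-1})\rangle\,\overline{T_\sigma}\,\Omega\Big[\sum_{1\le i\le j\le l}X_i/z_{l+1-j}\Big]z^{\eta_-},$$ where $\overline{T_\sigma}$ acts on the $z$ variables, coefficientwise in the $X_i$. Flagged tableaux. A signed alphabet is a totally ordered set $\mathcal{A}$ partitioned into positive letters $\mathcal{A}^+$ and negative letters $\mathcal{A}^-$; $\mathcal{A}_i<\mathcal{A}_j$ means $a<b$ for all $a\in\mathcal{A}_i$, $b\in\mathcal{A}_j$. A box $x$ in $\nu^{(j)}$ is $i$-admissible if (i) $i$ is at most the flag number of the row containing $x$, and (ii) $i$ is greater than the flag number in every flag box of $\nu^{(j)}$ lying below $x$ in the column of $x$. $\mathrm{FST}(\boldsymbol{\nu},\sigma,\mathcal{A})$ is the set of flagged tableaux: maps $T:\boldsymbol{\nu}\to\bigcup_i\mathcal{A}_i$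 such that each row of $T$ is weakly increasing left to right with no repeated negative letter; within each component each column is weakly increasing bottom to top with no repeated positive letter; and if $T(x)\in\mathcal{A}_i$ then $x$ is $i$-admissible. An attacking pair is a pair $(x,y)$ with $x\in\nu^{(i)}$, $y\in\nu'^{(j)}$ such that either $i<j$ and $c(y)=c(x)$, or $i>j$ and $c(y)=c(x)+1$. It is an attacking inversion of $T$ if either $y\in\boldsymbol{\nu}$ and ($T(x)>T(y)$ or $T(x)=T(y)\in\mathcal{A}^-$), or $y$ is a flag box with flag number $p$ and $T(x)\in\mathcal{A}_s$ for some $s>p$. $\operatorname{inv}(T)$ is the number of attacking inversions of $T$. *)

(* Defs.v *)
(* The classical layer (boolp) is used only for equality/choice on power series, for definite description and for
   sums over finite supports. *)
From HB Require Import structures.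
From mathcomp Require Import all_boot all_order all_algebra all_fingroup.
From mathcomp Require boolp classical_sets fsbigop.
From mathcomp Require Import finmap ring.
From mathcomp Require Import monalg.
From mathcomp Require Import mpoly.

Set Implicit Arguments.
Unset Strict Implicit.
Unset Printing Implicit Defensive.

Import Order.TTheory GRing.Theory Num.Theory.
Local Open Scope ring_scope.

Section CommutativeMonomials.
Variable V : choiceType.
Implicit Types (m d e : {cmonom V}) (a : V).

Definition cm_letters m : seq V :=
  flatten [seq nseq (cmonom_val m a) a | a <- finsupp (cmonom_val m)].

Definition cm_divisors m : seq {cmonom V} :=
  undup (foldr (fun a L => L ++ [seq mmul (ucm a) d | d <- L])
               [:: mone] (cm_letters m)).

(* All factorizations of m into an ordered pair, each listed once. *)
Definition cm_pairs m : seq ({cmonom V} * {cmonom V}) :=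
  [seq (d, divcm m d) | d <- cm_divisors m].

Lemma cm_ext m m' :
  (forall a, cmonom_val m a = cmonom_val m' a) -> m = m'.
Proof. by move=> h; apply/eqP/monalg.cmP. Qed.

Lemma cm_prod_letters m : \big[mmul/mone]_(a <- cm_letters m) ucm a = m.
Proof.
apply: cm_ext => b.
have cmB (s : seq V) :
    cmonom_val (\big[mmul/mone]_(a <- s) ucm a) b = count_mem b s.
  elim: s => [|a s IH]; first by rewrite big_nil monalg.cm1.
  by rewrite big_cons monalg.cmM monalg.cmU IH.
rewrite cmB /cm_letters count_flatten -map_comp.
rewrite sumnE big_map.
under eq_bigr => a _ do rewrite /= count_nseq /=.
have [bin|bin] := boolP (b \in finsupp (cmonom_val m)).
  rewrite (big_fsetD1 b) //= eqxx mul1n big1_fset ?addn0 // => a.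
  by rewrite in_fsetD1 => /andP[/negbTE-> _] _; rewrite mul0n.
rewrite big1_fset; first by rewrite memNfinsupp in bin; rewrite (eqP bin).
by move=> a ain _; case: eqP => [E|_]; rewrite ?mul0n //; rewrite -E ain in bin.
Qed.

Lemma mem_cm_divisors m d :
  reflect (exists e, mmul d e = m) (d \in cm_divisors m).
Proof.
rewrite mem_undup -{1}(cm_prod_letters m).
elim: (cm_letters m) d => [|a s IH] d /=.
  rewrite big_nil inE; apply: (iffP eqP) => [->|[e /monalg.mulcm_eq0[]//]].
  by exists mone; rewrite mul1m.
rewrite big_cons mem_cat; apply: (iffP orP).
  case=> [/IH[e <-]|/mapP[d' /IH[e <-] ->]].
    by exists (mmul (ucm a) e); rewrite !mulmA [mmul d _]monalg.mulmC.
  by exists e; rewrite mulmA.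
case=> e E.
have Eb b : (cmonom_val d b + cmonom_val e b = (a == b) +
    cmonom_val (\big[mmul/mone]_(j <- s) ucm j) b)%N.
  by rewrite -monalg.cmU -!monalg.cmM E.
have [da|da] := posnP (cmonom_val d a).
  left; apply/IH; exists (divcm e (ucm a)); apply: cm_ext => b.
  move: (Eb b); rewrite monalg.cmM divcmE monalg.cmU.
  by case: eqVneq => [<-|_]; rewrite ?da ?add0n ?subn0 ?add1n // => ->; rewrite subn1.
right; apply/mapP; exists (divcm d (ucm a)); last first.
  apply: cm_ext => b; rewrite monalg.cmM divcmE monalg.cmU.
  by case: eqVneq => [<-|_]; rewrite ?subn0 // subnKC.
apply/IH; exists e; apply: cm_ext => b.
move: (Eb b); rewrite monalg.cmM divcmE monalg.cmU.
case: eqVneq => [<-|_]; rewrite ?subn0 // => Ea.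
by rewrite addnBAC // Ea addKn.
Qed.

Lemma mem_cm_pairs m p : (p \in cm_pairs m) = (mmul p.1 p.2 == m).
Proof.
apply/mapP/eqP => [[d /mem_cm_divisors[e <-] ->]|<-].
  by apply: cm_ext => b; rewrite /= !monalg.cmM divcmE monalg.cmM addKn.
exists p.1; first by apply/mem_cm_divisors; exists p.2.
case: p => d e /=; congr pair; apply: cm_ext => b.
by rewrite divcmE monalg.cmM addKn.
Qed.

Lemma uniq_cm_pairs m : uniq (cm_pairs m).
Proof. by rewrite map_inj_uniq ?undup_uniq // => d e []. Qed.

End CommutativeMonomials.

Definition fps (V : choiceType) (K : comNzRingType) := {cmonom V} -> K.

Section PowerSeries.
Variables (V : choiceType) (K : comNzRingType).
Local Notation S := (fps V K).
Implicit Types (f g h : S) (m : {cmonom V}).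

HB.instance Definition _ := boolp.gen_eqMixin S.
HB.instance Definition _ := boolp.gen_choiceMixin S.

Lemma fpsP f g : (forall m, f m = g m) -> f = g.
Proof. by move=> h; apply: boolp.funext. Qed.

Definition fpsC (c : K) : S := fun m => c *+ (m == mone).
Definition fps_add f g : S := fun m => f m + g m.
Definition fps_opp f : S := fun m => - f m.
Definition fps_mul f g : S := fun m => \sum_(p <- cm_pairs m) f p.1 * g p.2.

Lemma fps_addA : associative fps_add.
Proof. by move=> f g h; apply: fpsP => m; rewrite /fps_add addrA. Qed.
Lemma fps_addC : commutative fps_add.
Proof. by move=> f g; apply: fpsP => m; rewrite /fps_add addrC. Qed.
Lemma fps_add0 : left_id (fpsC 0) fps_add.
Proof. by move=> f; apply: fpsP => m; rewrite /fps_add /fpsC mul0rn add0r. Qed.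
Lemma fps_addN : left_inverse (fpsC 0) fps_opp fps_add.
Proof.
by move=> f; apply: fpsP => m; rewrite /fps_add /fps_opp /fpsC mul0rn addNr.
Qed.

HB.instance Definition _ :=
  GRing.isZmodule.Build S fps_addA fps_addC fps_add0 fps_addN.

Lemma fps_mulC : commutative fps_mul.
Proof.
move=> f g; apply: fpsP => m; rewrite /fps_mul.
rewrite (perm_big [seq (p.2, p.1) | p <- cm_pairs m]) /=; last first.
  apply: uniq_perm; rewrite ?uniq_cm_pairs //.
    by rewrite map_inj_uniq ?uniq_cm_pairs // => -[a b] [c d] [-> ->].
  move=> [d e]; rewrite mem_cm_pairs /=.
  apply/eqP/mapP => [<-|[[d' e']]].
    by exists (e, d); rewrite // mem_cm_pairs /= monalg.mulmC.
  by rewrite mem_cm_pairs /= => /eqP <- [-> ->]; rewrite monalg.mulmC.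
by rewrite big_map; apply: eq_bigr => p _; rewrite mulrC.
Qed.

Lemma fps_mulA : associative fps_mul.
Proof.
move=> f g h; apply: fpsP => m; rewrite /fps_mul.
pose T3 := [seq (p.1, q.1, q.2) | p <- cm_pairs m, q <- cm_pairs p.2].
pose T3' := [seq (q.1, q.2, p.2) | p <- cm_pairs m, q <- cm_pairs p.1].
have -> : \sum_(p <- cm_pairs m)
            f p.1 * (\sum_(q <- cm_pairs p.2) g q.1 * h q.2)
        = \sum_(x <- T3) f x.1.1 * g x.1.2 * h x.2.
  rewrite big_allpairs_dep; apply: eq_bigr => p _; rewrite mulr_sumr.
  by apply: eq_bigr => q _; rewrite mulrA.
have -> : \sum_(p <- cm_pairs m)
            (\sum_(q <- cm_pairs p.1) f q.1 * g q.2) * h p.2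
        = \sum_(x <- T3') f x.1.1 * g x.1.2 * h x.2.
  by rewrite big_allpairs_dep; apply: eq_bigr => p _; rewrite mulr_suml.
apply/perm_big/uniq_perm.
- apply: allpairs_uniq_dep; rewrite ?uniq_cm_pairs //.
    by move=> p _; rewrite uniq_cm_pairs.
  move=> [[a b] [c d]] [[a' b'] [c' d']] /=.
  move=> /allpairsPdep[p [q [_ + [E1 E2]]]].
  move=> + /allpairsPdep[p' [q' [_ + [E3 E4]]]].
  rewrite -E1 -E2 -E3 -E4 !mem_cm_pairs /=.
  by move=> /eqP <- /eqP <- [-> -> ->].
- apply: allpairs_uniq_dep; rewrite ?uniq_cm_pairs //.
    by move=> p _; rewrite uniq_cm_pairs.
  move=> [[a b] [c d]] [[a' b'] [c' d']] /=.
  move=> /allpairsPdep[p [q [_ + [E1 E2]]]].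
  move=> + /allpairsPdep[p' [q' [_ + [E3 E4]]]].
  rewrite -E1 -E2 -E3 -E4 !mem_cm_pairs /=.
  by move=> /eqP <- /eqP <- [-> -> ->].
move=> [[a b] c]; apply/allpairsPdep/allpairsPdep => -[p [q []]].
  rewrite !mem_cm_pairs => /eqP Ep /eqP Eq [-> -> ->].
  exists (mmul p.1 q.1, q.2), (p.1, q.1); split => //=.
    by rewrite mem_cm_pairs /= -mulmA Eq Ep.
  by rewrite mem_cm_pairs.
rewrite !mem_cm_pairs => /eqP Ep /eqP Eq [-> -> ->].
exists (q.1, mmul q.2 p.2), (q.2, p.2); split => //=.
  by rewrite mem_cm_pairs /= mulmA Eq Ep.
by rewrite mem_cm_pairs.
Qed.

Lemma fps_mul1 : left_id (fpsC 1) fps_mul.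
Proof.
move=> f; apply: fpsP => m; rewrite /fps_mul /fpsC.
have m1 : (mone, m) \in cm_pairs m by rewrite mem_cm_pairs /= mul1m.
rewrite (bigD1_seq (mone, m)) ?uniq_cm_pairs //= eqxx mulr1n mul1r.
rewrite big_seq_cond big1 ?addr0 // => -[d e]; rewrite mem_cm_pairs /=.
case/andP=> /eqP <- ne; case: eqP => [d1|_]; last by rewrite mul0r.
by rewrite d1 mul1m eqxx in ne.
Qed.

Lemma fps_mulDl : left_distributive fps_mul fps_add.
Proof.
move=> f g h; apply: fpsP => m; rewrite /fps_mul /fps_add -big_split /=.
by apply: eq_bigr => p _; rewrite mulrDl.
Qed.

Lemma fps_1neq0 : fpsC 1 != 0 :> S.
Proof.
apply/eqP => /(congr1 (fun f : S => f mone)).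
rewrite /fpsC eqxx mulr1n => E; move: (oner_neq0 K); rewrite E.
by rewrite /GRing.zero /= /fpsC mul0rn eqxx.
Qed.

HB.instance Definition _ := GRing.Zmodule_isComNzRing.Build S
  fps_mulA fps_mulC fps_mul1 fps_mulDl fps_1neq0.

(* s is the formal sum of the family (F i), i ranging over P: each monomial
   occurs in finitely many members only, and the coefficients add up. *)
Definition fps_sum (I : eqType) (P : pred I) (F : I -> S) (s : S) : Prop :=
  forall m, exists r : seq I,
    [/\ uniq r, forall i, (i \in r) = P i && (F i m != 0)
      & s m = \sum_(i <- r) F i m].

End PowerSeries.

(* Lambda(X_1) (x) ... (x) Lambda(X_l) over the coefficient ring K, as the free
   commutative algebra on the h_k(X_i) with k >= 1; the variable (i, k) stands
   for h_{k+1}(X_i). *)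
Definition msymf (K : comNzRingType) (l : nat) :=
  {malg K[{cmonom ('I_l * nat)%type}]}.

Definition hX (K : comNzRingType) (l : nat) (i : 'I_l) (k : nat) : msymf K l :=
  if k is k'.+1 then mkmalgU (ucm (i, k')) 1 else 1.

(* A formal sum of signed variables: the positive ones are the a in B with
   ~~ neg a, the negative ones the b in B with neg b. The n-th coefficient in u
   of the factor 1/(1 - u x_a), resp. 1 - u x_b, of the generating function is
   letter_coef _ n times x_a^n. *)
Definition letter_coef (K : comNzRingType) (V : choiceType) (B neg : pred V)
    (a : V) (n : nat) : K :=
  if ~~ B a then (n == 0)%N%:R
  else if neg a then (n == 0)%N%:R - (n == 1)%N%:R
  else 1.

(* h_k[Z] is the coefficient of u^k in
   \prod_(b negative) (1 - u x_b) / \prod_(a positive) (1 - u x_a);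
   distinct variables occur in distinct factors, so x^m comes with u^(deg m)
   and a coefficient that is a product over the variables. *)
Definition h_signed (K : comNzRingType) (V : choiceType) (B neg : pred V)
    (k : nat) : fps V K :=
  fun m => if monalg.mdeg m == k then
             \prod_(a <- finsupp (cmonom_val m))
               letter_coef K B neg a (cmonom_val m a)
           else 0.

(* f[Z_1, ..., Z_l], where H i k = h_k[Z_i]. *)
Definition pleth (K : comNzRingType) (V : choiceType) (l : nat)
    (H : 'I_l -> nat -> fps V K) (f : msymf K l) : fps V K :=
  monalg.mmap (@fpsC V K)
    (fun M => \prod_(x <- finsupp (cmonom_val M))
                H x.1 x.2.+1 ^+ cmonom_val M x) f.

Section PlethTheory.
Variables (K : comNzRingType) (V : choiceType) (l : nat).
Variable H : 'I_l -> nat -> fps V K.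

Lemma fpsC_is_zmod_morphism : zmod_morphism (@fpsC V K).
Proof. by move=> a b; apply: fpsP => m; rewrite /fpsC mulrnBl. Qed.
HB.instance Definition _ := GRing.isZmodMorphism.Build K (fps V K) (@fpsC V K)
  fpsC_is_zmod_morphism.

Lemma fpsC_is_monoid_morphism : monoid_morphism (@fpsC V K).
Proof.
split=> // a b; apply: fpsP => m.
rewrite /GRing.mul /= /fps_mul /fpsC; have [->|m1] := eqVneq m mone.
  have o1 : (mone, mone) \in cm_pairs (mone : {cmonom V}).
    by rewrite mem_cm_pairs /= mul1m.
  rewrite (bigD1_seq _ o1) ?uniq_cm_pairs //= !eqxx big_seq_cond big1 ?addr0 //.
  move=> [d e]; rewrite mem_cm_pairs /= => /andP[/eqP/monalg.mulcm_eq0[-> ->]].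
  by rewrite eqxx.
rewrite big_seq big1 // => -[d e]; rewrite mem_cm_pairs /= => /eqP de.
case: eqP => [d1|_]; last by rewrite mul0r.
case: eqP => [e1|_]; last by rewrite mulr0.
by rewrite -de d1 e1 mul1m eqxx in m1.
Qed.
HB.instance Definition _ := GRing.isMonoidMorphism.Build K (fps V K)
  (@fpsC V K) fpsC_is_monoid_morphism.

Let hmon (M : {cmonom ('I_l * nat)%type}) : fps V K :=
  \prod_(x <- finsupp (cmonom_val M)) H x.1 x.2.+1 ^+ cmonom_val M x.

Lemma hmon_sub (d : {fset ('I_l * nat)%type}) M :
  (finsupp (cmonom_val M) `<=` d)%fset ->
  hmon M = \prod_(x <- d) H x.1 x.2.+1 ^+ cmonom_val M x.
Proof.
move=> sub; rewrite /hmon; apply/esym; rewrite (big_fset_incl _ sub) //.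
by move=> x _; rewrite memNfinsupp => /eqP ->.
Qed.

Lemma hmon_is_mmorphism : mmorphism hmon.
Proof.
split=> [M N|]; last by rewrite /hmon monalg.mdom1 big_seq_fset0.
pose d := (finsupp (cmonom_val M) `|` finsupp (cmonom_val N))%fset.
rewrite (@hmon_sub d) ?monalg.mdomD // (@hmon_sub d M) ?fsubsetUl //.
rewrite (@hmon_sub d N) ?fsubsetUr // -big_split /=.
by apply: eq_bigr => x _; rewrite monalg.cmM exprD.
Qed.
HB.instance Definition _ := isMultiplicative.Build _ _ hmon hmon_is_mmorphism.

Lemma pleth_is_zmod_morphism : zmod_morphism (pleth H).
Proof. by move=> f g; apply: (@monalg.mmapB _ _ _ (@fpsC V K) hmon). Qed.

Lemma pleth_is_monoid_morphism : monoid_morphism (pleth H).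
Proof.
have [h1 h2] := @monalg.mmap_is_multiplicative _ _ _ (@fpsC V K) hmon.
by split; [exact: h2|exact: h1].
Qed.

Lemma plethC c : pleth H (malgC c) = fpsC c.
Proof. exact: (@monalg.mmapC _ _ _ (@fpsC V K) hmon). Qed.

Lemma pleth_hX i k : H i 0%N = 1 -> pleth H (hX K i k) = H i k.
Proof.
move=> H0; case: k => [|k]; first by rewrite H0 pleth_is_monoid_morphism.1.
rewrite /pleth /= (@monalg.mmapU _ _ _ (@fpsC V K)).
rewrite [X in X * _](_ : _ = 1) //.
rewrite mul1r monalg.mdomU big_seq_fset1 /=.
by rewrite monalg.cmUU expr1.
Qed.

End PlethTheory.

Section FractionRepr.
Import generic_quotient.
Variable R : idomainType.
Local Notation tf := (@FracField.tofrac R).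

Lemma frac_repr (f : {fraction R}) : f = tf \n_(repr f) / tf \d_(repr f).
Proof.
have d0 := denom_ratioP (repr f).
apply: (canRL (mulfK _)); first by rewrite tofrac_eq0.
rewrite -[X in X * _]reprK; set x := repr f; rewrite -/x in d0.
rewrite /FracField.tofrac; unlock; rewrite -[LHS]FracField.pi_mul.
apply/eqmodP; rewrite /= FracField.equivfE /FracField.mulf.
by rewrite !numden_Ratio ?mulf_neq0 ?oner_neq0 // !mulr1 mulrC.
Qed.
End FractionRepr.

Section HeckeIdentities.
Variables (F : fieldType) (T a b : F) (s : F -> F).
Let H (f : F) : F := T * s f + (1 - T) / (1 - a / b) * (s f - f).
Hypothesis sD : forall f g, s (f + g) = s f + s g.
Hypothesis sM : forall f g, s (f * g) = s f * s g.
Hypothesis sT : s T = T.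
Hypotheses (sa : s a = b) (sb : s b = a).
Hypothesis sK : forall f, s (s f) = f.
Hypotheses (a0 : a != 0) (b0 : b != 0) (ab : a - b != 0).

Lemma hecke_quad_identity f : H (H f) = (T - 1) * H f + T * f.
Proof.
have s0 : s 0 = 0 by apply: (addrI (s 0)); rewrite -sD !addr0.
have sN g : s (- g) = - s g by apply/eqP; rewrite -addr_eq0 -sD addNr s0.
have s1 : s 1 = 1.
  by apply: (mulIf a0); rewrite -{1}sb -sM !mul1r sb.
have sV g : s g^-1 = (s g)^-1.
  have [->|g0] := eqVneq g 0; first by rewrite invr0 s0 invr0.
  have sg0 : s g != 0 by apply: contra_neq g0 => E; rewrite -(sK g) E s0.
  by apply: (mulIf sg0); rewrite -sM !mulVf.
have sE : s (H f) = T * f + (1 - T) / (1 - b / a) * (f - s f).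
  by rewrite /H !(sD, sN, sM, sV, s1, sT, sa, sb, sK).
rewrite {1}/H sE /H; move: (s f) => g.
have ba : b - a != 0 by rewrite -oppr_eq0 opprB.
have -> : 1 - a / b = (b - a) / b by rewrite mulrBl divff.
have -> : 1 - b / a = (a - b) / a by rewrite mulrBl divff.
by field; rewrite ?a0 ?b0 ?ab ?ba.
Qed.

Lemma hecke_add f g : H (f + g) = H f + H g.
Proof. by rewrite /H sD; ring. Qed.
Lemma hecke_scale f : H (T * f) = T * H f.
Proof. by rewrite /H sM sT; ring. Qed.

End HeckeIdentities.

Section HeckeInverse.
Variables (F : fieldType) (T : F) (H : F -> F).
Hypothesis H2 : forall f, H (H f) = (T - 1) * H f + T * f.
Hypothesis T0 : T != 0.
Let Hi (f : F) : F := T^-1 * (H f + (1 - T) * f).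

Lemma hecke_invl : cancel H Hi.
Proof. by move=> f; rewrite /Hi H2; move: (H f) => g; field. Qed.

Hypothesis HD : forall f g, H (f + g) = H f + H g.
Hypothesis HZ : forall f, H (T * f) = T * H f.

Lemma hecke_invr : cancel Hi H.
Proof.
move=> f; apply: (mulfI T0); rewrite -HZ /Hi mulVKf // HD H2.
have -> : H ((1 - T) * f) = H f - T * H f.
  by apply/eqP; rewrite -subr_eq opprK -HZ -HD mulrBl mul1r subrK.
by ring.
Qed.
End HeckeInverse.

Section Hecke.
Variables (K : fieldType) (t : K) (l : nat).

(* K(z_1, ..., z_l); the index i : 'I_l stands for z_{i+1}. *)
Definition zfield : fieldType := {fraction (mpoly l K)}.
Implicit Types (f g : zfield) (w v : 'S_l).

Definition zscal (c : K) : zfield := FracField.tofrac (c%:MP : mpoly l K).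
Definition zvar (i : 'I_l) : zfield := FracField.tofrac ('X_i : mpoly l K).

Definition wt := {ffun 'I_l -> int}.

Definition zmon (la : wt) : zfield := \prod_(i < l) zvar i ^ la i.

(* Permutation of the variables: z_i becomes z_{w(i)}. *)
Definition zperm (w : 'S_l) (f : zfield) : zfield :=
  FracField.tofrac (msym w \n_(generic_quotient.repr f)) /
  FracField.tofrac (msym w \d_(generic_quotient.repr f)).

Definition ell (w : 'S_l) : nat :=
  #|[set ij : 'I_l * 'I_l | (ij.1 < ij.2)%N && (w ij.2 < w ij.1)%N]|.

(* i : 'I_l.-1 stands for i + 1; s_i exchanges the positions s_lo i, s_hi i. *)
Lemma s_lo_subproof (i : 'I_l.-1) : (i < l)%N.
Proof. by apply: leq_trans (ltn_ord i) (leq_pred l). Qed.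
Lemma s_hi_subproof (i : 'I_l.-1) : (i.+1 < l)%N.
Proof. by case: l i => [[]|n] //= i; rewrite ltnS. Qed.
Definition s_lo (i : 'I_l.-1) : 'I_l := Ordinal (s_lo_subproof i).
Definition s_hi (i : 'I_l.-1) : 'I_l := Ordinal (s_hi_subproof i).

Definition simple (i : 'I_l.-1) : 'S_l := tperm (s_lo i) (s_hi i).

Definition heckeT (i : 'I_l.-1) (f : zfield) : zfield :=
  zscal t * zperm (simple i) f
  + (1 - zscal t) / (1 - zvar (s_lo i) / zvar (s_hi i))
    * (zperm (simple i) f - f).

(* The inverse of T_i (see heckeTK and heckeTinvK), by
   (T_i - t)(T_i + 1) = 0. *)
Definition heckeTinv (i : 'I_l.-1) (f : zfield) : zfield :=
  (zscal t)^-1 * (heckeT i f + (1 - zscal t) * f).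

(* A word i_1, ..., i_k with w = s_{i_1} o ... o s_{i_k} and k = ell w. *)
Definition is_word_for (w : 'S_l) (u : seq 'I_l.-1) : bool :=
  [forall x, foldr (fun i y => simple i y) x u == w x].
Definition reduced_word (w : 'S_l) : seq 'I_l.-1 :=
  if [pick u : (ell w).-tuple 'I_l.-1 | is_word_for w u] is Some u
  then tval u else [::].

(* \overline{T_w} *)
Definition Tbar (w : 'S_l) (f : zfield) : zfield :=
  foldr heckeTinv f (reduced_word w).

(* (w la)_{w(i)} = la_i *)
Definition wt_act (w : 'S_l) (la : wt) : wt := [ffun i => la ((w^-1)%g i)].

(* The weakly increasing rearrangement la_-. *)
Definition wt_inc (la : wt) : wt :=
  [ffun i : 'I_l => nth 0 (sort <=%R [seq la j | j <- enum 'I_l]) i].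

(* The minimal length v with v(la_-) = la. *)
Definition min_perm (la : wt) : 'S_l :=
  odflt 1%g [pick v : 'S_l | (wt_act v (wt_inc la) == la) &
    [forall v' : 'S_l, (wt_act v' (wt_inc la) == la) ==> (ell v <= ell v')%N]].

(* F_la(z; t^-1) *)
Definition Ffun (la : wt) : zfield := Tbar (min_perm la) (zmon (wt_inc la)).

(* The expansion of a Laurent polynomial g in the basis (F_la); junk value 0 if
   g is not a linear combination of the F_la. *)
Definition Fexp (g : zfield) : {malg K[wt]} :=
  classical_sets.xget 0 (fun c : {malg K[wt]} =>
    g = \sum_(la <- monalg.msupp c) zscal (monalg.mcoeff la c) * Ffun la).
Definition Fcoef (la : wt) (g : zfield) : K := monalg.mcoeff la (Fexp g).

Local Notation tf := (@FracField.tofrac (mpoly l K)).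

Lemma msym_eq0 w (p : mpoly l K) : (msym w p == 0) = (p == 0).
Proof. by rewrite -[RHS](inj_eq (@inj_msym _ _ w)) msym0. Qed.

Lemma zperm_frac w (p q : mpoly l K) : q != 0 ->
  zperm w (tf p / tf q) = tf (msym w p) / tf (msym w q).
Proof.
move=> q0; rewrite /zperm; set f := tf p / tf q.
have d0 := denom_ratioP (generic_quotient.repr f).
have := frac_repr f; rewrite {1}/f.
set n := \n_ _; set d := \d_ _ => /eqP.
rewrite eqr_div ?tofrac_eq0 // -!tofracM tofrac_eq => /eqP E.
apply/eqP; rewrite eqr_div ?tofrac_eq0 ?msym_eq0 // -!tofracM tofrac_eq.
by rewrite -!msymM E.
Qed.

Lemma zperm_is_zmod_morphism w : zmod_morphism (zperm w).
Proof.
move=> f g; rewrite (frac_repr f) (frac_repr g).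
have d1 := denom_ratioP (generic_quotient.repr f).
have d2 := denom_ratioP (generic_quotient.repr g).
set a := \n_ _; set b := \d_ _ in d1 *; set c := \n_ _; set d := \d_ _ in d2 *.
have nz r : r != 0 -> tf (msym w r) != 0.
  by rewrite tofrac_eq0 msym_eq0.
rewrite -mulNr addf_div ?tofrac_eq0 // -rmorphN -!rmorphM -rmorphD.
rewrite !zperm_frac ?mulf_neq0 // msymD !msymM msymN.
by rewrite -[in RHS]mulNr addf_div ?nz // !rmorphD !rmorphM !rmorphN.
Qed.

Lemma zperm_is_monoid_morphism w : monoid_morphism (zperm w).
Proof.
have z1 : zperm w 1 = 1.
  have -> : 1 = tf 1 / tf 1 :> zfield by rewrite divff // oner_neq0.
  by rewrite zperm_frac ?oner_neq0 // !msym1.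
split=> // f g; rewrite (frac_repr f) (frac_repr g).
have d1 := denom_ratioP (generic_quotient.repr f).
have d2 := denom_ratioP (generic_quotient.repr g).
set a := \n_ _; set b := \d_ _ in d1 *; set c := \n_ _; set d := \d_ _ in d2 *.
rewrite mulf_div -!rmorphM !zperm_frac ?mulf_neq0 // !msymM !rmorphM.
by rewrite mulf_div.
Qed.

HB.instance Definition _ w := GRing.isZmodMorphism.Build zfield zfield (zperm w)
  (zperm_is_zmod_morphism w).
HB.instance Definition _ w := GRing.isMonoidMorphism.Build zfield zfield
  (zperm w) (zperm_is_monoid_morphism w).

Lemma zperm_tofrac w p : zperm w (tf p) = tf (msym w p).
Proof.
have -> : tf p = tf p / tf 1 by rewrite rmorph1 divr1.
by rewrite zperm_frac ?oner_neq0 // msym1 rmorph1 divr1.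
Qed.

Lemma zperm_scal w c : zperm w (zscal c) = zscal c.
Proof. by rewrite /zscal zperm_tofrac /msym mmapC. Qed.

Lemma zperm_var w i : zperm w (zvar i) = zvar (w i).
Proof. by rewrite /zvar zperm_tofrac /msym mmapX mmap1U. Qed.

Lemma zperm_mul v w f : zperm (v * w)%g f = zperm w (zperm v f).
Proof.
have d0 := denom_ratioP (generic_quotient.repr f).
rewrite (frac_repr f); move: \n_ _ \d_ _ d0 => p q q0.
have q1 : msym v q != 0 by rewrite msym_eq0.
apply: (etrans (zperm_frac (v * w) p q0)); rewrite !msymMm.
apply: (etrans (esym (zperm_frac w (msym v p) q1))).
by congr zperm; apply/esym/zperm_frac.
Qed.

Lemma zperm1 f : zperm 1 f = f.
Proof. by rewrite {2}(frac_repr f) /zperm !msym1m. Qed.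

Lemma simpleK i f : zperm (simple i) (zperm (simple i) f) = f.
Proof. by rewrite -zperm_mul tperm2 zperm1. Qed.

Lemma zvar_neq0 i : zvar i != 0.
Proof. by rewrite tofrac_eq0 -msize_poly_eq0 msizeX mdeg1. Qed.

Lemma zvar_inj i j : i != j -> zvar i - zvar j != 0.
Proof.
move=> ij; rewrite subr_eq0 tofrac_eq.
apply/eqP => /(congr1 (mpoly.mcoeff (mnm1 i))).
rewrite !mpoly.mcoeffXU eqxx eq_sym (negbTE ij).
by move/eqP; rewrite oner_eq0.
Qed.

Lemma s_lo_hi i : s_lo i != s_hi i.
Proof. by rewrite -val_eqE /= neq_ltn ltnSn. Qed.

Lemma heckeT_quad i f :
  heckeT i (heckeT i f) = (zscal t - 1) * heckeT i f + zscal t * f.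
Proof.
apply: hecke_quad_identity.
- by move=> g h; apply: (rmorphD (zperm (simple i))).
- by move=> g h; apply: (rmorphM (zperm (simple i))).
- exact: zperm_scal.
- by rewrite zperm_var tpermL.
- by rewrite zperm_var tpermR.
- exact: simpleK.
- exact: zvar_neq0.
- exact: zvar_neq0.
- exact/zvar_inj/s_lo_hi.
Qed.

Hypothesis t_neq0 : t != 0.

Lemma zscal_t_neq0 : zscal t != 0.
Proof. by rewrite tofrac_eq0 mpolyC_eq0. Qed.

Lemma heckeTinvK i : cancel (heckeTinv i) (heckeT i).
Proof.
apply: (@hecke_invr _ (zscal t) (heckeT i) (heckeT_quad i) zscal_t_neq0) => [g h|g].
  by apply: hecke_add => g' h'; apply: (rmorphD (zperm (simple i))).
apply: hecke_scale => [g' h'|].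
  by apply: (rmorphM (zperm (simple i))).
exact: zperm_scal.
Qed.

Lemma heckeTK i : cancel (heckeT i) (heckeTinv i).
Proof. exact: (@hecke_invl _ (zscal t) (heckeT i) (heckeT_quad i) zscal_t_neq0). Qed.

End Hecke.

(* A diagram beta/alpha is the list of its rows (alpha_j, beta_j), bottom to
   top; a tuple of diagrams is a list of diagrams. *)
Definition ragged_right (D : seq (int * int)) : bool :=
  [&& (0 < size D)%N, all (fun r => r.1 <= r.2) D
    & sorted (fun r r' => (r'.1 <= r.1) && (r'.2 <= r.2 + 1)) D].

Section IndexingData.
Variable nu : seq (seq (int * int)).

(* Rows are numbered from 0: p : 'I_nrows stands for row p + 1. *)
Definition nrows : nat := size (flatten nu).
Implicit Types (p q : 'I_nrows) (sigma : 'S_nrows).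

Definition alpha p : int := (nth (0, 0) (flatten nu) p).1.
Definition beta p : int := (nth (0, 0) (flatten nu) p).2.
Definition row_comp p : nat := reshape_index (shape nu) p.
(* The height j >= 1 of row p in its component. *)
Definition rowno p : nat := (reshape_offset (shape nu) p).+1.

Definition gamma : wt nrows := [ffun p => alpha p + 1 - (rowno p)%:Z].
Definition eta : wt nrows := [ffun p => beta p + 1 - (rowno p)%:Z].

(* Tagged p n is the box of row p in column alpha_p + 1 + n. *)
Definition box := {p : 'I_nrows & 'I_`|beta p - alpha p|%N}.
(* The boxes of nu'; inr p is the flag box of row p. *)
Definition xbox := (box + 'I_nrows)%type.

Definition xrow (y : xbox) : 'I_nrows :=
  match y with inl x => tag x | inr p => p end.
Definition xcol (y : xbox) : int :=
  match y with
  | inl x => alpha (tag x) + 1 + (tagged x : nat)%:Z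
  | inr p => beta p + 1
  end.
Definition content (y : xbox) : int := xcol y - (rowno (xrow y))%:Z.

(* The Young subgroup S_r. *)
Definition young : {set 'S_nrows} :=
  [set w : 'S_nrows | [forall p : 'I_nrows, row_comp (w p) == row_comp p]].

Definition compatible sigma : bool :=
  [forall p : 'I_nrows, forall q : 'I_nrows,
    (p <= q)%N ==> (eta (sigma p) <= eta (sigma q))] &&
  [forall p : 'I_nrows, forall q : 'I_nrows,
    (val q == p.+1) && (row_comp p == row_comp q) ==>
    ((sigma^-1)%g q < (sigma^-1)%g p)%N].

(* The flag number l + 1 - sigma^-1(p); it lies between 1 and l. *)
Definition flagno sigma p : nat := (nrows - (sigma^-1)%g p)%N.

Definition h_stat : nat :=
  #|[set yz : box * xbox | (row_comp (tag yz.1) < row_comp (xrow yz.2))%N &&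
                           (content (inl yz.1) == content yz.2)]|.

Definition e_stat sigma : nat :=
  #|[set pq : 'I_nrows * 'I_nrows |
      [&& (pq.1 < pq.2)%N, row_comp pq.1 != row_comp pq.2, eta pq.1 == eta pq.2
        & ((sigma^-1)%g pq.2 < (sigma^-1)%g pq.1)%N]]|.

End IndexingData.

(* The part of degree d in the X_i of
     Omega[\sum_(1 <= i <= j <= l) X_i / z_{l+1-j}]
       = \prod_(i <= j) \sum_k h_k(X_i) z_{l+1-j}^-k,
   a multi-symmetric function with coefficients in the field of the z_i;
   with indices from 0, l + 1 - j becomes rev_ord j. *)
Definition Omega_deg (K : fieldType) (l d : nat) : msymf (zfield K l) l :=
  \sum_(k : {ffun 'I_l * 'I_l -> 'I_d.+1} |
         (\sum_(ij : 'I_l * 'I_l) (k ij : nat) == d)%N &&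
         [forall ij : 'I_l * 'I_l, (ij.2 < ij.1)%N ==> (k ij == 0 :> nat)%N])
    \prod_(ij : 'I_l * 'I_l | (ij.1 <= ij.2)%N)
       (zvar K (rev_ord ij.2) ^- k ij *: hX (zfield K l) ij.1 (k ij)).

Definition coefwise (K K' : comNzRingType) (l : nat) (phi : K -> K')
    (f : msymf K l) : msymf K' l :=
  \sum_(M <- monalg.msupp f) mkmalgU M (phi (monalg.mcoeff M f)).

Section FlaggedLLT.
Variables (K : fieldType) (t : K).
Variables (nu : seq (seq (int * int))) (sigma : 'S_(nrows nu)).

Definition flagged_LLT_deg (d : nat) : msymf K (nrows nu) :=
  t ^+ (h_stat nu + e_stat sigma) *:
  \sum_(w in young nu) (-1) ^+ ell w *:
    coefwise (fun c => Fcoef t (wt_act w (gamma nu))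
                         (Tbar t sigma (c * zmon K (wt_inc (eta nu)))))
             (Omega_deg K (nrows nu) d).

(* G_{nu,sigma}(X_1, ..., X_l; t): the sum over all d of its parts of degree d;
   all but finitely many are 0, since the T_i preserve degree and F_la is
   homogeneous of degree |la|. *)
Definition flagged_LLT : msymf K (nrows nu) :=
  \sum_(d <- fsbigop.finite_support 0 classical_sets.setT flagged_LLT_deg)
    flagged_LLT_deg d.

End FlaggedLLT.

Section Tableaux.
Variables (nu : seq (seq (int * int))) (sigma : 'S_(nrows nu)).
Variables (disp : Order.disp_t) (A : orderType disp).
(* neg is A^-, its complement A^+; Asub i is A_{i+1}. *)
Variables (neg : pred A) (Asub : 'I_(nrows nu) -> pred A).
Implicit Types (x y : box nu) (T : {ffun box nu -> A}).

Definition admissible (i : nat) x : bool :=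
  (i <= flagno sigma (tag x))%N &&
  [forall q : 'I_(nrows nu),
    [&& row_comp q == row_comp (tag x), xcol (inr q) == xcol (inl x)
      & (rowno q < rowno (tag x))%N] ==> (flagno sigma q < i)%N].

Definition row_ok T : bool :=
  [forall x : box nu, forall y : box nu,
    (tag x == tag y) && (xcol (inl x) < xcol (inl y)) ==>
    (T x <= T y)%O && ((T x == T y) ==> ~~ neg (T x))].

Definition col_ok T : bool :=
  [forall x : box nu, forall y : box nu,
    [&& row_comp (tag x) == row_comp (tag y), xcol (inl x) == xcol (inl y)
      & (rowno (tag x) < rowno (tag y))%N] ==>
    (T x <= T y)%O && ((T x == T y) ==> neg (T x))].

Definition flag_ok T : bool :=
  [forall x : box nu, [exists i : 'I_(nrows nu), Asub i (T x)] &&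
             [forall i : 'I_(nrows nu), Asub i (T x) ==> admissible i.+1 x]].

Definition FST : pred {ffun box nu -> A} :=
  fun T => [&& row_ok T, col_ok T & flag_ok T].

Definition attacking x (y : xbox nu) : bool :=
  ((row_comp (tag x) < row_comp (xrow y))%N && (content y == content (inl x))) ||
  ((row_comp (xrow y) < row_comp (tag x))%N && (content y == content (inl x) + 1)).

Definition attacking_inversion T x (y : xbox nu) : bool :=
  attacking x y &&
  match y with
  | inl y' => (T y' < T x)%O || (T x == T y') && neg (T x)
  | inr q => [exists s : 'I_(nrows nu),
                (flagno sigma q < s.+1)%N && Asub s (T x)]
  end.

Definition inv_stat T : nat :=
  #|[set xy : box nu * xbox nu | attacking_inversion T xy.1 xy.2]|.

Definition mneg T : nat := #|[set x : box nu | neg (T x)]|.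

Definition xmon T : {cmonom A} := \big[mmul/mone]_(x : box nu) ucm (T x).

(* (-1)^m(T) t^inv(T) x^T *)
Definition FST_term (K : fieldType) (t : K) T : fps A K :=
  fun m => (-1) ^+ mneg T * t ^+ inv_stat T *+ (m == xmon T).

End Tableaux.

Definition Qt : fieldType := {fraction {poly rat}}.
Definition tQ : Qt := FracField.tofrac 'X.

(* Main.v *)
(* Fix a monomial x. The kernel Omega factors over letters: at x, a letter of A_i with exponent n
   contributes h_n (positive letter) or (-1)^n e_n (negative letter) of the variables z_p^-1,
   p <= l + 1 - i. A Pieri rule for e_n(z_1^-1, ..., z_m^-1) F_la, transported through Tbar_sigma,
   describes the effect of such a factor on the antisymmetrized coefficients: one adds a vertical
   strip to the rows p with sigma^-1(p) <= m (the active rows, here numbered from 0), the irregular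
   weights cancelling in pairs; the rule for h_n follows from \sum_i (-1)^i e_i h_{n-i} = 0 by a
   sign-reversing involution. A row must have reached eta_p when it becomes inactive.
   Treating the letters in increasing order, the coefficient at x becomes a sum over chains of
   weights from gamma to eta. Such chains are the flagged tableaux T with x^T = x: the weight before
   the letter a is gamma_p + #{boxes of row p with entry < a}, and the conditions on the steps
   encode the column and flag conditions. The power of t is compared one pair (box u, row q) at a
   time: if row q lies in a later component and meets the content c of u (gamma_q <= c <= eta_q),
   then exactly one of the following holds: u attacks row q with an inversion, the entry of content
   c - 1 in row q attacks u with an inversion, or the pair is counted by the step of the letter T(u). *)
Require Import Defs.
From mathcomp Require Import all_boot all_order all_algebra all_fingroup.
From mathcomp Require boolp classical_sets cardinality fsbigop.
From mathcomp Require Import finmap ring zify.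
From mathcomp Require Import monalg.
From mathcomp Require Import mpoly.

Set Implicit Arguments.
Unset Strict Implicit.
Unset Printing Implicit Defensive.

Import Order.TTheory GRing.Theory Num.Theory.
Local Open Scope ring_scope.

(** * Hecke operators *)

(** The rule for e_n comes first because a vertical strip changes each weight by at most 1:
    subtracted from a sorted weight it leaves descents of size at most 1, and there F_la is a single
    monomial. Horizontal shifts offer no such base case. Multiplication by e_n(z_1^-1, ..., z_m^-1)
    commutes with T_i for i different from m only, so the rule is restricted to weights without a
    descent across position m: every active entry is at most every inactive one. Multiplication
    keeps this, since it lowers active entries only; enlarging m keeps it, since eta o sigma
    increases and a row still carries eta when it becomes active. The factors therefore act on
    z^{eta_-} in the order of increasing m, from the last letter to the first, whereas the chains
    are read from gamma, in the opposite direction. *)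

Section BraidIdentity.
Variables (F : fieldType) (T a b c : F) (s1 s2 : F -> F).
Hypothesis s1D : forall f g, s1 (f + g) = s1 f + s1 g.
Hypothesis s1M : forall f g, s1 (f * g) = s1 f * s1 g.
Hypothesis s2D : forall f g, s2 (f + g) = s2 f + s2 g.
Hypothesis s2M : forall f g, s2 (f * g) = s2 f * s2 g.
Hypotheses (s1T : s1 T = T) (s2T : s2 T = T).
Hypotheses (s1a : s1 a = b) (s1b : s1 b = a) (s1c : s1 c = c).
Hypotheses (s2a : s2 a = a) (s2b : s2 b = c) (s2c : s2 c = b).
Hypotheses (s1K : forall f, s1 (s1 f) = f) (s2K : forall f, s2 (s2 f) = f).
Hypothesis sB : forall f, s1 (s2 (s1 f)) = s2 (s1 (s2 f)).
Hypotheses (a0 : a != 0) (b0 : b != 0) (c0 : c != 0).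
Hypotheses (ab : a - b != 0) (bc : b - c != 0) (ac : a - c != 0).
Let H1 (f : F) : F := T * s1 f + (1 - T) / (1 - a / b) * (s1 f - f).
Let H2 (f : F) : F := T * s2 f + (1 - T) / (1 - b / c) * (s2 f - f).

(** Moving [s1] and [s2] inwards writes both sides as combinations of the six images of [f] under
    the group they generate, with coefficients rational in a, b, c, T. With the images as free
    variables, a field identity remains. *)
Lemma hecke_braid_identity f : H1 (H2 (H1 f)) = H2 (H1 (H2 f)).
Proof.
have gen (s : F -> F) : (forall f g, s (f + g) = s f + s g) ->
    (forall f g, s (f * g) = s f * s g) -> (forall f, s (s f) = f) ->
    [/\ forall g, s (- g) = - s g, s 1 = 1 & forall g, s g^-1 = (s g)^-1].
  move=> sD sM sK.
  have s0 : s 0 = 0 by apply: (addrI (s 0)); rewrite -sD !addr0.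
  have sN g : s (- g) = - s g by apply/eqP; rewrite -addr_eq0 -sD addNr s0.
  have sone : s 1 = 1.
    have u : s 1 != 0.
      by apply/eqP => E; move: (sK 1); rewrite E s0 => /eqP; rewrite eq_sym oner_eq0.
    by apply: (mulfI u); rewrite -sM !mulr1.
  have sV g : s g^-1 = (s g)^-1.
    have [->|g0] := eqVneq g 0; first by rewrite invr0 s0 invr0.
    have sg0 : s g != 0 by apply: contra_neq g0 => E; rewrite -(sK g) E s0.
    by apply: (mulIf sg0); rewrite -sM !mulVf.
  by [].
have [s1N s11 s1V] := gen _ s1D s1M s1K.
have [s2N s21 s2V] := gen _ s2D s2M s2K.
have E1 := (s1D, s1M, s1N, s1V, s11, s1T, s1a, s1b, s1c, s1K).
have E2 := (s2D, s2M, s2N, s2V, s21, s2T, s2a, s2b, s2c, s2K).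
rewrite /H1 /H2 !(E1, E2, sB).
have e1 : 1 - a / b = - (a - b) / b by rewrite mulNr mulrBl divff // opprB.
have e2 : 1 - b / c = - (b - c) / c by rewrite mulNr mulrBl divff // opprB.
have e3 : 1 - a / c = - (a - c) / c by rewrite mulNr mulrBl divff // opprB.
have e4 : 1 - b / a = (a - b) / a by rewrite mulrBl divff.
have e5 : 1 - c / b = (b - c) / b by rewrite mulrBl divff.
have e6 : 1 - c / a = (a - c) / a by rewrite mulrBl divff.
rewrite !(e1, e2, e3, e4, e5, e6).
move: (s2 (s1 (s2 f))) (s1 (s2 f)) (s2 (s1 f)) (s1 f) (s2 f) => f1 f2 f3 f4 f5.
field.
by rewrite ?oppr_eq0 ?a0 ?b0 ?c0 ?ab ?bc ?ac.
Qed.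
End BraidIdentity.

Section SimpleTranspositions.
Variable l : nat.
Implicit Types (i j : 'I_l.-1) (p q : 'I_l) (la mu : wt l).

Lemma simple_lo i : simple i (s_lo i) = s_hi i.
Proof. exact: tpermL. Qed.
Lemma simple_hi i : simple i (s_hi i) = s_lo i.
Proof. exact: tpermR. Qed.
Lemma simple_id i p : p != s_lo i -> p != s_hi i -> simple i p = p.
Proof. by move=> h1 h2; rewrite /simple tpermD // eq_sym. Qed.
Lemma simpleV i : ((simple i)^-1)%g = simple i.
Proof. exact: tpermV. Qed.
Lemma simple2 i p : simple i (simple i p) = p.
Proof. exact: tpermK. Qed.
Lemma s_lo_lt_hi i : (s_lo i < s_hi i)%N. Proof. by rewrite /= ltnSn. Qed.

Variant simple_spec i p : bool -> bool -> 'I_l -> Prop :=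
| SimpleLo of p = s_lo i : simple_spec i p true false (s_hi i)
| SimpleHi of p = s_hi i : simple_spec i p false true (s_lo i)
| SimpleNo of p != s_lo i & p != s_hi i : simple_spec i p false false p.

Lemma simpleP i p : simple_spec i p (p == s_lo i) (p == s_hi i) (simple i p).
Proof.
have [->|n1] := eqVneq p (s_lo i).
  by rewrite (negbTE (s_lo_hi i)) simple_lo; constructor.
have [->|n2] := eqVneq p (s_hi i); first by rewrite simple_hi; constructor.
by rewrite simple_id //; constructor.
Qed.

Lemma val_simple i p : simple i p = (if p == i :> nat then i.+1
  else if p == i.+1 :> nat then nat_of_ord i else nat_of_ord p) :> nat.
Proof.
case: simpleP => [->|->|] /=; first by rewrite eqxx.
  by rewrite eqn_leq ltnn eqxx.
by rewrite -!val_eqE /= => /negbTE -> /negbTE ->.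
Qed.

Lemma simple_lt i p q : (p < q)%N -> ~~ ((p == s_lo i) && (q == s_hi i)) ->
  (simple i p < simple i q)%N.
Proof.
rewrite -!val_eqE /= !val_simple => pq.
by do 4?case: ifP => /eqP; lia.
Qed.

Lemma wt_act_simple i la p : wt_act (simple i) la p = la (simple i p).
Proof. by rewrite ffunE simpleV. Qed.

Lemma wt_act1 la : wt_act 1%g la = la.
Proof. by apply/ffunP => p; rewrite ffunE invg1 perm1. Qed.

Lemma wt_actM v w la : wt_act (v * w)%g la = wt_act w (wt_act v la).
Proof. by apply/ffunP => p; rewrite !ffunE invMg permM. Qed.

Lemma wt_actK v la : wt_act (v^-1)%g (wt_act v la) = la.
Proof. by rewrite -wt_actM mulgV wt_act1. Qed.

Lemma wt_simpleK i la : wt_act (simple i) (wt_act (simple i) la) = la.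
Proof. by rewrite -{1}(simpleV i) wt_actK. Qed.

Lemma simple_comm i j : (i.+1 < j)%N -> (simple i * simple j = simple j * simple i)%g.
Proof.
move=> ij; apply/permP => p; apply: val_inj; rewrite !permM /= !val_simple.
by repeat case: ifP => /eqP; lia.
Qed.

Lemma simple_braid i j : (j = i.+1 :> nat) ->
  (simple i * simple j * simple i = simple j * simple i * simple j)%g.
Proof.
move=> ij; apply/permP => p; apply: val_inj; rewrite !permM /= !val_simple ij.
by repeat case: ifP => /eqP; lia.
Qed.
End SimpleTranspositions.

Section HeckeInverseIdentities.
Variable F : fieldType.
Implicit Types (T f g D E : F).

(** In this lemma [g] stands for s_i f and [E] for (1 - z_i/z_{i+1})^-1. In the next two a prime
    marks the image under s_i, and [D] is t^-1 (1 - t). *)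
Lemma hecke_inv_identity T f g E : T != 0 ->
  T^-1 * (T * g + (1 - T) * E * (g - f) + (1 - T) * f) =
  g + T^-1 * (1 - T) * ((g - f) * E + f).
Proof. by move=> T0; field. Qed.

Lemma hecke_inv_add_identity D E f f' g g' :
  f' + g' + D * ((f' + g' - (f + g)) * E + (f + g)) =
  f' + D * ((f' - f) * E + f) + (g' + D * ((g' - g) * E + g)).
Proof. by ring. Qed.

Lemma hecke_inv_sym_identity D E f f' g :
  g * f' + D * ((g * f' - g * f) * E + g * f) = g * (f' + D * ((f' - f) * E + f)).
Proof. by ring. Qed.

Lemma hecke_inv_comm_identity (s1 s2 : F -> F) D E1 E2 f :
  (forall f g, s1 (f + g) = s1 f + s1 g) -> (forall f g, s1 (f * g) = s1 f * s1 g) ->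
  (forall f, s1 (- f) = - s1 f) ->
  (forall f g, s2 (f + g) = s2 f + s2 g) -> (forall f g, s2 (f * g) = s2 f * s2 g) ->
  (forall f, s2 (- f) = - s2 f) ->
  (forall f, s1 (s2 f) = s2 (s1 f)) ->
  s1 D = D -> s2 D = D -> s1 E2 = E2 -> s2 E1 = E1 ->
  let H1 g := s1 g + D * ((s1 g - g) * E1 + g) in
  let H2 g := s2 g + D * ((s2 g - g) * E2 + g) in
  H1 (H2 f) = H2 (H1 f).
Proof.
move=> s1D s1M s1N s2D s2M s2N C d1 d2 e1 e2 /=.
rewrite !(s1D, s1M, s1N, s2D, s2M, s2N) d1 d2 e1 e2 C; ring.
Qed.

Lemma hecke_inv_fix_identity T f : T != 0 -> f + T^-1 * (1 - T) * f = T^-1 * f.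
Proof. by move=> T0; field. Qed.
End HeckeInverseIdentities.

Section HeckeOperators.
Variables (K : fieldType) (t : K) (l : nat).
Hypothesis t0 : t != 0.
Implicit Types (i j : 'I_l.-1) (f g : zfield K l) (la mu : wt l) (w : 'S_l).
Local Notation TI := (heckeTinv t).
Local Notation sc := (@zscal K l).

Lemma zscalD c d : sc (c + d) = sc c + sc d.
Proof. by rewrite /zscal mpolyCD rmorphD. Qed.
Lemma zscalM c d : sc (c * d) = sc c * sc d.
Proof. by rewrite /zscal mpolyCM rmorphM. Qed.
Lemma zscal1 : sc 1 = 1.
Proof. by rewrite /zscal mpolyC1 rmorph1. Qed.
Lemma zscal0 : sc 0 = 0.
Proof. by rewrite /zscal mpolyC0 rmorph0. Qed.
Lemma zscalN c : sc (- c) = - sc c.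
Proof. by rewrite /zscal mpolyCN rmorphN. Qed.
Lemma zscalV c : sc c^-1 = (sc c)^-1.
Proof.
have [->|c0] := eqVneq c 0; first by rewrite invr0 zscal0 invr0.
have u : sc c != 0 by rewrite tofrac_eq0 mpolyC_eq0.
by apply: (mulIf u); rewrite mulVf // -zscalM mulVf // zscal1.
Qed.
Lemma zscal_sum (I : Type) (r : seq I) (P : pred I) (c : I -> K) :
  sc (\sum_(i <- r | P i) c i) = \sum_(i <- r | P i) sc (c i).
Proof. by apply: (big_morph sc zscalD zscal0). Qed.

Lemma zpermD w f g : zperm w (f + g) = zperm w f + zperm w g.
Proof. exact: (rmorphD (zperm w)). Qed.
Lemma zpermN w f : zperm w (- f) = - zperm w f.
Proof. exact: (rmorphN (zperm w)). Qed.
Lemma zpermM w f g : zperm w (f * g) = zperm w f * zperm w g.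
Proof. exact: (rmorphM (zperm w)). Qed.
Lemma zpermV w f : zperm w f^-1 = (zperm w f)^-1.
Proof. exact: (fmorphV (zperm w)). Qed.
Lemma zperm_one w : zperm w 1 = 1 :> zfield K l.
Proof. exact: (rmorph1 (zperm w)). Qed.
Lemma zpermX w f n : zperm w (f ^+ n) = zperm w f ^+ n.
Proof. exact: (rmorphXn (zperm w)). Qed.

Lemma heckeTinvE i f : TI i f = zperm (simple i) f + (sc t)^-1 * (1 - sc t) *
  ((zperm (simple i) f - f) / (1 - zvar K (s_lo i) / zvar K (s_hi i)) + f).
Proof.
have tz := zscal_t_neq0 l t0.
rewrite /heckeTinv /heckeT.
exact: hecke_inv_identity.
Qed.

Lemma heckeTinvD i f g : TI i (f + g) = TI i f + TI i g.
Proof.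
rewrite !heckeTinvE zpermD.
exact: hecke_inv_add_identity.
Qed.

(** An s_i-invariant factor comes out of both s_i f and the divided difference. This is how
    e_k(z_1^-1, ..., z_m^-1) passes through every T_i that does not mix the first m variables with
    the others. *)
Lemma heckeTinvM_sym i f g : zperm (simple i) g = g -> TI i (g * f) = g * TI i f.
Proof.
move=> sg; rewrite !heckeTinvE zpermM sg.
exact: hecke_inv_sym_identity.
Qed.

Lemma heckeTinvZ i c f : TI i (sc c * f) = sc c * TI i f.
Proof. by apply: heckeTinvM_sym; exact: zperm_scal. Qed.

Lemma heckeTinv0 i : TI i 0 = 0.
Proof. by rewrite -[0 in LHS](mul0r 0) -zscal0 heckeTinvZ zscal0 mul0r. Qed.

Lemma heckeTinvN i f : TI i (- f) = - TI i f.
Proof. by rewrite -mulN1r -zscal1 -zscalN heckeTinvZ zscalN zscal1 mulN1r. Qed.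

Lemma heckeTinv_sum i (I : Type) (r : seq I) (P : pred I) (F : I -> zfield K l) :
  TI i (\sum_(k <- r | P k) F k) = \sum_(k <- r | P k) TI i (F k).
Proof. by apply: (big_morph (TI i) (heckeTinvD i) (heckeTinv0 i)). Qed.

Lemma heckeTinv_inj i : injective (TI i).
Proof. exact: can_inj (heckeTinvK t0 i). Qed.

Lemma heckeTinv_sym i f : zperm (simple i) f = f -> TI i f = (sc t)^-1 * f.
Proof.
move=> sf; rewrite heckeTinvE sf subrr mul0r add0r.
exact/hecke_inv_fix_identity/zscal_t_neq0.
Qed.

Lemma zperm_comm i j f : (i.+1 < j)%N ->
  zperm (simple i) (zperm (simple j) f) = zperm (simple j) (zperm (simple i) f).
Proof. by move=> ij; rewrite -!zperm_mul (simple_comm ij). Qed.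

Lemma zvar_simple_far i j : (i.+1 < j)%N -> zperm (simple j) (zvar K (s_lo i)) = zvar K (s_lo i) /\
  zperm (simple j) (zvar K (s_hi i)) = zvar K (s_hi i).
Proof.
by move=> ij; rewrite !zperm_var; split; rewrite simple_id //; apply/eqP => /(congr1 val) /=; lia.
Qed.

Lemma zvar_simple_far' i j : (i.+1 < j)%N -> zperm (simple i) (zvar K (s_lo j)) = zvar K (s_lo j) /\
  zperm (simple i) (zvar K (s_hi j)) = zvar K (s_hi j).
Proof.
by move=> ij; rewrite !zperm_var; split; rewrite simple_id //; apply/eqP => /(congr1 val) /=; lia.
Qed.

Lemma heckeTinv_comm i j f : (i.+1 < j)%N -> TI i (TI j f) = TI j (TI i f).
Proof.
move=> ij; have [e1 e2] := zvar_simple_far ij; have [e3 e4] := zvar_simple_far' ij.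
have sz k : zperm (simple k) (sc t) = sc t by exact: zperm_scal.
have sE k (a b : zfield K l) : zperm (simple k) a = a -> zperm (simple k) b = b ->
    zperm (simple k) ((1 - a / b)^-1) = (1 - a / b)^-1.
  by move=> ea eb; rewrite zpermV zpermD zpermN zpermM zpermV ea eb zperm_one.
have sD k : zperm (simple k) ((sc t)^-1 * (1 - sc t)) = (sc t)^-1 * (1 - sc t).
  by rewrite zpermM zpermV zpermD zpermN sz zperm_one.
rewrite !heckeTinvE; apply: (@hecke_inv_comm_identity _ (zperm (simple i)) (zperm (simple j))).
- exact: zpermD.
- exact: zpermM.
- exact: zpermN.
- exact: zpermD.
- exact: zpermM.
- exact: zpermN.
- by move=> g; exact: zperm_comm.
- exact: sD.
- exact: sD.
- exact: sE.
- exact: sE.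
Qed.

Lemma heckeT_braid i j f : (j = i.+1 :> nat) ->
  heckeT t i (heckeT t j (heckeT t i f)) = heckeT t j (heckeT t i (heckeT t j f)).
Proof.
move=> ij; have e : s_lo j = s_hi i by apply: val_inj; rewrite /= ij.
have n1 : s_lo i != s_hi j by rewrite -val_eqE /= ij; lia.
have n2 : s_hi i != s_hi j by rewrite -val_eqE /= ij; lia.
have n3 := s_lo_hi i.
rewrite {1 3 4}/heckeT; rewrite /heckeT e.
apply: (@hecke_braid_identity _ (sc t) (zvar K (s_lo i)) (zvar K (s_hi i))
  (zvar K (s_hi j)) (zperm (simple i)) (zperm (simple j))).
- by move=> g h; apply: (rmorphD (zperm (simple i))).
- by move=> g h; apply: (rmorphM (zperm (simple i))).
- by move=> g h; apply: (rmorphD (zperm (simple j))).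
- by move=> g h; apply: (rmorphM (zperm (simple j))).
- exact: zperm_scal.
- exact: zperm_scal.
- by rewrite zperm_var simple_lo.
- by rewrite zperm_var simple_hi.
- by rewrite zperm_var simple_id // eq_sym.
- by rewrite zperm_var simple_id // e.
- by rewrite zperm_var -e simple_lo.
- by rewrite zperm_var simple_hi e.
- exact: simpleK.
- exact: simpleK.
- by move=> g; rewrite -!zperm_mul !mulgA (simple_braid ij).
- exact: zvar_neq0.
- exact: zvar_neq0.
- exact: zvar_neq0.
- exact: zvar_inj.
- exact: zvar_inj.
- exact: zvar_inj.
Qed.

Lemma heckeTinv_braid i j f : (j = i.+1 :> nat) ->
  TI i (TI j (TI i f)) = TI j (TI i (TI j f)).
Proof.
move=> ij; have Tinj (k : 'I_l.-1) : injective (@heckeT K t l k) by exact: can_inj (heckeTK t0 k).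
(* Under the injective map T_i T_j T_i the left side becomes [f]; so does the right side, once the
   braid relation has turned this map into T_j T_i T_j. *)
apply: (Tinj i); apply: (Tinj j); apply: (Tinj i).
transitivity f.
  rewrite [X in heckeT t i (heckeT t j X)](heckeTinvK t0 i (TI j (TI i f))).
  rewrite [X in heckeT t i X](heckeTinvK t0 j (TI i f)).
  exact: (heckeTinvK t0 i f).
symmetry; rewrite (heckeT_braid (TI j (TI i (TI j f))) ij).
rewrite [X in heckeT t j (heckeT t i X)](heckeTinvK t0 j (TI i (TI j f))).
rewrite [X in heckeT t j X](heckeTinvK t0 i (TI j f)).
exact: (heckeTinvK t0 j f).
Qed.

Lemma zmonD la mu : zmon K (la + mu) = zmon K la * zmon K mu.
Proof.
rewrite /zmon -big_split /=; apply: eq_bigr => p _.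
by rewrite ffunE expfzDr // zvar_neq0.
Qed.

Lemma zperm_zmon w la : zperm w (zmon K la) = zmon K (wt_act w la).
Proof.
rewrite /zmon (rmorph_prod (zperm w)).
rewrite [RHS](reindex_inj (@perm_inj _ w)) /=; apply: eq_bigr => p _.
rewrite ffunE permK -(zperm_var K w p).
case: (la p) => n; first exact: zpermX.
by rewrite /exprz zpermV zpermX.
Qed.
End HeckeOperators.

(** * Reduced words as descent words of weights, and their independence *)

Section ReducedWords.
Variable l : nat.
Implicit Types (i j : 'I_l.-1) (p q : 'I_l) (la mu : wt l) (u v : seq 'I_l.-1) (w : 'S_l).

Definition inv_set la : {set 'I_l * 'I_l} :=
  [set pq : 'I_l * 'I_l | (pq.1 < pq.2)%N && (la pq.2 < la pq.1)].
(** The length of the shortest permutation carrying [wt_inc la] to [la]. *)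
Definition winv la : nat := #|inv_set la|.

Definition wsorted la := [forall p : 'I_l, forall q : 'I_l, (p <= q)%N ==> (la p <= la q)].

Lemma wsortedP la : reflect (forall p q, (p <= q)%N -> la p <= la q) (wsorted la).
Proof.
apply: (iffP 'forall_forallP) => h p q; first by move=> pq; apply: (implyP (h p q)).
by apply/implyP/h.
Qed.

(** Apply s_i to both positions: the adjacent pair at the descent disappears and the order of all
    other pairs is kept. The relation [R] selects the inversions to be counted, so that one
    bijection serves for lengths, ties and strip statistics. *)
Lemma card_inv_desc i la (R : rel 'I_l) : la (s_hi i) < la (s_lo i) ->
  #|[set pq : 'I_l * 'I_l | [&& (pq.1 < pq.2)%N, la pq.2 < la pq.1 & R pq.1 pq.2]]| =
  (R (s_lo i) (s_hi i) +
   #|[set pq : 'I_l * 'I_l | [&& (pq.1 < pq.2)%N, (la (simple i pq.2) < la (simple i pq.1))%R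
       & R (simple i pq.1) (simple i pq.2)]]|)%N.
Proof.
move=> d; rewrite (cardsD1 (s_lo i, s_hi i)) inE /= ltnSn d /=; congr addn.
pose phi (x : 'I_l * 'I_l) := (simple i x.1, simple i x.2).
have phiI : injective phi.
  by move=> [a b] [c e] [] /perm_inj -> /perm_inj ->.
rewrite -[RHS](card_preimset _ phiI); apply: eq_card => -[p q].
rewrite !inE /= !simple2 andbA.
case: ltP => /= dpq; rewrite ?andbF //; case: (R p q); rewrite ?andbF // !andbT.
apply/andP/idP => [[ne lt]|lt]; first exact: simple_lt.
have ne' : ~~ ((simple i p == s_lo i) && (simple i q == s_hi i)).
  apply/negP => /andP[/eqP e1 /eqP e2].
  have e3 : p = s_hi i by rewrite -(simple2 i p) e1 simple_lo.
  have e4 : q = s_lo i by rewrite -(simple2 i q) e2 simple_hi.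
  by move: dpq; rewrite e3 e4 ltNge ltW.
have := simple_lt lt ne'; rewrite !simple2 => pq; split => //.
by apply/eqP => -[e1 e2]; move: lt; rewrite e1 e2 simple_lo simple_hi /= ltnNge ltnW.
Qed.

Lemma winv_desc i la : la (s_hi i) < la (s_lo i) ->
  winv la = (winv (wt_act (simple i) la)).+1.
Proof.
move=> d; rewrite /winv /inv_set; have := card_inv_desc (fun _ _ => true) d.
rewrite add1n => e; apply: (etrans _ (etrans e _)); first by apply: eq_card => x; rewrite !inE andbT.
by congr _.+1; apply: eq_card => x; rewrite !inE andbT !wt_act_simple.
Qed.

Lemma winv_asc i la : la (s_lo i) < la (s_hi i) ->
  winv (wt_act (simple i) la) = (winv la).+1.
Proof.
by move=> d; rewrite (@winv_desc i) ?wt_simpleK // !wt_act_simple simple_lo simple_hi.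
Qed.

Lemma wt_act_tie i la : la (s_lo i) = la (s_hi i) -> wt_act (simple i) la = la.
Proof.
by move=> e; apply/ffunP => p; rewrite wt_act_simple; case: simpleP => [->|->|].
Qed.

Lemma winv_simple_le i la : (winv (wt_act (simple i) la) <= (winv la).+1)%N.
Proof.
case: (ltgtP (la (s_lo i)) (la (s_hi i))) => c.
- by rewrite winv_asc.
- by rewrite (winv_desc c) ltnW // ltnS.
- by rewrite wt_act_tie.
Qed.

Lemma winv_sorted la : wsorted la -> winv la = 0%N.
Proof.
move/wsortedP => h; apply/eqP; rewrite cards_eq0; apply/eqP/setP => -[p q].
by rewrite !inE; apply/negP => /= /andP[pq]; rewrite ltNge h // ltnW.
Qed.

Lemma adjacent_sorted la : (forall i, la (s_lo i) <= la (s_hi i)) -> wsorted la.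
Proof.
move=> h; apply/wsortedP => p q; have [k] := ubnP (q - p)%N.
elim: k q => // k IH q kq; rewrite leq_eqVlt => /orP[/eqP/val_inj -> //|pq].
have q0 : (q.-1 < l.-1)%N by have := ltn_ord q; lia.
have eh : s_hi (Ordinal q0) = q by apply: val_inj => /=; lia.
rewrite -eh; apply: le_trans (h _); apply: IH => /=; lia.
Qed.

Lemma exists_descent la : ~~ wsorted la -> exists i, la (s_hi i) < la (s_lo i).
Proof.
move=> n; apply/existsP; apply: contraNT n; rewrite negb_exists => /forallP h.
by apply: adjacent_sorted => i; rewrite leNgt.
Qed.

(** Every letter removes one inversion until the weight is sorted, so these are the reduced words of
    the shortest permutation carrying [wt_inc la] to [la]. Recursion on the weight replaces
    reasoning about permutations. *)
Fixpoint dword u la : bool :=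
  if u is i :: u' then (la (s_hi i) < la (s_lo i)) && dword u' (wt_act (simple i) la)
  else wsorted la.

Lemma dword_size u la : dword u la -> size u = winv la.
Proof.
elim: u la => [|i u IH] la /=; first by move/winv_sorted.
by case/andP=> d /IH ->; rewrite -winv_desc.
Qed.

Lemma dword_exists la : exists u, dword u la.
Proof.
have [n] := ubnP (winv la); elim: n la => // n IH la; rewrite ltnS => le.
have [s|/exists_descent[i d]] := boolP (wsorted la); first by exists [::].
have [|u hu] := IH (wt_act (simple i) la); first by rewrite -(winv_desc d).
by exists (i :: u); rewrite /= d.
Qed.

Definition aw u la : wt l := foldr (fun i mu => wt_act (simple i) mu) la u.
(** Permutations are multiplied from left to right, so this product is the map s_{i_1} o ... o
    s_{i_k}. *)
Definition wperm u : 'S_l := foldr (fun i w => (w * simple i)%g) 1%g u.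

Lemma awE u la : aw u la = wt_act (wperm u) la.
Proof. by elim: u => [|i u IH] /=; rewrite ?wt_act1 // wt_actM IH. Qed.

Lemma winv_aw u mu : (winv (aw u mu) <= size u + winv mu)%N.
Proof.
elim: u => [|i u IH] //=; apply: leq_trans (winv_simple_le _ _) _.
by rewrite addSn ltnS.
Qed.

(** A letter raises [winv] by at most 1, and [mu] has no inversion. If the length of the word equals
    the final number of inversions, every letter must have created one. *)
Lemma dword_aw u mu : wsorted mu -> size u = winv (aw u mu) -> dword u (aw u mu).
Proof.
move=> s; elim: u => [|i u IH] //= e; rewrite wt_simpleK.
have le := winv_aw u mu; rewrite (winv_sorted s) addn0 in le.
rewrite !wt_act_simple simple_lo simple_hi.
case: (ltgtP (aw u mu (s_lo i)) (aw u mu (s_hi i))) => c.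
- by rewrite IH //; move: e; rewrite winv_asc // => -[].
- by move: e; have := winv_desc c; lia.
- by move: e; rewrite wt_act_tie // => e; move: le; rewrite -e ltnn.
Qed.

Lemma wt_inc_perm w la : wt_inc (wt_act w la) = wt_inc la.
Proof.
apply/ffunP => p; rewrite !ffunE; congr (nth _ _ p); apply/perm_sort_leP.
have e (r : seq 'I_l) : map (fun q => wt_act w la q) r = map (fun q => la q) (map (w^-1)%g r).
  by elim: r => //= q r ->; rewrite ffunE.
rewrite e; apply: perm_map; apply: uniq_perm; rewrite ?enum_uniq //.
  by rewrite map_inj_uniq ?enum_uniq //; exact: perm_inj.
move=> q; rewrite mem_enum; apply/mapP; exists (w q); rewrite ?mem_enum //.
by rewrite permK.
Qed.

Lemma wt_inc_sorted la : wsorted la -> wt_inc la = la.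
Proof.
move=> /wsortedP s; apply/ffunP => p; rewrite ffunE sort_le_id.
  by rewrite (nth_map p) ?size_enum_ord // nth_ord_enum.
rewrite sorted_map; apply/(sortedP p) => k; rewrite size_enum_ord => hk.
have hk' : (k < l)%N by apply: ltnW.
rewrite /= (_ : nth p _ k = Ordinal hk'); last by apply: val_inj; rewrite /= nth_enum_ord.
rewrite (_ : nth p _ k.+1 = Ordinal hk); last by apply: val_inj; rewrite /= nth_enum_ord.
exact: s.
Qed.

Lemma dword_wt_inc u la : dword u la -> aw u (wt_inc la) = la.
Proof.
elim: u la => [|i u IH] la /=; first exact: wt_inc_sorted.
by case/andP=> _ /IH; rewrite wt_inc_perm => ->; rewrite wt_simpleK.
Qed.

Lemma wsorted_wt_inc la : wsorted (wt_inc la).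
Proof.
apply/wsortedP => p q pq; rewrite !ffunE.
apply: (sorted_leq_nth le_trans le_refl 0 (sort_le_sorted _)) => //.
all: by rewrite inE size_sort size_map size_enum_ord.
Qed.

(** Being strictly increasing, its rearrangements correspond to permutations, so that facts on
    weights specialize to permutations. *)
Definition idwt : wt l := [ffun p : 'I_l => (p : nat)%:Z].

Lemma wsorted_idwt : wsorted idwt.
Proof. by apply/wsortedP => p q pq; rewrite !ffunE lez_nat. Qed.

Lemma wt_act_idwt_inj (v w : 'S_l) : wt_act v idwt = wt_act w idwt -> v = w.
Proof.
move=> e; apply: invg_inj; apply/permP => p; move/ffunP/(_ p): e.
by rewrite !ffunE => -[] /val_inj.
Qed.

Lemma ell_winv w : ell w = winv (wt_act w idwt).
Proof.
pose phi (x : 'I_l * 'I_l) := ((w^-1)%g x.2, (w^-1)%g x.1).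
have phiI : injective phi.
  by move=> [a b] [c e] [] /perm_inj -> /perm_inj ->.
rewrite /ell /winv -(card_preimset _ phiI); apply: eq_card => -[p q].
by rewrite !inE /= !permKV !ffunE ltz_nat andbC.
Qed.

Lemma is_word_forE w u : is_word_for w u = (wperm u == w).
Proof.
have e x : foldr (fun i y => simple i y) x u = wperm u x.
  by elim: u => [|i u IH] /=; rewrite ?perm1 // permM IH.
apply/forallP/eqP => [h|<- x]; last by rewrite e.
by apply/permP => x; rewrite -e; apply/eqP.
Qed.

(** A descent word of the rearranged [idwt] is a witness, so the default [[::]] in [reduced_word] is
    never taken. *)
Lemma reduced_wordP w : wperm (reduced_word w) = w /\ size (reduced_word w) = ell w.
Proof.
rewrite /reduced_word; case: pickP => [u|n].
  by rewrite is_word_forE => /eqP e; rewrite size_tuple e.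
have [u hu] := dword_exists (wt_act w idwt).
have su : size u == ell w by rewrite (dword_size hu) ell_winv.
have := n (Tuple su); rewrite is_word_forE /=.
have := dword_wt_inc hu; rewrite wt_inc_perm (wt_inc_sorted wsorted_idwt) awE.
by move/wt_act_idwt_inj => ->; rewrite eqxx.
Qed.

Lemma dword_reduced w : dword (reduced_word w) (wt_act w idwt).
Proof.
have [e s] := reduced_wordP w; rewrite -{2}e -awE; apply: dword_aw.
  exact: wsorted_idwt.
by rewrite awE e s ell_winv.
Qed.

(** Minimality bounds the length of the chosen permutation by that of any descent word, which is
    [winv la]; conversely, reaching [la] from a sorted weight takes at least [winv la] letters. So
    the word in the definition of F_la is a descent word, and any other one may replace it. *)
Lemma min_perm_dword la : dword (reduced_word (min_perm la)) la.
Proof.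
have [u hu] := dword_exists la.
pose P (v : 'S_l) := wt_act v (wt_inc la) == la.
have Pu : P (wperm u) by rewrite /P -awE (dword_wt_inc hu).
rewrite /min_perm; case: pickP => [v /andP[/eqP e /forallP m]|/=]; last first.
  case: (arg_minnP (@ell l) Pu) => v Pv mv /(_ v); rewrite [wt_act v _ == la]Pv /=.
  by move/negbT/negP; case; apply/forallP => v'; apply/implyP => /mv.
have [er sr] := reduced_wordP v; have er' := er.
have ea : aw (reduced_word v) (wt_inc la) = la by rewrite awE er e.
rewrite /= -ea; apply: dword_aw; first exact: wsorted_wt_inc.
rewrite ea; apply/eqP; rewrite eqn_leq; apply/andP; split; last first.
  by have := winv_aw (reduced_word v) (wt_inc la);
     rewrite ea (winv_sorted (wsorted_wt_inc la)) addn0.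
rewrite sr -(dword_size hu); apply: leq_trans (implyP (m (wperm u)) Pu) _.
have := winv_aw u idwt.
by rewrite awE -ell_winv (winv_sorted wsorted_idwt) addn0.
Qed.
End ReducedWords.

Section HeckeWords.
Variables (K : fieldType) (t : K) (l : nat).
Hypothesis t0 : t != 0.
Implicit Types (i j : 'I_l.-1) (f g : zfield K l) (la mu : wt l) (w : 'S_l).
Implicit Types (u v : seq 'I_l.-1).
Local Notation TI := (@heckeTinv K t l).
Local Notation sc := (@zscal K l).

Definition opw u f : zfield K l := foldr TI f u.

Lemma opw_cat u v f : opw (u ++ v) f = opw u (opw v f).
Proof. by rewrite /opw foldr_cat. Qed.

Lemma opwD u f g : opw u (f + g) = opw u f + opw u g.
Proof. by elim: u => [|i u IH] //=; rewrite IH heckeTinvD. Qed.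

Lemma opwZ u c f : opw u (sc c * f) = sc c * opw u f.
Proof. by elim: u => [|i u IH] //=; rewrite IH heckeTinvZ. Qed.

Lemma opw0 u : opw u 0 = 0.
Proof. by elim: u => [|i u IH] //=; rewrite IH heckeTinv0. Qed.

Lemma opw_sum u (I : Type) (r : seq I) (P : pred I) (F : I -> zfield K l) :
  opw u (\sum_(k <- r | P k) F k) = \sum_(k <- r | P k) opw u (F k).
Proof. by apply: (big_morph (opw u) (opwD u) (opw0 u)). Qed.

Lemma opw_inj u : injective (opw u).
Proof. by elim: u => [|i u IH] f g //= /(heckeTinv_inj t0) /IH. Qed.

(* Matsumoto: two descents i, j of la generate a dihedral interval on which the
   commutation or braid relation applies. *)
Lemma opw_dword u v la f : dword u la -> dword v la -> opw u f = opw v f.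
Proof.
have [n] := ubnP (winv la); elim: n u v la => // n IH u v la; rewrite ltnS => le du dv.
have su := dword_size du; have sv := dword_size dv.
case: u du su => [|i u]; first by case: v dv sv => // j v _ <-.
case: v dv sv => [|j v]; first by move=> _ <-.
wlog: i j u v / (i <= j)%N => [W|].
  by case: (leqP i j) => [|/ltnW] c h1 h2 h3 h4; [apply: W|apply/esym/W].
move=> ij dv sv du su.
have [di du'] : la (s_hi i) < la (s_lo i) /\ dword u (wt_act (simple i) la) by case/andP: du.
have [dj dv'] : la (s_hi j) < la (s_lo j) /\ dword v (wt_act (simple j) la) by case/andP: dv.
have lti : (winv (wt_act (simple i) la) < n)%N by rewrite -(winv_desc di).
have ltj : (winv (wt_act (simple j) la) < n)%N by rewrite -(winv_desc dj).
have [eij|ne] := eqVneq i j.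
  by move: dv'; rewrite /= -eij => dv'; congr TI; apply: (IH _ _ _ lti).
have [c|c] := ltnP i.+1 j.
  pose la2 := wt_act (simple j) (wt_act (simple i) la).
  have [x dx] := dword_exists la2.
  have e1 : opw u f = opw (j :: x) f.
    apply: (IH _ _ _ lti) => //=; rewrite dx andbT !wt_act_simple !simple_id //;
    by apply/eqP => /(congr1 val) /=; lia.
  have e2 : opw v f = opw (i :: x) f.
    apply: (IH _ _ _ ltj) => //=; rewrite -wt_actM -(simple_comm c) wt_actM dx andbT.
    rewrite !wt_act_simple !simple_id //; by apply/eqP => /(congr1 val) /=; lia.
  by rewrite /= -/(opw u f) -/(opw v f) e1 e2 /= heckeTinv_comm.
have ji : j = i.+1 :> nat by move: ne; rewrite -val_eqE /=; lia.
have elo : s_lo j = s_hi i by apply: val_inj; rewrite /= ji.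
have n1 : s_lo i != s_lo j by rewrite elo s_lo_hi.
have n2 : s_lo i != s_hi j by apply/eqP => /(congr1 val) /=; lia.
have n3 : s_hi j != s_lo i by rewrite eq_sym.
have n4 : s_hi j != s_hi i by apply/eqP => /(congr1 val) /=; lia.
pose la3 := wt_act (simple i) (wt_act (simple j) (wt_act (simple i) la)).
have e3 : wt_act (simple j) (wt_act (simple i) (wt_act (simple j) la)) = la3.
  by rewrite /la3 -!wt_actM !mulgA (simple_braid ji).
have [x dx] := dword_exists la3.
rewrite elo in dj.
have jb : simple j (s_hi i) = s_hi j by rewrite -elo simple_lo.
have jc : simple j (s_hi j) = s_hi i by rewrite simple_hi.
have ja : simple j (s_lo i) = s_lo i by apply: simple_id.
have ic : simple i (s_hi j) = s_hi j by apply: simple_id.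
have R := (jb, jc, ja, ic, simple_lo, simple_hi).
have dk := lt_trans dj di.
have e1 : opw u f = opw (j :: i :: x) f.
  by apply: (IH _ _ _ lti) => //=; rewrite dx !wt_act_simple elo !R dj dk.
have e2 : opw v f = opw (i :: j :: x) f.
  by apply: (IH _ _ _ ltj) => //=; rewrite e3 dx !wt_act_simple elo !R di dk.
by rewrite /= -/(opw u f) -/(opw v f) e1 e2 /= heckeTinv_braid.
Qed.
End HeckeWords.

(** * The functions F_la *)

Section HallLittlewood.
Variables (K : fieldType) (t : K) (l : nat).
Hypothesis t0 : t != 0.
Implicit Types (i j : 'I_l.-1) (f g : zfield K l) (la mu ka : wt l) (w : 'S_l).
Implicit Types (u v : seq 'I_l.-1).
Local Notation TI := (@heckeTinv K t l).
Local Notation sc := (@zscal K l).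
Local Notation FF := (@Ffun K t l).

Lemma Tbar_dword u w f : dword u (wt_act w (idwt l)) -> Tbar t w f = opw t u f.
Proof. by move=> du; apply: (opw_dword t0 _ (dword_reduced w) du). Qed.

Lemma Ffun_dword u la : dword u la -> FF la = opw t u (zmon K (wt_inc la)).
Proof. by move=> du; apply: (opw_dword t0 _ (min_perm_dword la) du). Qed.

Lemma Ffun_sorted la : wsorted la -> FF la = zmon K la.
Proof. by move=> s; rewrite (@Ffun_dword [::]) //= wt_inc_sorted. Qed.

Lemma Ffun_asc i la : la (s_lo i) < la (s_hi i) ->
  FF (wt_act (simple i) la) = TI i (FF la).
Proof.
move=> a; have [u du] := dword_exists la.
rewrite (@Ffun_dword (i :: u)) /=; last first.
  by rewrite wt_simpleK du !wt_act_simple simple_lo simple_hi a.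
by rewrite wt_inc_perm -(Ffun_dword du).
Qed.

Lemma Ffun_desc i la : la (s_hi i) < la (s_lo i) ->
  FF la = TI i (FF (wt_act (simple i) la)).
Proof.
by move=> d; rewrite -Ffun_asc ?wt_simpleK // !wt_act_simple simple_lo simple_hi.
Qed.

(** Induction on [winv la]. For sorted [la] the monomial is s_i-invariant. Otherwise strip a descent
    k, necessarily different from i. If k is not adjacent to i, the operators commute. If it is, the
    tie makes i a descent after k has been stripped; strip it too, and the braid relation turns T_i
    T_k T_i into T_k T_i T_k, where the innermost operator meets the same tie, now at k. *)
Lemma Ffun_tie i la : la (s_lo i) = la (s_hi i) -> TI i (FF la) = (sc t)^-1 * FF la.
Proof.
have [n] := ubnP (winv la); elim: n i la => // n IH i la; rewrite ltnS => le tie.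
have [s|/exists_descent[k dk]] := boolP (wsorted la).
  by rewrite Ffun_sorted // heckeTinv_sym // zperm_zmon wt_act_tie.
have tZ k' f : TI k' ((sc t)^-1 * f) = (sc t)^-1 * TI k' f.
  by rewrite -zscalV heckeTinvZ.
have ltk : (winv (wt_act (simple k) la) < n)%N by rewrite -(winv_desc dk).
rewrite (Ffun_desc dk); set mu := wt_act (simple k) la.
have [c|c|c] := ltngtP k i.
- have [c'|c'] := ltnP k.+1 i.
    rewrite -heckeTinv_comm // IH // !wt_act_simple !simple_id //;
    by apply/eqP => /(congr1 val) /=; lia.
  have ki : i = k.+1 :> nat by lia.
  have elo : s_lo i = s_hi k by apply: val_inj; rewrite /= ki.
  have ib : simple i (s_hi k) = s_hi i by rewrite -elo simple_lo.
  have ic : simple i (s_hi i) = s_hi k by rewrite simple_hi.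
  have ia : simple i (s_lo k) = s_lo k.
    by apply: simple_id; apply/eqP => /(congr1 val) /=; lia.
  have kc : simple k (s_hi i) = s_hi i.
    by apply: simple_id; apply/eqP => /(congr1 val) /=; lia.
  have R := (ib, ic, ia, kc, simple_lo, simple_hi).
  have di : mu (s_hi i) < mu (s_lo i) by rewrite !wt_act_simple elo !R -tie elo.
  rewrite (Ffun_desc di); set rho := wt_act (simple i) mu.
  have lti : (winv rho < n)%N by apply: leq_trans ltk; rewrite (winv_desc di) leqW.
  rewrite -(heckeTinv_braid t0 _ ki) IH ?tZ //.
  by rewrite !wt_act_simple !R -tie elo.
- have [c'|c'] := ltnP i.+1 k.
    rewrite heckeTinv_comm // IH // !wt_act_simple !simple_id //;
    by apply/eqP => /(congr1 val) /=; lia.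
  have ki : k = i.+1 :> nat by lia.
  have elo : s_lo k = s_hi i by apply: val_inj; rewrite /= ki.
  have kb : simple k (s_hi i) = s_hi k by rewrite -elo simple_lo.
  have kc : simple k (s_hi k) = s_hi i by rewrite simple_hi.
  have ka : simple k (s_lo i) = s_lo i.
    by apply: simple_id; apply/eqP => /(congr1 val) /=; lia.
  have ic : simple i (s_hi k) = s_hi k.
    by apply: simple_id; apply/eqP => /(congr1 val) /=; lia.
  have R := (kb, kc, ka, ic, simple_lo, simple_hi).
  have di : mu (s_hi i) < mu (s_lo i) by rewrite !wt_act_simple !R tie -elo.
  rewrite (Ffun_desc di); set rho := wt_act (simple i) mu.
  have lti : (winv rho < n)%N by apply: leq_trans ltk; rewrite (winv_desc di) leqW.
  rewrite (heckeTinv_braid t0 _ ki) IH ?tZ //.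
  by rewrite !wt_act_simple elo !R tie.
- by move/val_inj: c dk => ->; rewrite tie ltxx.
Qed.

Definition rties w la : nat :=
  #|[set pq : 'I_l * 'I_l | [&& (pq.1 < pq.2)%N, ((w^-1)%g pq.2 < (w^-1)%g pq.1)%N
      & la pq.1 == la pq.2]]|.

(** Each letter of a reduced word inverts one pair of entries. The hypothesis says that such a pair
    ends up as a descent or as a tie: in the first case F moves on to the next weight, in the second
    the eigenvalue t^-1 appears. *)
Lemma Tbar_Ffun w la :
  (forall p q : 'I_l, (p < q)%N -> ((w^-1)%g q < (w^-1)%g p)%N -> la q <= la p) ->
  Tbar t w (FF (wt_act (w^-1)%g la)) = (sc t)^-1 ^+ rties w la * FF la.
Proof.
have [u du] := dword_exists (wt_act w (idwt l)).
rewrite (Tbar_dword _ du); elim: u w la du => [|i u IH] w la /=.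
  move=> s _; have w1 : w = 1%g.
    by apply: wt_act_idwt_inj; rewrite wt_act1 -{1}(wt_inc_sorted s) wt_inc_perm
         wt_inc_sorted ?wsorted_idwt.
  rewrite w1 invg1 wt_act1 [rties _ _](_ : _ = 0%N) ?mul1r //.
  apply/eqP; rewrite cards_eq0; apply/eqP/setP => -[p q]; rewrite !inE /= invg1 !perm1.
  by case: ltngtP.
case/andP=> d du h; rewrite -wt_actM in du.
have hd : ((w^-1)%g (s_hi i) < (w^-1)%g (s_lo i))%N by move: d; rewrite !ffunE ltz_nat.
have wV : ((w * simple i)^-1 = simple i * w^-1)%g by rewrite invMg simpleV.
have := IH _ (wt_act (simple i) la) du.
rewrite wV wt_actM wt_simpleK => -> ; last first.
  move=> p q pq; rewrite !permM !wt_act_simple => lt; apply: h => //.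
  rewrite simple_lt //; apply/negP => /andP[/eqP e1 /eqP e2].
  by move: lt; rewrite e1 e2 simple_lo simple_hi ltnNge ltnW.
have -> : rties w la = ((la (s_lo i) == la (s_hi i)) +
    rties (w * simple i)%g (wt_act (simple i) la))%N.
  have ewt p q : (wt_act w (idwt l) p < wt_act w (idwt l) q) = ((w^-1)%g p < (w^-1)%g q)%N.
    by rewrite !ffunE ltz_nat.
  rewrite /rties; have := card_inv_desc (fun p q => la p == la q) d => e.
  apply: (etrans _ (etrans e _)); first by apply: eq_card => x; rewrite !inE ewt.
  by congr addn; apply: eq_card => x; rewrite !inE ewt wV !permM !wt_act_simple.
rewrite -zscalV exprD.
have sX n : sc t^-1 ^+ n = sc (t^-1 ^+ n).
  by elim: n => [|n IHn]; rewrite ?expr0 ?zscal1 // !exprS zscalM IHn.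
rewrite [in LHS]sX heckeTinvZ // -sX.
rewrite [X in X * FF la]mulrC -mulrA; congr (_ * _).
have := h _ _ (s_lo_lt_hi i) hd; rewrite le_eqVlt => /orP[/eqP e|lt].
  by rewrite -e eqxx expr1 zscalV wt_act_tie // Ffun_tie.
by rewrite (gt_eqF lt) expr0 mul1r -Ffun_desc.
Qed.
End HallLittlewood.

(** For f = z^la with gap n at i and u = z_i/z_{i+1}, f u^n is s_i f and the left side is the
    divided-difference part of T_i^-1. The summand [+ f] removes the term r = 0, so only weights
    strictly between [la] and s_i(la) occur. *)
Lemma geometric_divided_difference (F : fieldType) (f u : F) n : u != 1 -> (0 < n)%N ->
  (f * u ^+ n - f) / (1 - u) + f = - \sum_(1 <= r < n) f * u ^+ r.
Proof.
move=> u1 n0; have d0 : 1 - u != 0 by rewrite subr_eq0 eq_sym.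
apply: (mulIf d0); rewrite mulrDl divfK // mulNr -mulr_sumr.
have e : f * u ^+ n - f = - (f * (1 - u) * \sum_(0 <= r < n) u ^+ r).
  rewrite -mulrA -[f * u ^+ n - f](_ : f * (u ^+ n - 1) = _); last by rewrite mulrBr mulr1.
  by rewrite subrX1 big_mkord -mulrN -mulNr opprB.
rewrite e big_ltn // expr0; move: (\sum_(1 <= _ < n) _) => S; ring.
Qed.

(** * Triangularity, linear independence and coefficients of the F_la *)

Section Spans.
Variables (K : fieldType) (l : nat) (G : wt l -> zfield K l).
Implicit Types (f g : zfield K l) (P Q : wt l -> Prop).
Local Notation sc := (@zscal K l).

(** The list may repeat weights, so closure under sums is concatenation; uniqueness of coefficients
    is a separate matter, settled by [Ffun_indep]. *)
Definition wspan P f : Prop := exists s : seq (K * wt l),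
  (forall x, x \in s -> P x.2) /\ f = \sum_(x <- s) sc x.1 * G x.2.

Lemma wspan0 P : wspan P 0.
Proof. by exists [::]; split=> //; rewrite big_nil. Qed.

Lemma wspanD P f g : wspan P f -> wspan P g -> wspan P (f + g).
Proof.
move=> [s [hs ->]] [s' [hs' ->]]; exists (s ++ s'); split; last by rewrite big_cat.
by move=> x; rewrite mem_cat => /orP[/hs|/hs'].
Qed.

Lemma wspanZ P c f : wspan P f -> wspan P (sc c * f).
Proof.
move=> [s [hs ->]]; exists [seq (c * x.1, x.2) | x <- s]; split.
  by move=> x /mapP[y /hs hy ->].
by rewrite big_map mulr_sumr; apply: eq_bigr => x _; rewrite zscalM mulrA.
Qed.

Lemma wspanN P f : wspan P f -> wspan P (- f).
Proof. by move/(wspanZ (-1)); rewrite zscalN zscal1 mulN1r. Qed.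

Lemma wspan_sum (I : eqType) (r : seq I) (A : pred I) P (F : I -> zfield K l) :
  (forall i, i \in r -> A i -> wspan P (F i)) -> wspan P (\sum_(i <- r | A i) F i).
Proof.
move=> h; rewrite big_seq_cond.
by apply: big_ind => [|x y|i /andP[]]; [exact: wspan0|exact: wspanD|exact: h].
Qed.

Lemma wspan_gen P la : P la -> wspan P (G la).
Proof.
move=> h; exists [:: (1, la)]; split; first by move=> x; rewrite inE => /eqP ->.
by rewrite big_seq1 zscal1 mul1r.
Qed.

Lemma wspan_sub P Q f : (forall la, P la -> Q la) -> wspan P f -> wspan Q f.
Proof. by move=> h [s [hs ->]]; exists s; split=> // x /hs /h. Qed.

Lemma wspan_trans (G' : wt l -> zfield K l) P Q f :
  (forall la, P la -> exists s : seq (K * wt l),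
    (forall x, x \in s -> Q x.2) /\ G la = \sum_(x <- s) sc x.1 * G' x.2) ->
  wspan P f -> exists s : seq (K * wt l),
    (forall x, x \in s -> Q x.2) /\ f = \sum_(x <- s) sc x.1 * G' x.2.
Proof.
move=> h [s [hs ->]]; elim: s hs => [|y s IH] hs.
  by exists [::]; split=> //; rewrite !big_nil.
have [|s1 [h1 e1]] := h y.2; first by apply: hs; rewrite mem_head.
have [|s2 [h2 e2]] := IH; first by move=> x xs; apply: hs; rewrite inE xs orbT.
exists ([seq (y.1 * x.1, x.2) | x <- s1] ++ s2); split.
  by move=> x; rewrite mem_cat => /orP[/mapP[z /h1 hz ->]|/h2].
rewrite big_cons big_cat big_map e1 e2 mulr_sumr; congr (_ + _).
by apply: eq_bigr => x _; rewrite zscalM mulrA.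
Qed.
End Spans.

Lemma big_group_seq (R : nmodType) (X Y : eqType) (s : seq X) (h : X -> Y)
    (U : seq Y) (f : X -> R) : uniq U -> (forall x, x \in s -> h x \in U) ->
  \sum_(x <- s) f x = \sum_(y <- U) \sum_(x <- s | h x == y) f x.
Proof.
move=> uU hU; rewrite (exchange_big_dep predT) //= big_seq [RHS]big_seq.
apply: eq_bigr => x xs; rewrite big_mkcond (bigD1_seq (h x)) ?hU //= eqxx.
by rewrite big1 ?addr0 // => y; rewrite eq_sym => /negbTE ->.
Qed.

Section Triangularity.
Variables (K : fieldType) (t : K) (l : nat).
Hypothesis t0 : t != 0.
Implicit Types (i j : 'I_l.-1) (f g : zfield K l) (la mu ka : wt l) (w : 'S_l).
Local Notation TI := (@heckeTinv K t l).
Local Notation sc := (@zscal K l).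
Local Notation FF := (@Ffun K t l).
Local Notation ZM := (@zmon K l).

Lemma sum_lo_hi (R : nmodType) i (f : 'I_l -> R) :
  \sum_p f p = f (s_lo i) + (f (s_hi i) + \sum_(p | (p != s_lo i) && (p != s_hi i)) f p).
Proof.
by rewrite (bigD1 (s_lo i)) //= (bigD1 (s_hi i)) // eq_sym s_lo_hi.
Qed.

(** r times the simple root e_i - e_{i+1}. *)
Definition dlt i (r : int) : wt l :=
  [ffun p => if p == s_lo i then r else if p == s_hi i then - r else 0].

Lemma zmon_dlt i (r : nat) :
  ZM (dlt i r%:Z) = (zvar K (s_lo i) / zvar K (s_hi i)) ^+ r.
Proof.
rewrite /zmon (bigD1 (s_lo i)) //= (bigD1 (s_hi i)) 1?eq_sym ?s_lo_hi //=.
rewrite big1 ?mulr1 => [|p /andP[h1 h2]]; last by rewrite ffunE (negbTE h1) (negbTE h2) expr0z.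
rewrite !ffunE eqxx eq_sym (negbTE (s_lo_hi i)) eqxx.
by rewrite -invr_expz exprMn exprVn.
Qed.

Lemma wt_act_dlt i la (n : int) : la (s_hi i) = la (s_lo i) + n ->
  wt_act (simple i) la = la + dlt i n.
Proof.
move=> e; apply/ffunP => p; rewrite wt_act_simple !ffunE.
by case: simpleP => [->|->|h1 h2]; rewrite ?addr0 // e ?addrK.
Qed.

Lemma heckeTinv_zmon i la n : (0 < n)%N -> la (s_hi i) = la (s_lo i) + n%:Z ->
  TI i (ZM la) = ZM (wt_act (simple i) la) -
    (sc t)^-1 * (1 - sc t) * \sum_(1 <= r < n) ZM (la + dlt i r%:Z).
Proof.
move=> n0 e; rewrite heckeTinvE // zperm_zmon (wt_act_dlt e); congr (_ + _); rewrite -[RHS]mulrN; congr (_ * _).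
rewrite !zmonD zmon_dlt geometric_divided_difference //.
  by congr (- _); apply: eq_bigr => r _; rewrite zmonD zmon_dlt.
rewrite -subr_eq0 -(inj_eq (mulIf (zvar_neq0 K (s_hi i)))) mul0r mulrBl divfK ?zvar_neq0 //.
by rewrite mul1r zvar_inj // s_lo_hi.
Qed.

Definition wdeg la : int := \sum_p la p.
(** The squared Euclidean norm is invariant under permutations and smaller at lattice points
    strictly between [la] and s_i(la) than at these two ends; this makes it the measure for
    triangularity. *)
Definition wnorm la : nat := (\sum_p `|la p| ^ 2)%N.

Lemma wnormE la : (wnorm la)%:Z = \sum_p la p ^+ 2.
Proof.
rewrite /wnorm (big_morph Posz PoszD (erefl _)); apply: eq_bigr => p _.
by rewrite -mulnn PoszM abszE -expr2 real_normK // num_real.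
Qed.

Lemma wdeg_act w la : wdeg (wt_act w la) = wdeg la.
Proof.
rewrite /wdeg (reindex_inj (@perm_inj _ w)); apply: eq_bigr => p _.
by rewrite ffunE permK.
Qed.

Lemma wnorm_act w la : wnorm (wt_act w la) = wnorm la.
Proof.
rewrite /wnorm (reindex_inj (@perm_inj _ w)); apply: eq_bigr => p _.
by rewrite ffunE permK.
Qed.

Lemma wdeg_dlt i la (r : int) : wdeg (la + dlt i r) = wdeg la.
Proof.
rewrite /wdeg !(sum_lo_hi i) !ffunE eqxx eq_sym (negbTE (s_lo_hi i)) eqxx.
rewrite (eq_bigr (fun p => la p)) => [|p /andP[/negbTE h1 /negbTE h2]].
  by rewrite addrACA [_ + (_ - _)]addrA addrACA; ring.
by rewrite !ffunE h1 h2 addr0.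
Qed.

Lemma wnorm_dlt i la (n r : nat) : (0 < r < n)%N -> la (s_hi i) = la (s_lo i) + n%:Z ->
  (wnorm (la + dlt i r%:Z)%R < wnorm la)%N.
Proof.
move=> /andP[r0 rn] e; rewrite -ltz_nat !wnormE !(sum_lo_hi i) !ffunE eqxx.
rewrite eq_sym (negbTE (s_lo_hi i)) eqxx e.
rewrite [ltLHS](_ : _ = (la (s_lo i) + r%:Z) ^+ 2 + ((la (s_lo i) + n%:Z - r%:Z) ^+ 2 +
   \sum_(p | (p != s_lo i) && (p != s_hi i)) la p ^+ 2)); last first.
  do 2 congr (_ + _); apply: eq_bigr => p /andP[/negbTE h1 /negbTE h2].
  by rewrite !ffunE h1 h2 addr0.
rewrite !addrA ltrD2r; have [n' en] : exists n' : nat, n = (r + n'.+1)%N.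
  by exists (n - r).-1; lia.
move: (la _) => a; rewrite en PoszD -subr_gt0.
rewrite [X in 0 < X](_ : _ = 2%:Z * r%:Z * n'.+1%:Z); last by ring.
by rewrite !mulr_gt0 // ltz_nat.
Qed.

Definition low la ka := wdeg ka = wdeg la /\ (wnorm ka < wnorm la)%N.
Definition lowe la ka := wdeg ka = wdeg la /\ (wnorm ka <= wnorm la)%N.

Lemma heckeTinv_zmon_asc i la : la (s_lo i) < la (s_hi i) ->
  wspan ZM (low la) (TI i (ZM la) - ZM (wt_act (simple i) la)).
Proof.
move=> a; pose n := `|la (s_hi i) - la (s_lo i)|%N.
have e : la (s_hi i) = la (s_lo i) + n%:Z by rewrite /n; lia.
have n0 : (0 < n)%N by rewrite /n; lia.
rewrite (heckeTinv_zmon n0 e) addrAC subrr sub0r.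
rewrite -zscalV -zscal1 -zscalN -zscalD -zscalM; apply/wspanN/wspanZ/wspan_sum => r.
rewrite mem_index_iota => rn _; apply: wspan_gen.
by split; [exact: wdeg_dlt|exact: wnorm_dlt rn e].
Qed.

Lemma heckeTinv_zmon_le i la : wspan ZM (lowe la) (TI i (ZM la)).
Proof.
have asc mu : mu (s_lo i) < mu (s_hi i) -> wspan ZM (lowe mu) (TI i (ZM mu)).
  move=> a; rewrite -[TI i _](subrK (ZM (wt_act (simple i) mu))).
  apply: wspanD; last by apply: wspan_gen; rewrite /lowe wdeg_act wnorm_act.
  by apply: wspan_sub (heckeTinv_zmon_asc a) => ka [h1 h2]; split=> //; apply: ltnW.
case: (ltgtP (la (s_lo i)) (la (s_hi i))) => c; first exact: asc.
  (* At a descent, write z^la as (z^la + s_i z^la) - s_i z^la: the bracket is symmetric, hence an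
     eigenvector, and the remaining monomial has an ascent at i. *)
  rewrite -[ZM la](addrK (ZM (wt_act (simple i) la))) heckeTinvD //  heckeTinvN //.
  apply: wspanD; last first.
    apply/wspanN/(@wspan_sub _ _ _ (lowe (wt_act (simple i) la))).
      by move=> ka; rewrite /lowe wdeg_act wnorm_act.
    by apply: asc; rewrite !wt_act_simple simple_lo simple_hi.
  rewrite heckeTinv_sym // -?zscalV; last first.
    by rewrite zpermD !zperm_zmon wt_simpleK addrC.
  by apply/wspanZ/wspanD; apply: wspan_gen; rewrite /lowe ?wdeg_act ?wnorm_act.
rewrite heckeTinv_sym // -?zscalV; last by rewrite zperm_zmon wt_act_tie.
exact/wspanZ/wspan_gen.
Qed.

Lemma wspan_heckeTinv i la f : wspan ZM (low la) f -> wspan ZM (low la) (TI i f).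
Proof.
move=> [s [hs ->]]; rewrite heckeTinv_sum //; apply: wspan_sum => x /hs[h1 h2] _.
rewrite heckeTinvZ //; apply: wspanZ; apply: wspan_sub (heckeTinv_zmon_le i x.2) => ka [k1 k2].
by split; [rewrite k1|apply: leq_ltn_trans k2 h2].
Qed.

(** Along a descent word each letter acts at an ascent, where the leading monomial is permuted with
    coefficient 1; terms of smaller norm stay smaller because T_i^-1 never raises the norm. *)
Lemma Ffun_triangular la : wspan ZM (low la) (FF la - ZM la).
Proof.
have [n] := ubnP (winv la); elim: n la => // n IH la; rewrite ltnS => le.
have [s|/exists_descent[k dk]] := boolP (wsorted la).
  by rewrite Ffun_sorted // subrr; apply: wspan0.
rewrite (Ffun_desc t0 dk); set mu := wt_act (simple k) la.
have ltk : (winv mu < n)%N by rewrite -(winv_desc dk).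
have em : wt_act (simple k) mu = la by rewrite wt_simpleK.
rewrite -[FF mu](subrK (ZM mu)) heckeTinvD // -addrA.
have lm ka : low mu ka -> low la ka by rewrite /low wdeg_act wnorm_act.
apply: wspanD.
  apply: wspan_heckeTinv; exact: wspan_sub lm (IH _ ltk).
apply: (wspan_sub lm); rewrite -em; apply: heckeTinv_zmon_asc.
by rewrite !wt_act_simple simple_lo simple_hi.
Qed.

Lemma zmon_in_Fspan la : wspan FF (lowe la) (ZM la).
Proof.
have [n] := ubnP (wnorm la); elim: n la => // n IH la; rewrite ltnS => le.
rewrite -[ZM la](subKr (FF la)); apply: wspanD; first by apply: wspan_gen.
apply: wspanN; apply: wspan_trans (Ffun_triangular la) => ka [h1 h2].
apply: (@wspan_sub _ _ _ (lowe ka)) (IH ka _); last exact: leq_trans h2 le.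
by move=> mu [m1 m2]; split; [rewrite m1|apply: leq_trans m2 (ltnW h2)].
Qed.
End Triangularity.

Section Coefficients.
Variables (K : fieldType) (t : K) (l : nat).
Hypothesis t0 : t != 0.
Implicit Types (f g : zfield K l) (la mu ka : wt l) (s : seq (K * wt l)).
Local Notation sc := (@zscal K l).
Local Notation FF := (@Ffun K t l).
Local Notation ZM := (@zmon K l).
Local Notation tf := (@FracField.tofrac (mpoly l K)).

Definition wmnm la : 'X_{1..l} := [multinom `|la p|%N | p < l].

Lemma zmon_nonneg la : (forall p, 0 <= la p) -> ZM la = tf 'X_[wmnm la].
Proof.
move=> h; rewrite mpolyXE_id rmorph_prod /zmon; apply: eq_bigr => p _.
by rewrite rmorphXn mnmE /= -[in LHS](gez0_abs (h p)).
Qed.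

Lemma zmon_indep s : \sum_(x <- s) sc x.1 * ZM x.2 = 0 ->
  forall ka, \sum_(x <- s | x.2 == ka) x.1 = 0.
Proof.
(* [N] bounds all exponents that occur, so multiplication by z^(N, ..., N) turns the relation into
   one between polynomials, whose coefficients can be compared. *)
move=> h ka; pose N := (\sum_(mu <- ka :: [seq x.2 | x <- s]) \sum_p `|mu p|)%N.
have bound mu : mu \in ka :: [seq x.2 | x <- s] -> forall p, 0 <= mu p + N%:Z.
  move=> hm p; have : (`|mu p| <= N)%N.
    rewrite /N (big_rem mu) //= (bigD1 p) //= -!addnA; exact: leq_addr.
  by lia.
pose sh : wt l := [ffun _ => N%:Z].
have shE mu p : (mu + sh) p = mu p + N%:Z by rewrite !ffunE.
have : \sum_(x <- s) sc x.1 * ZM (x.2 + sh) = 0.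
  transitivity ((\sum_(x <- s) sc x.1 * ZM x.2) * ZM sh); last by rewrite h mul0r.
  by rewrite mulr_suml; apply: eq_bigr => x _; rewrite zmonD mulrA.
have -> : \sum_(x <- s) sc x.1 * ZM (x.2 + sh) =
          tf (\sum_(x <- s) x.1 *: 'X_[wmnm (x.2 + sh)]).
  rewrite rmorph_sum big_seq [RHS]big_seq; apply: eq_bigr => x xs.
  rewrite zmon_nonneg => [|p]; last by rewrite shE bound // inE (map_f snd xs) orbT.
  by rewrite /= -mul_mpolyC rmorphM.
move/eqP; rewrite tofrac_eq0 => /eqP /(congr1 (mpoly.mcoeff (wmnm (ka + sh)))).
rewrite mpoly.mcoeff0 raddf_sum /= => e; rewrite -[RHS]e big_mkcond big_seq [RHS]big_seq.
apply: eq_bigr => x xs; rewrite mpoly.mcoeffZ mpoly.mcoeffX.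
have -> : (wmnm (x.2 + sh) == wmnm (ka + sh)) = (x.2 == ka).
  apply/eqP/eqP => [e'|-> //]; apply/ffunP => p.
  have b1 : 0 <= x.2 p + N%:Z by apply: bound; rewrite inE (map_f snd xs) orbT.
  have b2 : 0 <= ka p + N%:Z by apply: bound; rewrite mem_head.
  have := congr1 (fun m : 'X_{1..l} => m p) e'; rewrite /= !mnmE !shE => e2.
  by apply: (addIr N%:Z); rewrite -(gez0_abs b1) -(gez0_abs b2) e2.
by case: (_ == ka); rewrite ?mulr1 ?mulr0.
Qed.

Lemma Ffun_indep s : \sum_(x <- s) sc x.1 * FF x.2 = 0 ->
  forall ka, \sum_(x <- s | x.2 == ka) x.1 = 0.
Proof.
move=> h.
have tri la : exists s0 : seq (K * wt l), (forall x, x \in s0 -> low la x.2) /\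
    FF la - ZM la = \sum_(x <- s0) sc x.1 * ZM x.2 := Ffun_triangular t0 la.
have [e he] := boolp.choice tri.
pose s' := s ++ flatten [seq [seq (x.1 * y.1, y.2) | y <- e x.2] | x <- s].
have hs' : \sum_(x <- s') sc x.1 * ZM x.2 = 0.
  transitivity (\sum_(x <- s) sc x.1 * FF x.2); last exact: h.
  rewrite /s' big_cat /= big_flatten /= big_map -big_split /=; apply: eq_bigr => x _.
  have [_ ex] := he x.2; rewrite big_map -[FF x.2](subrK (ZM x.2)) ex mulrDr addrC.
  by congr (_ + _); rewrite mulr_sumr; apply: eq_bigr => y _; rewrite zscalM mulrA.
(* No weight in [s] has norm above [M], and from there the claim descends: the correction at [ka]
   involves only weights of larger norm, whose total coefficients already vanish. *)
pose M := (\sum_(x <- s) wnorm x.2)%N.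
suff st k ka : (M < wnorm ka + k)%N -> \sum_(x <- s | x.2 == ka) x.1 = 0.
  by move=> ka; apply: (st M.+1 ka); rewrite addnS ltnS leq_addl.
elim: k ka => [|k IH] ka lt.
  rewrite big_seq_cond big1 // => x /andP[xs /eqP xk]; move: lt.
  by rewrite addn0 -xk /M (big_rem x) //= ltnNge leq_addr.
have := zmon_indep hs' ka; rewrite /s' big_cat big_flatten /= big_map.
set X := (X in _ + X = 0 -> _); suff -> : X = 0 by rewrite addr0.
rewrite /X; pose E la := \sum_(y <- e la | y.2 == ka) y.1.
transitivity (\sum_(x <- s) x.1 * E x.2).
  by apply: eq_bigr => x _; rewrite big_map /E mulr_sumr.
rewrite (@big_group_seq _ _ _ s (fun x => x.2) (undup [seq x.2 | x <- s])) ?undup_uniq //; last first.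
  by move=> x xs; rewrite mem_undup map_f.
rewrite big1_seq // => la _.
have -> : \sum_(x <- s | x.2 == la) x.1 * E x.2 = (\sum_(x <- s | x.2 == la) x.1) * E la.
  by rewrite mulr_suml; apply: eq_bigr => x /eqP ->.
have [lt'|le] := ltnP (wnorm ka) (wnorm la).
  by rewrite IH ?mul0r //; lia.
rewrite [E la]big1_seq ?mulr0 // => y /andP[/eqP yk ye].
by have [_] := (he la).1 _ ye; rewrite yk ltnNge le.
Qed.

Definition evF (c : {malg K[wt l]}) : zfield K l :=
  \sum_(la <- monalg.msupp c) sc (monalg.mcoeff la c) * FF la.

Lemma evF_sub (U : seq (wt l)) (c : {malg K[wt l]}) : uniq U ->
  {subset (monalg.msupp c : seq _) <= U} ->
  evF c = \sum_(la <- U) sc (monalg.mcoeff la c) * FF la.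
Proof.
move=> uU sub; rewrite /evF [RHS](bigID (fun la => la \in monalg.msupp c)) /=.
rewrite [X in _ = _ + X]big1 ?addr0 => [|la n]; last first.
  by rewrite monalg.mcoeff_outdom // zscal0 mul0r.
rewrite -[RHS]big_filter; apply: perm_big; apply: uniq_perm; rewrite ?filter_uniq ?fset_uniq //.
by move=> la; rewrite mem_filter; case: (boolP (la \in _)) => // /sub ->.
Qed.

(** [xget] falls back on its default only if no expansion exists; collecting equal weights in [s]
    produces one. *)
Lemma FexpP s g : g = \sum_(x <- s) sc x.1 * FF x.2 -> g = evF (Fexp t g).
Proof.
move=> eg; apply: (@classical_sets.xgetPex _ 0 (fun c => g = evF c)).
pose c := \sum_(x <- s) mkmalgU x.2 x.1.
have cE la : monalg.mcoeff la c = \sum_(x <- s | x.2 == la) x.1.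
  rewrite raddf_sum /= [RHS]big_mkcond; apply: eq_bigr => x _.
  by rewrite monalg.mcoeffU; case: eqP => _; rewrite ?mulr1n ?mulr0n.
pose U := undup ([seq x.2 | x <- s] ++ monalg.msupp c).
exists c; rewrite (@evF_sub U) ?undup_uniq //; last first.
  by move=> la h; rewrite mem_undup mem_cat h orbT.
rewrite eg (@big_group_seq _ _ _ s (fun x => x.2) U) ?undup_uniq //; last first.
  by move=> x xs; rewrite mem_undup mem_cat map_f.
apply: eq_bigr => la _; rewrite cE zscal_sum mulr_suml.
by apply: eq_bigr => x /eqP ->.
Qed.

(** By linear independence the expansion chosen in [Fexp] agrees with every other one. *)
Lemma FcoefE s g ka : g = \sum_(x <- s) sc x.1 * FF x.2 ->
  Fcoef t ka g = \sum_(x <- s | x.2 == ka) x.1.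
Proof.
move=> eg; have e := FexpP eg; rewrite /Fcoef; set c := Fexp t g in e *.
have := @Ffun_indep (s ++ [seq (- monalg.mcoeff la c, la) | la <- monalg.msupp c]) _ ka.
rewrite !big_cat /= !big_map /= => /(_ _)/eqP; rewrite addr_eq0.
have -> : \sum_(la <- monalg.msupp c | la == ka) - monalg.mcoeff la c = - monalg.mcoeff ka c.
  rewrite sumrN; congr (- _); have [i|n] := boolP (ka \in monalg.msupp c).
    by rewrite big_mkcond (bigD1_seq ka) ?fset_uniq //= eqxx big1 ?addr0 // => la /negbTE ->.
  rewrite monalg.mcoeff_outdom // big_seq_cond big1 // => la /andP[h /eqP e'].
  by rewrite -e' h in n.
move=> /(_ _)/eqP ->; rewrite ?opprK //.
rewrite -eg {1}e /evF -big_split big1 //= => la _.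
by rewrite zscalN mulNr subrr.
Qed.

Definition laurent g := wspan FF (fun _ => True) g.

Lemma laurentD f g : laurent f -> laurent g -> laurent (f + g).
Proof. exact: wspanD. Qed.
Lemma laurentZ c f : laurent f -> laurent (sc c * f).
Proof. exact: wspanZ. Qed.

Lemma FcoefD ka f g : laurent f -> laurent g ->
  Fcoef t ka (f + g) = Fcoef t ka f + Fcoef t ka g.
Proof.
move=> [s [_ e]] [s' [_ e']]; rewrite (FcoefE _ e) (FcoefE _ e').
by rewrite -big_cat; apply: FcoefE; rewrite big_cat e e'.
Qed.

Lemma FcoefZ ka c f : laurent f -> Fcoef t ka (sc c * f) = c * Fcoef t ka f.
Proof.
move=> [s [_ e]]; rewrite (FcoefE _ e).
rewrite (@FcoefE [seq (c * x.1, x.2) | x <- s]) ?big_map ?mulr_sumr //.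
by rewrite e mulr_sumr; apply: eq_bigr => x _; rewrite zscalM mulrA.
Qed.

Lemma Fcoef_sum ka (I : eqType) (r : seq I) (P : pred I) (F : I -> zfield K l) :
  (forall i, i \in r -> P i -> laurent (F i)) ->
  Fcoef t ka (\sum_(i <- r | P i) F i) = \sum_(i <- r | P i) Fcoef t ka (F i).
Proof.
move=> h; rewrite big_seq_cond [RHS]big_seq_cond.
have : laurent (\sum_(i <- r | (i \in r) && P i) F i) /\
  Fcoef t ka (\sum_(i <- r | (i \in r) && P i) F i) =
  \sum_(i <- r | (i \in r) && P i) Fcoef t ka (F i); last by case.
apply: (big_rec2 (fun x y => laurent y /\ Fcoef t ka y = x)).
  split; first exact: wspan0.
  by rewrite (@FcoefE [::]) ?big_nil.
move=> i x y /andP[hi Pi] [ly <-]; have li := h i hi Pi.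
by split; [exact: laurentD|rewrite FcoefD].
Qed.

Lemma Fcoef_wspan0 P ka g : wspan FF P g -> ~ P ka -> Fcoef t ka g = 0.
Proof.
move=> [s [hs e]] n; rewrite (FcoefE _ e) big_seq_cond big1 // => x /andP[/hs h /eqP xk].
by case: n; rewrite -xk.
Qed.

End Coefficients.

(** * Pieri rules *)

Section WeightShifts.
Variable l : nat.
Implicit Types (j : 'I_l.-1) (p q : 'I_l) (la mu : wt l) (S : {set 'I_l}) (w : 'S_l) (m : nat).

Definition eps S : wt l := [ffun p => (p \in S : nat)%:Z].

Lemma eps_act w S : wt_act w (eps S) = eps ((w^-1)%g @^-1: S).
Proof. by apply/ffunP => p; rewrite !ffunE inE. Qed.

Lemma wt_actD w la mu : wt_act w (la + mu) = wt_act w la + wt_act w mu.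
Proof. by apply/ffunP => p; rewrite !ffunE. Qed.
Lemma wt_actN w la : wt_act w (- la) = - wt_act w la.
Proof. by apply/ffunP => p; rewrite !ffunE. Qed.

Lemma simple_lt_block j m p : j.+1 != m -> (simple j p < m)%N = (p < m)%N.
Proof.
move=> jm; rewrite val_simple; case: ifP => [/eqP ->|_].
  by apply/idP/idP; lia.
by case: ifP => [/eqP ->|//]; apply/idP/idP; lia.
Qed.

Lemma sub_block_perm w m S : (forall p, (w p < m)%N = (p < m)%N) ->
  (w @^-1: S \subset [pred p : 'I_l | (p < m)%N]) = (S \subset [pred p : 'I_l | (p < m)%N]).
Proof.
move=> h; apply/subsetP/subsetP => sub p; last by rewrite !inE => /sub; rewrite inE h.
move=> pS; have := sub ((w^-1)%g p); rewrite !inE permKV => /(_ pS).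
by rewrite -h permKV.
Qed.

Lemma preimset_simpleK j S : simple j @^-1: (simple j @^-1: S) = S.
Proof. by apply/setP => p; rewrite !inE simple2. Qed.

Lemma preim_simple_inj j : injective (fun S : {set 'I_l} => simple j @^-1: S).
Proof. by move=> S S' /(congr1 (fun X : {set 'I_l} => simple j @^-1: X)); rewrite !preimset_simpleK. Qed.

Lemma card_preim_perm w S : #|w @^-1: S| = #|S|.
Proof. exact/card_preimset/perm_inj. Qed.

End WeightShifts.

Section Pieri.
Variables (K : fieldType) (t : K) (l : nat).
Hypothesis t0 : t != 0.
Implicit Types (i j : 'I_l.-1) (p q : 'I_l) (f g : zfield K l) (la mu ka : wt l).
Implicit Types (S : {set 'I_l}) (w sigma : 'S_l) (m k : nat).
Local Notation TI := (@heckeTinv K t l).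
Local Notation sc := (@zscal K l).
Local Notation FF := (@Ffun K t l).
Local Notation ZM := (@zmon K l).

(* e_k(z_1^-1, ..., z_m^-1) *)
Definition elemV m k : zfield K l :=
  \sum_(S : {set 'I_l} | (S \subset [pred p : 'I_l | (p < m)%N]) && (#|S| == k)) ZM (- eps S).

Lemma elemV_sym j m k : j.+1 != m -> zperm (simple j) (elemV m k) = elemV m k.
Proof.
move=> jm; rewrite /elemV (rmorph_sum (zperm (simple j))).
rewrite [RHS](reindex_inj (@preim_simple_inj _ j)).
apply: eq_big => S; last first.
  by move=> _; apply: (etrans (zperm_zmon _ _ _)); rewrite wt_actN eps_act simpleV.
by rewrite card_preim_perm sub_block_perm // => p; apply: simple_lt_block.
Qed.

(** Every descent met has size exactly 1; the sum over 1 <= r < 1 in [heckeTinv_zmon] is then empty,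
    and T_i^-1 merely permutes the monomial. *)
Lemma Ffun_almost_sorted la : (forall p q, (p < q)%N -> la p <= la q + 1) -> FF la = ZM la.
Proof.
have [n] := ubnP (winv la); elim: n la => // n IH la; rewrite ltnS => le h.
have [s|/exists_descent[j dj]] := boolP (wsorted la); first exact: Ffun_sorted.
have := h _ _ (s_lo_lt_hi j) => hj.
have ej : la (s_lo j) = la (s_hi j) + 1 by move: hj dj; lia.
rewrite (Ffun_desc t0 dj) IH -?(winv_desc dj) //; last first.
  move=> p q pq; rewrite !wt_act_simple.
  have [/andP[/eqP -> /eqP ->]|n'] := boolP ((p == s_lo j) && (q == s_hi j)).
    by rewrite simple_lo simple_hi ej; lia.
  exact/h/simple_lt.
rewrite (@heckeTinv_zmon _ _ _ t0 j _ 1) //; last by rewrite !wt_act_simple simple_lo simple_hi.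
by rewrite big_geq // mulr0 subr0 wt_simpleK.
Qed.

(** Descents of size 1 within the first m positions that subtracting the strip turns into ties; each
    costs a factor t^-1. *)
Definition pieri_stat m ka S : nat :=
  #|[set pq : 'I_l * 'I_l | [&& (pq.1 < pq.2)%N, pq.1 \in S, pq.2 \notin S,
      (pq.2 < m)%N & ka pq.1 == ka pq.2 + 1]]|.

(** Induction on inversions. For sorted [ka] all weights [ka - eps S] are almost sorted and the rule
    is one for monomials. Otherwise strip a descent j: by the hypothesis it does not cross position
    m, so T_j^-1 commutes with [elemV], and in each term it meets either a descent again or a new
    tie, counted by [pieri_stat]. *)
Lemma Ffun_pieri m k ka :
  (forall p q, (p < m)%N -> (m <= q)%N -> ka p <= ka q) ->
  elemV m k * FF ka =
  \sum_(S : {set 'I_l} | (S \subset [pred p : 'I_l | (p < m)%N]) && (#|S| == k))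
     sc (t^-1 ^+ pieri_stat m ka S) * FF (ka - eps S).
Proof.
have [n] := ubnP (winv ka); elim: n ka => // n IH ka; rewrite ltnS => le h.
have [s|/exists_descent[j dj]] := boolP (wsorted ka).
  move/wsortedP: (s) => s'.
  rewrite Ffun_sorted // mulr_suml; apply: eq_bigr => S /andP[/subsetP sS _].
  rewrite [pieri_stat _ _ _](_ : _ = 0%N) ?expr0 ?zscal1 ?mul1r; last first.
    apply/eqP; rewrite cards_eq0; apply/eqP/setP => -[p q]; rewrite !inE /=.
    apply/negP => /and5P[pq _ _ _ /eqP e]; have := s' _ _ (ltnW pq); rewrite e; lia.
  rewrite Ffun_almost_sorted ?zmonD 1?mulrC // => p q pq; have := s' _ _ (ltnW pq).
  rewrite !ffunE; case: (p \in S); case: (q \in S) => /=; lia.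
have jm : j.+1 != m.
  apply/eqP => e; have := h (s_lo j) (s_hi j); rewrite /= -e leqnn => /(_ isT isT).
  by rewrite leNgt dj.
have ltj : (winv (wt_act (simple j) ka) < n)%N by rewrite -(winv_desc dj).
rewrite (Ffun_desc t0 dj) -heckeTinvM_sym ?elemV_sym // IH // => [|p q pm mq]; last first.
  by rewrite !wt_act_simple h // ?simple_lt_block // leqNgt simple_lt_block // -leqNgt.
rewrite heckeTinv_sum // [LHS](reindex_inj (@preim_simple_inj _ j)).
apply: eq_big => S.
  by rewrite card_preim_perm sub_block_perm // => p; apply: simple_lt_block.
rewrite sub_block_perm => [|p]; last exact: simple_lt_block.
move=> /andP[/subsetP sS _]; rewrite heckeTinvZ //.
set la := ka - eps S.
have -> : wt_act (simple j) ka - eps (simple j @^-1: S) = wt_act (simple j) la.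
  by rewrite wt_actD wt_actN eps_act simpleV.
pose R p q := [&& p \in S, q \notin S, (q < m)%N & ka p == ka q + 1].
have -> : pieri_stat m ka S =
    (R (s_lo j) (s_hi j) + pieri_stat m (wt_act (simple j) ka) (simple j @^-1: S))%N.
  rewrite /pieri_stat; have := card_inv_desc R dj => e.
  apply: (etrans _ (etrans e _)).
    apply: eq_card => -[p q]; rewrite !inE /R /=; case: (p < q)%N => //=.
    by apply/idP/idP => [/and4P[-> -> -> /eqP e']|/andP[_ //]]; rewrite e' eqxx !andbT; lia.
  congr addn; apply: eq_card => -[p q]; rewrite !inE /R /= !wt_act_simple.
  case: (p < q)%N => //=; rewrite simple_lt_block //.
  by apply/idP/idP => [/andP[_ //]|/and4P[-> -> -> /eqP e']]; rewrite e' eqxx !andbT; lia.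
rewrite exprD [sc (t^-1 ^+ (R _ _) * _)]zscalM -mulrA [RHS]mulrCA; congr (_ * _).
have laE p : la p = ka p - (p \in S : nat)%:Z by rewrite !ffunE.
have [r|nr] := boolP (R (s_lo j) (s_hi j)).
  move: r => /and4P[r1 r2 _ /eqP r3].
  have tie : la (s_lo j) = la (s_hi j) by rewrite !laE r1 (negbTE r2) r3; lia.
  by rewrite wt_act_tie // Ffun_tie // expr1 zscalV.
rewrite /= expr0 zscal1 mul1r; symmetry; apply: (Ffun_desc t0).
rewrite !laE; move: nr; rewrite /R.
(* The descent at j could be lost only for j in S, j + 1 not in S and a difference of 1. Then j + 1
   < m, since j < m and j + 1 differs from m, and this is the case [R] already excluded. *)
case lS : (s_lo j \in S) => /=; last by case: (s_hi j \in S); move: dj; lia.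
case hS : (s_hi j \in S) => /=; first by move: dj; lia.
have -> /= : (j.+1 < m)%N by have := sS _ lS; rewrite inE /=; lia.
by move: dj => dj /eqP; lia.
Qed.
End Pieri.

Section ActiveRows.
Variable l : nat.
Implicit Types (i j : 'I_l.-1) (p q : 'I_l) (la mu ka : wt l).
Implicit Types (S : {set 'I_l}) (w sigma : 'S_l) (m k : nat).

Lemma ell_desc j sigma : (sigma (s_hi j) < sigma (s_lo j))%N ->
  ell sigma = (ell (simple j * sigma)%g).+1.
Proof.
move=> d; pose la : wt l := [ffun p => (sigma p : nat)%:Z].
have dla : la (s_hi j) < la (s_lo j) by rewrite !ffunE ltz_nat.
have := card_inv_desc (fun _ _ => true) dla; rewrite add1n => e.
rewrite /ell; apply: (etrans _ (etrans e _)).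
  by apply: eq_card => x; rewrite !inE !ffunE ltz_nat andbT.
by congr _.+1; apply: eq_card => x; rewrite !inE !ffunE ltz_nat !permM andbT.
Qed.

Lemma wperm_rcons u j : wperm (rcons u j) = (simple j * wperm u)%g.
Proof. by elim: u => [|i u IH] /=; rewrite ?mulg1 ?mul1g // IH mulgA. Qed.

Section Active.
Variables (sigma : 'S_l) (m : nat).

Definition active p := ((sigma^-1)%g p < m)%N.
Definition actset : {set 'I_l} := [set p | active p].
(** If sigma increases on each of the two blocks of positions, cut at m, then all inversions of its
    inverse are between an inactive row and a later active one; these are the tied ones, so in that
    case [ties] is [rties]. *)
Definition ties la : nat :=
  #|[set pq : 'I_l * 'I_l | [&& (pq.1 < pq.2)%N, ~~ active pq.1, active pq.2
      & la pq.1 == la pq.2]]|.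
Definition strip_stat la S : nat :=
  #|[set pq : 'I_l * 'I_l | [&& (pq.1 < pq.2)%N, pq.1 \in S, pq.2 \notin S,
      active pq.2 & la pq.1 == la pq.2 + 1]]|.
Definition active_dominated la := forall p q, active p -> ~~ active q -> la p <= la q.

Lemma active_dominated_eps la S : active_dominated la -> S \subset actset ->
  active_dominated (la - eps S).
Proof.
move=> h sS p q ap nq; rewrite !ffunE.
have -> : q \in S = false by apply/negP => /(subsetP sS); rewrite inE (negbTE nq).
by have := h p q ap nq; case: (p \in S) => /=; lia.
Qed.
End Active.

Lemma block_mono m sigma :
  (forall j, j.+1 != m -> (sigma (s_lo j) < sigma (s_hi j))%N) ->
  forall x y : 'I_l, (x < y)%N -> (y < m)%N || (m <= x)%N -> (sigma x < sigma y)%N.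
Proof.
move=> h x y; have [n] := ubnP (y - x)%N; elim: n y => // n IH y yn xy b.
have y0 : (y.-1 < l.-1)%N by have := ltn_ord y; lia.
have eh : s_hi (Ordinal y0) = y by apply: val_inj => /=; lia.
have hj : (sigma (s_lo (Ordinal y0)) < sigma y)%N.
  by rewrite -{2}eh; apply: h => /=; apply/eqP => e; move: b xy; lia.
have [e|ne] := eqVneq x (s_lo (Ordinal y0)); first by rewrite e.
apply: leq_trans hj; rewrite ltnS ltnW //; apply: IH => /=; move: ne; rewrite -?val_eqE /=; lia.
Qed.

End ActiveRows.

Section RowPieri.
Variables (K : fieldType) (t : K) (l : nat).
Hypothesis t0 : t != 0.
Implicit Types (i j : 'I_l.-1) (p q : 'I_l) (f g : zfield K l) (la mu ka : wt l).
Implicit Types (S : {set 'I_l}) (w sigma : 'S_l) (m k : nat).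
Local Notation TI := (@heckeTinv K t l).
Local Notation sc := (@zscal K l).
Local Notation FF := (@Ffun K t l).
Local Notation ZM := (@zmon K l).

(** In left-to-right notation [simple j * sigma] is sigma o s_j, so this separates the operator that
    is applied first. *)
Lemma Tbar_right j sigma f : (sigma (s_hi j) < sigma (s_lo j))%N ->
  Tbar t sigma f = Tbar t (simple j * sigma)%g (TI j f).
Proof.
move=> d; set s' := (simple j * sigma)%g.
have [e1 e2] := reduced_wordP s'.
have e : wperm (rcons (reduced_word s') j) = sigma.
  by rewrite wperm_rcons e1 mulgA /simple tperm2 mul1g.
rewrite (@Tbar_dword _ _ _ t0 (rcons (reduced_word s') j)).
  by rewrite -cats1 opw_cat.
rewrite -[in wt_act _ _]e -awE; apply: dword_aw; first exact: wsorted_idwt.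
by rewrite awE e -ell_winv (ell_desc d) size_rcons e2.
Qed.

(** As long as sigma has a descent j inside a block, T_j commutes with [elemV] and may be stripped
    without changing the set of active rows. The remaining sigma increases on both blocks, and
    [Tbar_Ffun] transports [Ffun_pieri]; the difference of [ties] in the exponent comes from its use
    before and after the strip. *)
Lemma Tbar_pieri sigma m k la g : active_dominated sigma m la ->
  Tbar t sigma g = FF la ->
  Tbar t sigma (elemV K l m k * g) =
  \sum_(S : {set 'I_l} | (S \subset actset sigma m) && (#|S| == k))
     sc (t ^ ((ties sigma m la)%:Z - (ties sigma m (la - eps S))%:Z
              - (strip_stat sigma m la S)%:Z)) * FF (la - eps S).
Proof.
have [n] := ubnP (ell sigma); elim: n sigma g => // n IH sigma g; rewrite ltnS => le dom.
case: (boolP [exists j : 'I_l.-1, (j.+1 != m) && (sigma (s_hi j) < sigma (s_lo j))%N]) => [|ne].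
  move=> /existsP[j /andP[jm d]] e; rewrite (Tbar_right _ d) heckeTinvM_sym ?elemV_sym //.
  rewrite (Tbar_right _ d) in e; set s' := (simple j * sigma)%g in e *.
  have lt' : (ell s' < n)%N by rewrite -(ell_desc d).
  have ea : active s' m =1 active sigma m.
    by move=> p; rewrite /active /s' invMg permM simpleV simple_lt_block.
  have et mu : ties s' m mu = ties sigma m mu.
    by rewrite /ties; apply: eq_card => x; rewrite !inE !ea.
  have es mu S : strip_stat s' m mu S = strip_stat sigma m mu S.
    by rewrite /strip_stat; apply: eq_card => x; rewrite !inE !ea.
  rewrite (IH _ _ lt' _ e); last by move=> p q; rewrite !ea; apply: dom.
  apply: eq_big => [S|S _]; last by rewrite !et es.
  by congr (_ && _); apply: eq_subset_r => p; rewrite !inE ea.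
(* From here on sigma increases on each block, so its inversions pair an inactive row with a later
   active row. *)
have mono : forall x y : 'I_l, (x < y)%N -> (y < m)%N || (m <= x)%N -> (sigma x < sigma y)%N.
  apply: block_mono => j jm; move: ne; rewrite negb_exists => /forallP/(_ j).
  rewrite jm /= -leqNgt leq_eqVlt => /orP[|//].
  by rewrite val_eqE (inj_eq perm_inj) (negbTE (s_lo_hi j)).
have inv p q : (p < q)%N -> ((sigma^-1)%g q < (sigma^-1)%g p)%N ->
    ~~ active sigma m p /\ active sigma m q.
  move=> pq lt; rewrite /active; case: (ltnP _ m) => h1; case: (ltnP _ m) => h2 //;
  have := mono _ _ lt; rewrite !permKV ?h1 ?h2 ?orbT => /(_ isT); lia.
have TF mu : active_dominated sigma m mu ->
    Tbar t sigma (FF (wt_act (sigma^-1)%g mu)) = sc (t ^- ties sigma m mu) * FF mu.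
  move=> dmu; rewrite Tbar_Ffun // => [|p q pq lt]; last first.
    by have [h1 h2] := inv p q pq lt; apply: dmu.
  congr (_ * _); rewrite -zscalV -exprVn.
  have -> : rties sigma mu = ties sigma m mu.
    apply: eq_card => -[p q]; rewrite !inE /=; case: (ltnP p q) => //= pq.
    apply/idP/idP => [/andP[lt ->]|/and3P[h1 h2 ->]].
      by have [-> ->] := inv p q pq lt.
    by rewrite andbT; move: h1 h2; rewrite /active -leqNgt => h1 h2; apply: leq_trans h2 h1.
  by elim: (ties _ _ _) => [|c IHc]; rewrite ?expr0 ?zscal1 // !exprS zscalM IHc.
(* As [Tbar] is injective, [g] must be the multiple of F at sigma^-1(la) that has the prescribed
   image. *)
move=> e; have eg : g = sc (t ^+ ties sigma m la) * FF (wt_act (sigma^-1)%g la).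
  apply: (opw_inj t0 (u := reduced_word sigma)); rewrite opwZ //.
  change (Tbar t sigma g = sc (t ^+ ties sigma m la) * Tbar t sigma (FF (wt_act (sigma^-1)%g la))).
  rewrite e (TF _ dom) mulrA -zscalM.
  by rewrite divff ?zscal1 ?mul1r // expf_neq0.
have aV p : (wt_act (sigma^-1)%g la) p = la (sigma p) by rewrite ffunE invgK.
rewrite eg mulrCA Ffun_pieri // => [|p q pm mq]; last first.
  by rewrite !aV; apply: dom; rewrite /active permK // -leqNgt.
have TbZ c f : Tbar t sigma (sc c * f) = sc c * Tbar t sigma f by apply: opwZ.
rewrite TbZ; apply: (etrans (congr1 _ (opw_sum t0 _ _ _ _))); rewrite mulr_sumr.
have sinj : injective (fun S : {set 'I_l} => sigma @^-1: S).
  move=> S S' /setP e'; apply/setP => p; have := e' ((sigma^-1)%g p).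
  by rewrite !inE permKV.
rewrite [LHS](reindex_inj sinj); apply: eq_big => [S|S].
  rewrite card_preim_perm; congr (_ && _); apply/subsetP/subsetP => sub p.
    by move=> pS; have := sub ((sigma^-1)%g p); rewrite !inE permKV => /(_ pS).
  by rewrite inE => /sub; rewrite inE /active permK.
move=> /andP[sS _]; have {}sS : S \subset actset sigma m.
  apply/subsetP => p pS; have := subsetP sS ((sigma^-1)%g p).
  by rewrite !inE permKV => /(_ pS).
have -> : wt_act (sigma^-1)%g la - eps (sigma @^-1: S) = wt_act (sigma^-1)%g (la - eps S).
  by rewrite wt_actD wt_actN eps_act invgK.
apply: (etrans (congr1 _ (TbZ _ _))); rewrite (TF _ (active_dominated_eps dom sS)) !mulrA -!zscalM; congr (sc _ * _).
have -> : pieri_stat m (wt_act (sigma^-1)%g la) (sigma @^-1: S) = strip_stat sigma m la S.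
  pose phi (x : 'I_l * 'I_l) := (sigma x.1, sigma x.2).
  have phiI : injective phi by move=> [a b] [c d] [] /perm_inj -> /perm_inj ->.
  rewrite /strip_stat -(card_preimset _ phiI); apply: eq_card => -[x y].
  rewrite !inE /= /active permK !aV.
  case xS : (sigma x \in S); rewrite ?andbF //=; case: (sigma y \in S); rewrite ?andbF //=.
  case ym : (y < m)%N; rewrite ?andbF //=; case: eqP; rewrite ?andbF ?andbT //=.
  have xm : (x < m)%N by have := subsetP sS _ xS; rewrite inE /active permK.
  move=> _; case: (ltngtP x y) => xy.
  - by rewrite mono // ym.
  - by have := mono _ _ xy; rewrite xm => /(_ isT); case: ltngtP.
  - by rewrite (val_inj xy) ltnn.
by rewrite exprVn !exprnN exprnP -!expfzDr //; congr (_ ^ _); ring.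
Qed.
End RowPieri.

(** * Antisymmetrized coefficients and chains of weights *)

Section AntisymmetricCoefficients.
Variables (K : fieldType) (t : K) (l : nat).
Hypothesis t0 : t != 0.
Variables (comp : 'I_l -> nat) (eta : wt l) (sigma : 'S_l).
Hypothesis comp_mono : forall p q : 'I_l, (p <= q)%N -> (comp p <= comp q)%N.
Hypothesis eta_sorted : forall x y : 'I_l, (x <= y)%N -> eta (sigma x) <= eta (sigma y).
Hypothesis sigma_comp : forall p q : 'I_l, (p < q)%N -> comp p = comp q ->
  ((sigma^-1)%g q < (sigma^-1)%g p)%N.
Implicit Types (p q : 'I_l) (f g : zfield K l) (la mu ga : wt l).
Implicit Types (S : {set 'I_l}) (w : 'S_l) (m k : nat).
Local Notation sc := (@zscal K l).
Local Notation FF := (@Ffun K t l).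
Local Notation act := (active sigma).

Definition youngm m : pred 'S_l :=
  fun w => [forall p, (comp (w p) == comp p) && (~~ act m p ==> (w p == p))].

Lemma youngm_comp m w p : youngm m w -> comp (w p) = comp p.
Proof. by move=> /forallP/(_ p)/andP[/eqP]. Qed.
Lemma youngm_fix m w p : youngm m w -> ~~ act m p -> w p = p.
Proof. by move=> /forallP/(_ p)/andP[_ /implyP h] /h /eqP. Qed.
Lemma youngm_act m w p : youngm m w -> act m (w p) = act m p.
Proof.
move=> y; case: (boolP (act m p)) => ap; last by rewrite (youngm_fix y ap) (negbTE ap).
apply: contraT => n; have := youngm_fix y n => /perm_inj e.
by rewrite e ap in n.
Qed.

Lemma comp_lt p q : (comp p < comp q)%N -> (p < q)%N.
Proof. by rewrite !ltnNge; apply: contra => /comp_mono. Qed.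

Lemma lt_comp p q : (p < q)%N -> comp p != comp q -> (comp p < comp q)%N.
Proof. by move=> pq; rewrite ltn_neqAle => ->; apply/comp_mono/ltnW. Qed.

(** Within a component sigma^-1 decreases from each row to the next, so rows become inactive from
    the bottom upwards. *)
Lemma inactive_first m p q : comp p = comp q -> ~~ act m p -> act m q -> (p < q)%N.
Proof.
move=> e; rewrite /active -leqNgt => h1 h2.
have [//|qp|/val_inj pq] := ltngtP p q; last by move: h1 h2; rewrite pq; lia.
by have := sigma_comp qp (esym e); lia.
Qed.

Lemma lt_inactive_active m w p q : youngm m w -> ~~ act m p -> act m q ->
  (p < w q)%N = (p < q)%N.
Proof.
move=> y np aq; have awq : act m (w q) by rewrite youngm_act.
have [e|ne] := eqVneq (comp p) (comp q).
  by rewrite !(@inactive_first m) // (youngm_comp _ y).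
apply/idP/idP => lt; apply: comp_lt.
  by rewrite -(youngm_comp q y); apply: lt_comp => //; rewrite (youngm_comp _ y).
by rewrite (youngm_comp q y); apply: lt_comp.
Qed.

Lemma ties_youngm m w mu : youngm m w -> ties sigma m (wt_act w mu) = ties sigma m mu.
Proof.
move=> y; pose phi (x : 'I_l * 'I_l) := (x.1, w x.2).
have phiI : injective phi by move=> [a b] [c d] [] -> /perm_inj ->.
rewrite /ties -(card_preimset _ phiI); apply: eq_card => -[p q].
rewrite !inE /= youngm_act //; case: (boolP (act m p)) => np; rewrite ?andbF //=.
case: (boolP (act m q)) => aq; rewrite ?andbF //= (lt_inactive_active y np aq).
have wp : (w^-1)%g p = p by rewrite -{1}(youngm_fix y np) permK.
by rewrite !ffunE permK wp.
Qed.

Definition comp_stat m la S : nat :=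
  #|[set pq : 'I_l * 'I_l | [&& (comp pq.1 < comp pq.2)%N, pq.1 \in S, pq.2 \notin S,
      act m pq.2 & la pq.1 == la pq.2 + 1]]|.

(** Antisymmetrization over the active rows vanishes on repeated weights; among the rearrangements
    of distinct ones this selects the decreasing one. *)
Definition regular m ga :=
  [forall p : 'I_l, forall q : 'I_l, [&& (p < q)%N, comp p == comp q & act m p] ==> (ga q < ga p)].

Lemma regularP m ga : reflect (forall p q, (p < q)%N -> comp p = comp q -> act m p -> ga q < ga p)
  (regular m ga).
Proof.
apply: (iffP 'forall_forallP) => h p q; last first.
  by apply/implyP => /and3P[pq /eqP e ap]; apply: h.
by move=> pq e ap; have := h p q; rewrite pq e eqxx ap.
Qed.

Lemma later_active m p q : (p < q)%N -> comp p = comp q -> act m p -> act m q.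
Proof. by move=> pq e; have := sigma_comp pq e; rewrite /active; lia. Qed.

Lemma regular_inj m ga p q : regular m ga -> comp p = comp q -> act m p -> act m q ->
  ga p = ga q -> p = q.
Proof.
move=> /regularP r e ap aq g; case: (ltngtP p q) => [pq|qp|/val_inj //].
  by have := r p q pq e ap; rewrite g ltxx.
by have := r q p qp (esym e) aq; rewrite g ltxx.
Qed.

(** Regularity makes the active weights of a component distinct, so a counted pair lies in two
    different components, whose order [w] preserves. The count thus no longer depends on [w]. *)
Lemma strip_comp_stat m w ga S : youngm m w -> regular m ga -> S \subset actset sigma m ->
  strip_stat sigma m (wt_act w (ga + eps S)) ((w^-1)%g @^-1: S) = comp_stat m (ga + eps S) S.
Proof.
move=> y r sS; pose phi (x : 'I_l * 'I_l) := (w x.1, w x.2).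
have phiI : injective phi by move=> [a b] [c d] [] /perm_inj -> /perm_inj ->.
rewrite /strip_stat -(card_preimset _ phiI); apply: eq_card => -[p q].
rewrite !inE /= !permK youngm_act // 2![wt_act w _ _]ffunE !permK.
case pS : (p \in S); rewrite ?andbF //=; case qS : (q \in S); rewrite ?andbF //=.
case: (boolP (act m q)) => aq; rewrite ?andbF //=.
case: eqP => e; rewrite ?andbF ?andbT //=.
have ap : act m p by have := subsetP sS _ pS; rewrite inE.
have ne : comp p != comp q.
  apply/eqP => ce; have pq : p = q.
    by apply: (regular_inj r ce ap aq); move: e; rewrite !ffunE pS qS /=; lia.
  by rewrite pq qS in pS.
apply/idP/idP => [lt|/comp_lt]; last first.
  by move=> pq; apply: comp_lt; rewrite !(youngm_comp _ y) lt_comp.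
by have := lt_comp lt; rewrite !(youngm_comp _ y); apply.
Qed.

Lemma odd_ell w : odd (ell w) = odd_perm w.
Proof.
have [e s] := reduced_wordP w; rewrite -s -[in RHS]e.
elim: (reduced_word w) => [|i u IH] /=; first by rewrite odd_perm1.
by rewrite odd_permM odd_tperm s_lo_hi -IH addbT.
Qed.

(** The value of [phi m ga] on the g with [Tbar t sigma g] equal to F_la. *)
Definition asym m ga la : K :=
  \sum_(w : 'S_l | youngm m w) (-1) ^+ ell w * (la == wt_act w ga)%:R.

(** Precomposing [w] with the transposition of p and q changes its sign but not [wt_act w ga]. *)
Lemma asym_nonregular m ga la p q : p != q -> comp p = comp q -> act m p -> act m q ->
  ga p = ga q -> asym m ga la = 0.
Proof.
move=> pq ce ap aq ge; rewrite /asym (bigID (fun w : 'S_l => odd_perm w)) /=.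
rewrite [X in _ + X](reindex_inj (mulgI (tperm p q))) /=.
rewrite [X in _ + X](eq_bigl (fun w : 'S_l => youngm m w && odd_perm w)); last first.
  move=> w; rewrite odd_permM odd_tperm pq addTb negbK; congr (_ && _).
  have sw x : comp (tperm p q x) = comp x by case: tpermP => // ->.
  apply/idP/idP => y; apply/forallP => x.
    have -> : w x = (tperm p q * w)%g (tperm p q x) by rewrite permM tpermK.
    rewrite (youngm_comp _ y) sw eqxx; apply/implyP => nx.
    have ex : tperm p q x = x by rewrite tpermD //; apply: contraNneq nx => <-.
    by rewrite ex (youngm_fix y nx).
  rewrite permM (youngm_comp _ y) sw eqxx; apply/implyP => nx.
  have ex : tperm p q x = x by rewrite tpermD //; apply: contraNneq nx => <-.
  by rewrite ex (youngm_fix y nx).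
rewrite -big_split big1 //= => w _.
have -> : wt_act (tperm p q * w)%g ga = wt_act w ga.
  rewrite wt_actM; congr wt_act; apply/ffunP => x; rewrite ffunE tpermV.
  by case: tpermP => [->|->|].
rewrite -mulrDl -(signr_odd _ (ell w)) -[X in _ + X]signr_odd !odd_ell odd_permM odd_tperm pq.
by rewrite addTb; case: (odd_perm w); rewrite /= ?expr0 ?expr1 ?addNr ?addrN mul0r.
Qed.

Definition step_exp m ga S : int :=
  (ties sigma m (ga + eps S))%:Z - (ties sigma m ga)%:Z - (comp_stat m (ga + eps S) S)%:Z.

(** For la = w(ga + eps S), transporting the strip by [w] moves it from [la] to [ga]; both
    statistics are invariant under this, so the power of t leaves the sum over [w]. *)
Lemma asym_strip m k ga la : regular m ga ->
  \sum_(S : {set 'I_l} | (S \subset actset sigma m) && (#|S| == k))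
     t ^ ((ties sigma m la)%:Z - (ties sigma m (la - eps S))%:Z
              - (strip_stat sigma m la S)%:Z) * asym m ga (la - eps S) =
  \sum_(S : {set 'I_l} | [&& S \subset actset sigma m, #|S| == k & regular m (ga + eps S)])
     t ^ step_exp m ga S * asym m (ga + eps S) la.
Proof.
move=> r; transitivity (\sum_(S : {set 'I_l} | (S \subset actset sigma m) && (#|S| == k))
     t ^ step_exp m ga S * asym m (ga + eps S) la); last first.
  rewrite [LHS](bigID (fun S => regular m (ga + eps S))) /= [X in _ + X]big1 ?addr0.
    by apply: eq_bigl => S; rewrite andbA.
  (* [ga] decreases strictly and the strip adds at most 1, so where regularity fails there is an
     equality, and the antisymmetrized term vanishes. *)
  move=> S /andP[/andP[sS _] nr]; have [p [q [pq ce ap e]]] : exists p, exists q,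
      [/\ (p < q)%N, comp p = comp q, act m p & (ga + eps S) p = (ga + eps S) q].
    move: nr; rewrite /regular negb_forall => /existsP[p]; rewrite negb_forall.
    case/existsP=> q; rewrite negb_imply -leNgt => /andP[/and3P[pq /eqP ce ap] le].
    exists p, q; split=> //; have := regularP _ _ r p q pq ce ap; move: le; rewrite !ffunE.
    by case: (p \in S); case: (q \in S) => /=; lia.
  rewrite (asym_nonregular _ _ ce ap (later_active pq ce ap) e) ?mulr0 //.
  by rewrite -val_eqE ltn_eqF.
rewrite /asym; under eq_bigr do rewrite mulr_sumr.
under [RHS]eq_bigr do rewrite mulr_sumr.
rewrite exchange_big [RHS]exchange_big /=; apply: eq_bigr => w y.
have sinj : injective (fun S : {set 'I_l} => (w^-1)%g @^-1: S).
  move=> S S' /setP e'; apply/setP => p; have := e' (w p).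
  by rewrite !inE permK.
rewrite (reindex_inj sinj) /=; apply: eq_big => [S|S].
  rewrite card_preim_perm; congr (_ && _); apply/subsetP/subsetP => sub p.
    move=> pS; have := sub (w p); rewrite !inE permK (youngm_act _ y); exact.
  rewrite inE => /sub; rewrite !inE => h.
  by rewrite -[p in act m p](permKV w) (youngm_act _ y).
move=> /andP[sS' _]; have sS : S \subset actset sigma m.
  apply/subsetP => p pS; have := subsetP sS' (w p).
  by rewrite !inE permK (youngm_act _ y); apply.
have -> : (la - eps ((w^-1)%g @^-1: S) == wt_act w ga) = (la == wt_act w (ga + eps S)).
  by rewrite wt_actD eps_act subr_eq.
case: eqP => [->|]; last by rewrite !mulr0.
congr (_ ^ _ * _); rewrite /step_exp ties_youngm // strip_comp_stat //.
by rewrite wt_actD eps_act addrK ties_youngm.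
Qed.

(** Factors act on z^{eta_-} from the last letter back, with m growing: rows that are not yet active
    still carry [eta]. *)
Definition wadm m la := (forall p, ~~ act m p -> la p = eta p) /\ active_dominated sigma m la.
Definition tspan m g := wspan FF (wadm m) (Tbar t sigma g).

(* At m = l this is the sum over S_r in the definition of G; for smaller m the inactive rows are
   frozen. *)
Definition phi m ga g : K :=
  \sum_(w : 'S_l | youngm m w) (-1) ^+ ell w * Fcoef t (wt_act w ga) (Tbar t sigma g).

Lemma TbarD f g : Tbar t sigma (f + g) = Tbar t sigma f + Tbar t sigma g.
Proof. exact: opwD. Qed.
Lemma TbarZ c f : Tbar t sigma (sc c * f) = sc c * Tbar t sigma f.
Proof. exact: opwZ. Qed.
Lemma Tbar_sum (I : Type) (r : seq I) (P : pred I) (F : I -> zfield K l) :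
  Tbar t sigma (\sum_(k <- r | P k) F k) = \sum_(k <- r | P k) Tbar t sigma (F k).
Proof. exact: opw_sum. Qed.
Lemma Tbar_inj : injective (Tbar t sigma).
Proof. exact: opw_inj. Qed.
Lemma Tbar_surj f : exists g, Tbar t sigma g = f.
Proof.
rewrite /Tbar; elim: (reduced_word sigma) f => [|i u IH] f /=; first by exists f.
by have [g e] := IH (heckeT t i f); exists g; rewrite e heckeTK.
Qed.

Lemma phi_lin m ga g (s : seq (K * wt l)) :
  Tbar t sigma g = \sum_(x <- s) sc x.1 * FF x.2 ->
  phi m ga g = \sum_(x <- s) x.1 * asym m ga x.2.
Proof.
move=> e; rewrite /phi /asym.
under [RHS]eq_bigr do rewrite mulr_sumr.
rewrite exchange_big; apply: eq_bigr => w _ /=; rewrite (FcoefE t0 _ e) big_mkcond mulr_sumr.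
by apply: eq_bigr => x _; rewrite mulrCA; congr (_ * _); case: eqP; rewrite ?mulr1 ?mulr0.
Qed.

Lemma phiD m ga f g : tspan m f -> tspan m g -> phi m ga (f + g) = phi m ga f + phi m ga g.
Proof.
move=> [s [_ e]] [s' [_ e']]; rewrite (phi_lin _ _ e) (phi_lin _ _ e') -big_cat.
by apply: phi_lin; rewrite TbarD e e' big_cat.
Qed.

Lemma phiZ m ga c f : tspan m f -> phi m ga (sc c * f) = c * phi m ga f.
Proof.
move=> [s [_ e]]; rewrite (phi_lin _ _ e) (@phi_lin _ _ _ [seq (c * x.1, x.2) | x <- s]).
  by rewrite big_map mulr_sumr; apply: eq_bigr => x _; rewrite mulrA.
by rewrite TbarZ e big_map mulr_sumr; apply: eq_bigr => x _; rewrite zscalM mulrA.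
Qed.

Lemma tspanD m f g : tspan m f -> tspan m g -> tspan m (f + g).
Proof. by rewrite /tspan TbarD; apply: wspanD. Qed.
Lemma tspanZ m c f : tspan m f -> tspan m (sc c * f).
Proof. by rewrite /tspan TbarZ; apply: wspanZ. Qed.
Lemma tspan0 m : tspan m 0.
Proof. by rewrite /tspan -[0](mul0r 0) -zscal0 TbarZ zscal0 mul0r; apply: wspan0. Qed.

Lemma wadm_eps m la S : wadm m la -> S \subset actset sigma m -> wadm m (la - eps S).
Proof.
move=> [h d] sS; split; last exact: active_dominated_eps.
move=> p np; rewrite !ffunE h //; case pS: (p \in S); last by rewrite subr0.
by have := subsetP sS _ pS; rewrite inE (negbTE np).
Qed.

(** By linearity it suffices to treat a g with [Tbar t sigma g] a single F_la, which exists because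
    [Tbar] is surjective; there the claim is [Tbar_pieri] combined with [asym_strip]. *)
Lemma elemV_rec m k g : tspan m g ->
  tspan m (elemV K l m k * g) /\
  forall ga, regular m ga -> phi m ga (elemV K l m k * g) =
  \sum_(S : {set 'I_l} | [&& S \subset actset sigma m, #|S| == k & regular m (ga + eps S)])
     t ^ step_exp m ga S * phi m (ga + eps S) g.
Proof.
move=> [s [hs e]]; elim: s g hs e => [|[c la] s IH] g hs e.
  have -> : g = 0.
    by apply: Tbar_inj; rewrite e big_nil -[0 in RHS](mul0r 0) -zscal0 TbarZ zscal0 mul0r.
  rewrite mulr0; split; first exact: tspan0.
  have p0 ga : phi m ga 0 = 0.
    rewrite (@phi_lin _ _ _ [::]) ?big_nil //.
    by rewrite -[0 in LHS](mul0r 0) -zscal0 TbarZ zscal0 mul0r.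
  by move=> ga _; rewrite p0 big1 // => S _; rewrite p0 mulr0.
have [a d] := hs (c, la) (mem_head _ _).
have [g1 e1] := Tbar_surj (FF la).
pose g2 := g - sc c * g1.
have e2 : Tbar t sigma g2 = \sum_(x <- s) sc x.1 * FF x.2.
  rewrite /g2 -mulN1r -zscal1 -zscalN TbarD TbarZ TbarZ zscalN zscal1 mulN1r e e1 big_cons.
  by rewrite addrAC subrr add0r.
have hs2 x : x \in s -> wadm m x.2 by move=> xs; apply: hs; rewrite inE xs orbT.
have [IH1 IH2] := IH g2 hs2 e2.
have eg : g = sc c * g1 + g2 by rewrite /g2 addrC subrK.
have t2 : tspan m g2 by exists s.
have t1 : tspan m g1 by rewrite /tspan e1; apply: wspan_gen.
have t1' : tspan m (elemV K l m k * g1).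
  rewrite /tspan (Tbar_pieri t0 _ d e1); apply: wspan_sum => S _ /andP[sS _].
  by apply: wspanZ; apply: wspan_gen; apply: wadm_eps.
have e3 : elemV K l m k * g = sc c * (elemV K l m k * g1) + elemV K l m k * g2.
  by rewrite eg mulrDr mulrCA.
split; first by rewrite e3; apply: tspanD => //; apply: tspanZ.
move=> ga r; rewrite e3 phiD //; last exact: tspanZ.
rewrite phiZ // IH2 //.
transitivity (c * \sum_(S : {set 'I_l} | [&& S \subset actset sigma m, #|S| == k & regular m (ga + eps S)])
     t ^ step_exp m ga S * phi m (ga + eps S) g1 +
   \sum_(S : {set 'I_l} | [&& S \subset actset sigma m, #|S| == k & regular m (ga + eps S)])
     t ^ step_exp m ga S * phi m (ga + eps S) g2); last first.
  rewrite mulr_sumr -big_split; apply: eq_bigr => S _ /=.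
  by rewrite eg (phiD _ (tspanZ c t1) t2) (phiZ _ _ t1) mulrDr mulrCA.
congr (_ * _ + _).
have p1 mu : phi m mu g1 = asym m mu la.
  have e1' : Tbar t sigma g1 = \sum_(x <- [:: (1, la)]) sc x.1 * FF x.2.
    by rewrite big_seq1 zscal1 mul1r.
  by rewrite (phi_lin _ _ e1') big_seq1 mul1r.
under [RHS]eq_bigr do rewrite p1.
rewrite -asym_strip //.
pose s1 := map (fun X : {set 'I_l} => (t ^ ((ties sigma m la)%:Z - (ties sigma m (la - eps X))%:Z
              - (strip_stat sigma m la X)%:Z), la - eps X))
   (enum [pred X : {set 'I_l} | (X \subset actset sigma m) && (#|X| == k)]).
rewrite (@phi_lin _ _ _ s1); first by rewrite big_map big_enum.
by rewrite (Tbar_pieri t0 _ d e1) big_map big_enum.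
Qed.

(** Row sigma(m) becomes active while still carrying [eta], and the monotonicity of [eta] along
    sigma bounds this by the weights of all rows that remain inactive. *)
Lemma wadmS m la : wadm m la -> wadm m.+1 la.
Proof.
move=> [h d]; have sub p : ~~ act m.+1 p -> ~~ act m p.
  by rewrite /active -!leqNgt => /ltnW.
split=> [p /sub|p q ap nq]; first exact: h.
have [ap'|np] := boolP (act m p); first exact: d ap' (sub _ nq).
rewrite (h _ np) (h _ (sub _ nq)) -(permKV sigma p) -(permKV sigma q); apply: eta_sorted.
by move: ap nq; rewrite /active; lia.
Qed.

Lemma tspan_le m n g : (m <= n)%N -> tspan m g -> tspan n g.
Proof.
move=> /subnK <-; elim: (n - m)%N => [//|k IH] /IH; rewrite addSn.
exact/wspan_sub/wadmS.
Qed.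

(* Row q = sigma(m) becomes inactive.  It is the first active row of its component,
   and la_q = eta_q is maximal, so every surviving w fixes q. *)
Lemma asym_transition m ga la (q : 'I_l) : ((sigma^-1)%g q = m :> nat) ->
  regular m.+1 ga -> wadm m la ->
  asym m.+1 ga la = (if ga q == eta q then asym m ga la else 0).
Proof.
move=> qm r [h d].
have actS p : act m.+1 p = act m p || (p == q).
  by rewrite /active ltnS leq_eqVlt orbC -qm val_eqE (inj_eq perm_inj).
have nq : ~~ act m q by rewrite /active qm ltnn.
have aq : act m.+1 q by rewrite actS eqxx orbT.
have key w : youngm m.+1 w -> la = wt_act w ga -> w q = q /\ ga q = eta q.
  move=> y e; pose p := (w^-1)%g q.
  have gp : ga p = eta q by rewrite -(h q nq) e ffunE.
  have wp : w p = q by rewrite permKV.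
  have cp : comp p = comp q by rewrite -wp (youngm_comp _ y).
  have ap : act m.+1 p by rewrite -(youngm_act _ y) wp.
  suff pq : p = q by rewrite pq in wp gp.
  apply/eqP/negPn/negP => ne.
  have ap' : act m p by move: ap; rewrite actS (negbTE ne) orbF.
  have qp := inactive_first (esym cp) nq ap'.
  have wq : w q != q by apply: contra_neq ne => wq; rewrite /p -{1}wq permK.
  have aw : act m (w q) by move: aq; rewrite -(youngm_act _ y) actS (negbTE wq) orbF.
  have le : ga q <= eta q.
    have -> : ga q = la (w q) by rewrite e ffunE permK.
    by rewrite -(h q nq); apply: d.
  by have := regularP _ _ r q p qp (esym cp) aq; rewrite gp ltNge le.
case: eqP => [gq|gq]; last first.
  rewrite /asym big1 // => w y; case: eqP => [/(key w y)[_ e]|_]; last by rewrite mulr0.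
  by case: gq.
rewrite /asym big_mkcond [RHS]big_mkcond; apply: eq_bigr => w _.
case: (boolP (youngm m.+1 w)) => y.
  case: (boolP (youngm m w)) => // n; case: eqP => [/(key w y)[wq _]|_]; last by rewrite mulr0.
  case/negP: n; apply/forallP => p; rewrite (youngm_comp _ y) eqxx; apply/implyP => np.
  have [->|ne] := eqVneq p q; first by rewrite wq.
  by rewrite (youngm_fix y) // actS (negbTE np).
case: (boolP (youngm m w)) => // y'; case/negP: y; apply/forallP => p.
rewrite (youngm_comp _ y') eqxx; apply/implyP; rewrite actS negb_or => /andP[np _].
by rewrite (youngm_fix y' np).
Qed.

Lemma phi_transition m ga g (q : 'I_l) : ((sigma^-1)%g q = m :> nat) ->
  regular m.+1 ga -> tspan m g ->
  phi m.+1 ga g = (if ga q == eta q then phi m ga g else 0).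
Proof.
move=> qm r [s [hs e]]; rewrite !(phi_lin _ _ e); case: ifP => c.
  rewrite big_seq [RHS]big_seq; apply: eq_bigr => x xs.
  by rewrite (asym_transition qm r (hs x xs)) c.
by rewrite big_seq big1 // => x xs; rewrite (asym_transition qm r (hs x xs)) c mulr0.
Qed.

Lemma wsorted_eta : wt_inc eta = wt_act (sigma^-1)%g eta.
Proof.
rewrite -(wt_inc_perm (sigma^-1)%g) wt_inc_sorted //.
by apply/wsortedP => x y xy; rewrite !ffunE invgK; apply: eta_sorted.
Qed.

(** The monomial is F at a sorted weight, and each inverted pair of rows tied in [eta] costs t^-1.
    The pairs in different components are those that e(nu, sigma) compensates. *)
Lemma Tbar_eta : Tbar t sigma (zmon K (wt_inc eta)) = sc (t ^- rties sigma eta) * FF eta.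
Proof.
have {1}-> : zmon K (wt_inc eta) = FF (wt_act (sigma^-1)%g eta).
  by rewrite -wsorted_eta Ffun_sorted // wsorted_wt_inc.
rewrite Tbar_Ffun // => [|p q pq lt]; last first.
  by rewrite -(permKV sigma p) -(permKV sigma q); apply: eta_sorted; apply: ltnW.
congr (_ * _); rewrite -zscalV -exprVn.
by elim: (rties _ _) => [|c IHc]; rewrite ?expr0 ?zscal1 // !exprS zscalM IHc.
Qed.

Lemma tspan_eta : tspan 0 (zmon K (wt_inc eta)).
Proof. by rewrite /tspan Tbar_eta; apply/wspanZ/wspan_gen; split. Qed.

Lemma phi_eta ga : phi 0 ga (zmon K (wt_inc eta)) = t ^- rties sigma eta * (ga == eta)%:R.
Proof.
rewrite (@phi_lin _ _ _ [:: (t ^- rties sigma eta, eta)]) ?big_seq1 ?Tbar_eta //=.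
congr (_ * _); rewrite /asym (big_pred1 1%g) => [|w].
  rewrite wt_act1 eq_sym [ell _](_ : _ = 0%N) ?mul1r //.
  apply/eqP; rewrite cards_eq0; apply/eqP/setP => -[p q]; rewrite !inE /= !perm1.
  by case: ltngtP.
apply/idP/eqP => [y|->]; first by apply/permP => p; rewrite perm1 (youngm_fix y).
by apply/forallP => p; rewrite perm1 !eqxx implybT.
Qed.
End AntisymmetricCoefficients.

(** * Steps of positive letters, by a sign-reversing involution *)

Section PositiveSteps.
Variables (K : fieldType) (t : K) (l : nat).
Hypothesis t0 : t != 0.
Variables (comp : 'I_l -> nat) (eta : wt l) (sigma : 'S_l).
Hypothesis comp_mono : forall p q : 'I_l, (p <= q)%N -> (comp p <= comp q)%N.
Hypothesis sigma_comp : forall p q : 'I_l, (p < q)%N -> comp p = comp q ->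
  ((sigma^-1)%g q < (sigma^-1)%g p)%N.
Variables (m D : nat).
Implicit Types (p q : 'I_l) (f g : zfield K l) (la mu ga : wt l).
Implicit Types (S : {set 'I_l}) (w : 'S_l) (n i : nat) (k : {ffun 'I_l -> 'I_D.+1}).
Local Notation sc := (@zscal K l).
Local Notation FF := (@Ffun K t l).
Local Notation act := (active sigma m).
Local Notation reg := (regular comp sigma m).
Local Notation ph := (phi t comp sigma m).
Local Notation tsp := (tspan t eta sigma m).

(** Shifts are bounded by [D] in order to range over a finite type; [D] will be the degree of the
    monomial under consideration. *)
Definition wshift ga k : wt l := [ffun p => ga p + (k p : nat)%:Z].
Definition ksum k : nat := (\sum_p k p)%N.

(** The shift adds to row p the contents ga_p + i with i < k_p; each is paired with the active rows
    q of later components whose interval from ga_q to ga_q + k_q contains it. *)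
Definition pos_count ga k : nat :=
  (\sum_(pq : 'I_l * 'I_l | (comp pq.1 < comp pq.2)%N && act pq.2)
     \sum_(0 <= i < k pq.1) ((ga pq.2 <= ga pq.1 + i%:Z)%R &&
        (ga pq.1 + i%:Z <= ga pq.2 + (k pq.2 : nat)%:Z)%R))%N.

Definition pos_ok ga k : bool :=
  [forall p : 'I_l, ~~ act p ==> (k p == 0 :> nat)] &&
  [forall p : 'I_l, forall q : 'I_l, [&& (p < q)%N, comp p == comp q & act p] ==>
     (ga q + (k q : nat)%:Z < ga p)].

Definition pos_exp ga k : int :=
  (ties sigma m (wshift ga k))%:Z - (ties sigma m ga)%:Z - (pos_count ga k)%:Z.

Lemma pos_okP ga k : reflect ((forall p, ~~ act p -> k p = 0 :> nat) /\
    (forall p q, (p < q)%N -> comp p = comp q -> act p -> ga q + (k q : nat)%:Z < ga p))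
  (pos_ok ga k).
Proof.
apply: (iffP andP) => -[h1 h2]; split.
- by move=> p np; have := forallP h1 p; rewrite np => /eqP.
- by move=> p q pq e ap; have /forallP/(_ q) := forallP h2 p; rewrite pq e eqxx ap.
- by apply/forallP => p; apply/implyP => /h1 ->.
- by apply/'forall_forallP => p q; apply/implyP => /and3P[pq /eqP e ap]; apply: h2.
Qed.

Lemma pos_ok_regular ga k : reg ga -> pos_ok ga k -> reg (wshift ga k).
Proof.
move=> _ /pos_okP[_ h]; apply/regularP => p q pq e ap; rewrite !ffunE.
by have := h p q pq e ap; lia.
Qed.

Definition ksub k S : {ffun 'I_l -> 'I_D.+1} := [ffun p => inord (k p - (p \in S))].
Definition kadd k S : {ffun 'I_l -> 'I_D.+1} := [ffun p => inord (k p + (p \in S))].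

Lemma ksubE k S p : ksub k S p = (k p - (p \in S))%N :> nat.
Proof. by rewrite ffunE inordK // ltnS (leq_trans (leq_subr _ _)) // -ltnS. Qed.

Section Toggle.
Variables (ga : wt l) (k : {ffun 'I_l -> 'I_D.+1}) (p0 : 'I_l).
Let mu := wshift ga k.
Hypothesis p0E : (0 < k p0)%N.
(* p0 is the last of the rows of nonzero shift at which mu is maximal. *)
Hypothesis p0M : forall q, (0 < k q)%N -> mu q < mu p0 \/ mu q = mu p0 /\ (q <= p0)%N.

Definition toggle_count S : nat := (pos_count ga (ksub k S) + comp_stat comp sigma m mu S)%N.
Definition toggle_ok S : bool :=
  [&& [forall p in S, 0 < k p]%N, S \subset actset sigma m, pos_ok ga (ksub k S) & reg mu].

Lemma comp_statE la S : comp_stat comp sigma m la S =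
  (\sum_(pq : 'I_l * 'I_l | (comp pq.1 < comp pq.2)%N && act pq.2)
     [&& pq.1 \in S, pq.2 \notin S & (la pq.1 == la pq.2 + 1)%R])%N.
Proof.
rewrite /comp_stat cardsE -sum1_card big_mkcond [RHS]big_mkcond; apply: eq_bigr => -[p q] _.
rewrite /= unfold_in /=; case: (comp p < comp q)%N => //=; case: (act q); rewrite ?andbF //=.
Qed.

(** The last unit of row p0 has content mu_p0 - 1. Whether it belongs to the strip or to the shift,
    it is paired with a later row q exactly if q is not in S and mu_q = mu_p0 - 1, by the choice of
    p0. For a pair (p, p0) the boxes of row p have content below mu_p <= mu_p0, so moving the end of
    row p0 by one is not noticed. *)
Lemma toggle_countD1 S : [forall p in S, 0 < k p]%N -> p0 \in S ->
  toggle_count S = toggle_count (S :\ p0).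
Proof.
move=> /forall_inP sk p0S; rewrite /toggle_count /pos_count !comp_statE -!big_split.
apply: eq_bigr => -[p q] /= /andP[cpq aq]; have pq := comp_lt comp_mono cpq.
have muE x : mu x = ga x + (k x : nat)%:Z by rewrite ffunE.
rewrite !ksubE !in_setD1.
have [ep|np] := eqVneq p p0.
  have nq : q != p0 by apply: contraTneq pq => ->; rewrite ep ltnn.
  have [n kn] : exists n, k p0 = n.+1 :> nat by exists (k p0).-1; lia.
  have mup := muE p0; have muq := muE q; rewrite kn in mup.
  rewrite nq ep p0S kn /= subn1 subn0 big_nat_recr //= addn0; congr (_ + _)%N.
  have [kq|kq] := posnP (k q).
    have nqS : q \notin S by apply/negP => /sk; rewrite kq.
    by rewrite (negbTE nqS) /= kq subn0; congr (nat_of_bool _); apply/eqP/andP; lia.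
  have lt : mu q < mu p0 by case: (p0M kq) => // -[_]; rewrite leqNgt -ep pq.
  case qS : (q \in S) => /=.
    by rewrite (_ : (_ + _ <= _) = false) ?andbF //; lia.
  by rewrite subn0; congr (nat_of_bool _); apply/eqP/andP; lia.
have [eq|nq] := eqVneq q p0; last by [].
rewrite eq p0S /= subn0 andbF addn0.
have mup := muE p; have muq := muE p0.
have [kp|kp] := posnP (k p).
  have npS : p \notin S by apply/negP => /sk; rewrite kp.
  by rewrite (negbTE npS) kp subn0 !big_geq.
have le : mu p <= mu p0 by case: (p0M kp) => [/ltW //|[-> _]].
rewrite [X in _ = (_ + X)%N](_ : _ = 0%N) ?addn0; last first.
  by case: (p \in S) => //=; case: eqP => // e; lia.
rewrite big_nat_cond [RHS]big_nat_cond; apply: eq_bigr => i /andP[/andP[_ hi] _].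
congr (nat_of_bool (_ && _)); apply/idP/idP; lia.
Qed.

Definition toggle S := if p0 \in S then S :\ p0 else p0 |: S.

Lemma toggleK : involutive toggle.
Proof.
move=> S; rewrite /toggle; case: (boolP (p0 \in S)) => h.
  by rewrite setD11 setD1K.
by rewrite setU11 setU1K.
Qed.

(** The one condition that gets harder is ga_p0 + k_p0 < ga_p for p earlier in the component.
    Regularity of mu gives mu_p0 < mu_p, and then the choice of p0 forces k_p = 0, so that mu_p =
    ga_p. *)
Lemma toggle_okD1 S : p0 \in S -> toggle_ok S = toggle_ok (S :\ p0).
Proof.
move=> p0S; have e x : x \in S = (x == p0) || (x \in S :\ p0).
  by rewrite !inE; case: eqP => // ->.
rewrite /toggle_ok; apply/and4P/and4P => -[/forall_inP h1 /subsetP h2 /pos_okP[h3 h4] r]; split => //.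
- by apply/forall_inP => p; rewrite in_setD1 => /andP[_ /h1].
- by apply/subsetP => p; rewrite in_setD1 => /andP[_ /h2].
- apply/pos_okP; split=> [p np|p q pq ce ap].
    have nS : p \notin S by apply: contra np => /h2; rewrite inE.
    by have := h3 p np; rewrite !ksubE in_setD1 (negbTE nS) andbF.
  have := h4 p q pq ce ap; rewrite !ksubE in_setD1.
  have [eq|//] := eqVneq q p0; move: pq ce; rewrite {}eq /= subn0 => pq ce _.
  have lt2 := regularP _ _ _ _ r p p0 pq ce ap.
  have [kp|kp] := posnP (k p); last by case: (p0M kp) => [|[]]; lia.
  by move: lt2; rewrite !ffunE kp addr0.
- apply/forall_inP => p; rewrite e => /orP[/eqP -> //|/h1 //].
- apply/subsetP => p; rewrite e => /orP[/eqP ->|/h2 //]; rewrite inE.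
  by apply: contraT => np; have := h3 p0 np; rewrite ksubE setD11; lia.
- apply/pos_okP; split=> [p np|p q pq ce ap].
    by have := h3 p np; rewrite !ksubE in_setD1; case: (p != p0); case: (p \in S) => /=; lia.
  by have := h4 p q pq ce ap; rewrite !ksubE in_setD1; case: (q != p0); case: (q \in S) => /=; lia.
Qed.

Lemma toggle_sum : \sum_(S | toggle_ok S) (-1) ^+ #|S| * t ^ (- (toggle_count S)%:Z) = 0.
Proof.
rewrite (bigID (fun S : {set 'I_l} => p0 \in S)) /= [X in _ + X](reindex_inj (inv_inj toggleK)) /=.
have tin S : (p0 \notin toggle S) = (p0 \in S).
  by rewrite /toggle; case: ifP => h; rewrite !inE eqxx.
rewrite [X in _ + X](eq_bigl (fun S => toggle_ok S && (p0 \in S))) => [|S]; last first.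
  rewrite tin; case: (boolP (p0 \in S)) => h; rewrite ?andbF // !andbT.
  by rewrite (toggle_okD1 h) /toggle h.
rewrite -big_split big1 //= => S /andP[/and4P[sk _ _ _] h].
rewrite (toggle_countD1 sk h) /toggle h -mulrDl (cardsD1 p0) h add1n exprS mulN1r addNr.
by rewrite mul0r.
Qed.
End Toggle.

Lemma exists_top ga k : (0 < ksum k)%N -> exists2 p0 : 'I_l, (0 < k p0)%N &
  forall q, (0 < k q)%N -> wshift ga k q < wshift ga k p0 \/
     wshift ga k q = wshift ga k p0 /\ (q <= p0)%N.
Proof.
move=> kn; have [p kp] : exists p, (0 < k p)%N.
  apply/existsP; apply: contraLR kn; rewrite negb_exists -leqNgt leqn0 => /forallP h.
  by rewrite /ksum big1 // => p _; apply/eqP; rewrite -leqn0 leqNgt h.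
case: (@arg_maxP _ _ _ p (fun q => 0 < k q)%N (wshift ga k) kp) => x kx mx.
pose P q := (0 < k q)%N && (wshift ga k q == wshift ga k x).
have Px : P x by rewrite /P kx eqxx.
case: (@arg_maxnP _ x P (fun q => nat_of_ord q) Px) => y /andP[ky /eqP ey] my.
exists y => // q kq; rewrite ey; have : wshift ga k q <= wshift ga k x := mx q kq.
rewrite le_eqVlt => /orP[/eqP e|]; last by left.
by right; split=> //; apply: my; rewrite /P kq e eqxx.
Qed.

Lemma toggle_sum0 ga k : (0 < ksum k)%N ->
  \sum_(S | toggle_ok ga k S) (-1) ^+ #|S| * t ^ (- (toggle_count ga k S)%:Z) = 0.
Proof. by move=> /exists_top-/(_ ga)[p0 h1 h2]; apply: toggle_sum h1 h2. Qed.

Lemma wshift_ksub ga k S : [forall p in S, 0 < k p]%N ->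
  wshift ga (ksub k S) + eps S = wshift ga k.
Proof.
move=> /forall_inP h; apply/ffunP => p; rewrite !ffunE inordK; last first.
  by rewrite ltnS (leq_trans (leq_subr _ _)) // -ltnS.
by case pS: (p \in S) => /=; [have := h p pS|]; lia.
Qed.

Lemma ksum_ksub k S : [forall p in S, 0 < k p]%N -> (ksum (ksub k S) + #|S|)%N = ksum k.
Proof.
move=> /forall_inP h; rewrite /ksum -sum1_card [X in (_ + X)%N]big_mkcond -big_split /=.
apply: eq_bigr => p _; rewrite ksubE; case pS: (p \in S) => //=; last by rewrite subn0 addn0.
by have := h p pS; lia.
Qed.

(* On the right, k is the total shift, of which S is the strip part. *)
Lemma strip_reindex (R : nmodType) n ga S (G : {ffun 'I_l -> 'I_D.+1} -> R) :
  (n <= D)%N -> (#|S| <= n)%N ->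
  \sum_(k | [&& (ksum k == n - #|S|)%N, pos_ok ga k, S \subset actset sigma m & reg (wshift ga k + eps S)])
     G k =
  \sum_(k | (ksum k == n) && toggle_ok ga k S) G (ksub k S).
Proof.
move=> nD Sn; rewrite (reindex_onto (fun k => ksub k S) (fun k => kadd k S)) /=; last first.
  move=> k /and4P[/eqP ks _ _ _]; apply/ffunP => p; apply: val_inj.
  rewrite /= ksubE ffunE inordK ?addnK // ltnS.
  have kp : (k p <= ksum k)%N by rewrite /ksum (bigD1 p) //= leq_addr.
  case pS: (p \in S); last by rewrite addn0 -ltnS.
  have cS : (0 < #|S|)%N by apply/card_gt0P; exists p.
  move: kp; rewrite ks /= addn1 => kp; apply: leq_ltn_trans kp _.
  by apply: leq_trans nD; rewrite -subn_gt0 subKn.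
apply: eq_bigl => k.
have eS : (kadd (ksub k S) S == k) = [forall p in S, 0 < k p]%N.
  apply/eqP/forall_inP => [/ffunP e p pS|h].
    have := congr1 val (e p); rewrite /= ffunE ksubE pS; have lk := ltn_ord (k p).
    have cS : (0 < #|S|)%N by apply/card_gt0P; exists p.
    have D0 : (0 < D)%N by apply: leq_trans nD; apply: leq_trans Sn.
    by case: (posnP (k p)) => // ->; rewrite inordK.
  apply/ffunP => p; apply: val_inj; rewrite /= ffunE ksubE; have lk := ltn_ord (k p).
  case pS: (p \in S) => /=; last by rewrite subn0 addn0 inordK.
  by have := h p pS => hp; rewrite subnK // inordK.
rewrite eS /toggle_ok; case: (boolP [forall p in S, 0 < k p]%N) => h; last by rewrite !andbF.
rewrite andbT /= -(ksum_ksub h) wshift_ksub //.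
have -> : (ksum (ksub k S) == n - #|S|)%N = (ksum (ksub k S) + #|S| == n)%N by lia.
by rewrite [X in _ && X = _]andbCA.
Qed.

Definition pos_sum ga n g : K :=
  \sum_(k | (ksum k == n) && pos_ok ga k) t ^ pos_exp ga k * ph (wshift ga k) g.

(** The counterpart of the alternating relation between e_i and h_{n-i}. After [elemV_rec] the terms
    are indexed by a shift and a strip; for a fixed total k the [ties] telescope, and the exponent
    depends on S through [toggle_count] only. *)
Lemma pos_sum_inversion ga n g : reg ga -> tsp g -> (0 < n <= D)%N ->
  \sum_(i < n.+1) (-1) ^+ i * pos_sum ga (n - i) (elemV K l m i * g) = 0.
Proof.
move=> r tg /andP[n0 nD].
pose Y S k := t ^ pos_exp ga k * (t ^ step_exp comp sigma m (wshift ga k) S *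
   ph (wshift ga k + eps S) g).
transitivity (\sum_(i < n.+1) \sum_(S : {set 'I_l} | #|S| == i) (-1) ^+ #|S| *
   \sum_(k | (ksum k == n) && toggle_ok ga k S) Y S (ksub k S)).
  apply: eq_bigr => i _; have [_ rec] := elemV_rec t0 comp_mono sigma_comp i tg.
  rewrite /pos_sum mulr_sumr.
  under eq_bigr => k /andP[_ h].
    rewrite rec ?(pos_ok_regular r h) // !mulr_sumr.
  over.
  rewrite (exchange_big_dep (fun S : {set 'I_l} => #|S| == i)) /= => [|k S _ /and3P[] //].
  apply: eq_bigr => S /eqP cS; rewrite -(strip_reindex ga (Y S) nD) ?cS //; last by rewrite -ltnS.
  rewrite mulr_sumr; apply: eq_big => [k|k _].
    by rewrite eqxx -!andbA.
  by [].
transitivity (\sum_(k | ksum k == n) \sum_(S | toggle_ok ga k S) (-1) ^+ #|S| * Y S (ksub k S)).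
  transitivity (\sum_(S : {set 'I_l} | (#|S| < n.+1)%N) (-1) ^+ #|S| *
     \sum_(k | (ksum k == n) && toggle_ok ga k S) Y S (ksub k S)).
    rewrite (partition_big (fun S : {set 'I_l} => inord #|S| : 'I_n.+1) predT) //=.
    apply: eq_bigr => i _; apply: eq_bigl => S; apply/eqP/andP => [cS|[lt /eqP <-]].
      by rewrite cS ltn_ord; split=> //; apply/eqP/val_inj; rewrite /= inordK.
    by rewrite inordK.
  under eq_bigr do rewrite mulr_sumr.
  rewrite (exchange_big_dep (fun k => ksum k == n)) /= => [|S k _ /andP[] //].
  apply: eq_bigr => k /eqP kn; apply: eq_bigl => S; rewrite kn eqxx /=.
  case: (boolP (toggle_ok ga k S)); rewrite ?andbF // => /and4P[h _ _ _].
  by rewrite andbT ltnS -kn -(ksum_ksub h) leq_addl.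
rewrite big1 // => k /eqP kn.
transitivity (t ^ ((ties sigma m (wshift ga k))%:Z - (ties sigma m ga)%:Z) * ph (wshift ga k) g *
   \sum_(S | toggle_ok ga k S) (-1) ^+ #|S| * t ^ (- (toggle_count ga k S)%:Z)); last first.
  by rewrite toggle_sum0 ?mulr0 // kn.
rewrite mulr_sumr; apply: eq_bigr => S /and4P[h _ _ _].
have e : t ^ pos_exp ga (ksub k S) * t ^ step_exp comp sigma m (wshift ga (ksub k S)) S =
    t ^ ((ties sigma m (wshift ga k))%:Z - (ties sigma m ga)%:Z) * t ^ (- (toggle_count ga k S)%:Z).
  rewrite -!expfzDr // /pos_exp /step_exp /toggle_count wshift_ksub // PoszD.
  by congr (_ ^ _); ring.
rewrite /Y [X in _ * X]mulrA e wshift_ksub //.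
move: (ph _ _) (t ^ (- _)) (t ^ _) ((-1) ^+ #|S|) => P E C s; ring.
Qed.

Variable hs : nat -> zfield K l.
Hypothesis hs_rec : forall n,
  \sum_(i < n.+1) (-1) ^+ i * (elemV K l m i * hs (n - i)) = (n == 0%N)%:R.

Lemma elemV0 : elemV K l m 0 = 1.
Proof.
rewrite /elemV (big_pred1 set0) => [|S]; last first.
  apply/andP/eqP => [[_ /eqP/cards0_eq]|->] //.
  by rewrite cards0; split=> //; apply/subsetP => p; rewrite inE.
rewrite /zmon big1 // => p _; rewrite !ffunE inE /=; exact: expr0z.
Qed.

Lemma hs_recl n : hs n = (n == 0%N)%:R +
  \sum_(i < n) (-1) ^+ i * (elemV K l m i.+1 * hs (n - i.+1)).
Proof.
have := hs_rec n; rewrite big_ord_recl /= expr0 mul1r elemV0 mul1r subn0 => <-.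
rewrite -addrA -big_split big1 ?addr0 //= => i _.
by rewrite exprS mulN1r mulNr addNr.
Qed.

Lemma sign_mul n g : (-1) ^+ n * g = @zscal K l ((-1) ^+ n) * g.
Proof.
congr (_ * _); elim: n => [|n IH]; first by rewrite !expr0 zscal1.
by rewrite !exprS zscalM IH zscalN zscal1.
Qed.

Lemma tspan_sum (I : Type) (r : seq I) (P : pred I) (F : I -> zfield K l) :
  (forall x, P x -> tsp (F x)) -> tsp (\sum_(x <- r | P x) F x).
Proof. by move=> h; apply: big_ind => //; [exact: tspan0|move=> x y; exact: tspanD]. Qed.

Lemma phi0 ga : ph ga 0 = 0.
Proof.
by rewrite -[0 in LHS](mul0r 0) -zscal0 (phiZ t0 comp ga 0 (tspan0 t0 eta sigma m)) mul0r.
Qed.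

Lemma phi_sum ga (I : Type) (r : seq I) (P : pred I) (F : I -> zfield K l) :
  (forall x, P x -> tsp (F x)) ->
  ph ga (\sum_(x <- r | P x) F x) = \sum_(x <- r | P x) ph ga (F x).
Proof.
move=> h; have : tsp (\sum_(x <- r | P x) F x) /\
    ph ga (\sum_(x <- r | P x) F x) = \sum_(x <- r | P x) ph ga (F x); last by case.
apply: (big_rec2 (fun x y => tsp x /\ ph ga x = y)); first by rewrite phi0; split=> //; exact: tspan0.
move=> i y x Pi [tx <-]; split; first by apply: tspanD => //; exact: h.
exact: (phiD t0 _ _ (h i Pi) tx).
Qed.

(** The relation [hs_rec] expresses [hs n] by smaller ones, and [pos_sum_inversion] gives the same
    recursion for [pos_sum]. *)
Lemma homV_rec n g : (n <= D)%N -> tsp g -> tsp (hs n * g) /\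
  forall ga, reg ga -> ph ga (hs n * g) = pos_sum ga n g.
Proof.
have [N] := ubnP n; elim: N n g => // N IH n g; rewrite ltnS => nN nD tg.
have step (i : 'I_n) : tsp ((-1) ^+ i * (elemV K l m i.+1 * hs (n - i.+1)) * g) /\
    forall ga, reg ga -> ph ga ((-1) ^+ i * (elemV K l m i.+1 * hs (n - i.+1)) * g) =
    (-1) ^+ i * pos_sum ga (n - i.+1) (elemV K l m i.+1 * g).
  have [te _] := elemV_rec t0 comp_mono sigma_comp i.+1 tg.
  have lti := ltn_ord i.
  have lt1 : (n - i.+1 < N)%N by lia.
  have [th eh] := IH (n - i.+1)%N _ lt1 (leq_trans (leq_subr _ _) nD) te.
  have -> : (-1) ^+ i * (elemV K l m i.+1 * hs (n - i.+1)) * g =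
     sc ((-1) ^+ i) * (hs (n - i.+1) * (elemV K l m i.+1 * g)).
    by rewrite -sign_mul -!mulrA; congr (_ * _); rewrite mulrCA.
  split; first exact: tspanZ.
  by move=> ga r; rewrite (phiZ t0 _ _ _ th) eh.
have tz : tsp ((n == 0%N)%:R * g).
  by case: (n == 0%N); rewrite ?mul1r ?mul0r //; apply: tspan0.
rewrite hs_recl mulrDl mulr_suml.
have ts : tsp (\sum_(i < n) (-1) ^+ i * (elemV K l m i.+1 * hs (n - i.+1)) * g).
  by apply: tspan_sum => i _; case: (step i).
split; first exact: tspanD.
move=> ga r; rewrite (phiD t0 _ _ tz ts) phi_sum; last by move=> i _; case: (step i).
under eq_bigr => i _ do rewrite (step i).2 //.
have [n0|n0] := posnP n.
  rewrite n0 big_ord0 addr0 mul1r /pos_sum.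
  pose k0 : {ffun 'I_l -> 'I_D.+1} := [ffun _ => ord0].
  have w0 : wshift ga k0 = ga by apply/ffunP => p; rewrite !ffunE addr0.
  have k00 p : k0 p = 0%N :> nat by rewrite ffunE.
  have ok0 : pos_ok ga k0.
    apply/pos_okP; split=> [p _|p q pq e ap]; rewrite k00 // addr0.
    exact: (regularP _ _ _ _ r p q pq e ap).
  rewrite (big_pred1 k0) => [|k]; last first.
    apply/andP/eqP => [[/eqP ks _]|->].
      apply/ffunP => p; apply: val_inj; rewrite /= k00; apply/eqP.
      by rewrite -leqn0 -ks /ksum (bigD1 p) //= leq_addr.
    by split=> //; rewrite /ksum big1.
  rewrite w0 /pos_exp w0 subrr sub0r [pos_count _ _](_ : _ = 0%N) ?mul1r //.
  by rewrite /pos_count big1 // => -[p q] _; rewrite /= k00 big_geq.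
have := pos_sum_inversion r tg (n := n); rewrite n0 nD => /(_ isT).
rewrite big_ord_recl /= expr0 mul1r elemV0 mul1r subn0 => /eqP; rewrite addr_eq0 => /eqP ->.
rewrite /= mul0r phi0 add0r -sumrN; apply: eq_bigr => i _.
by rewrite exprS mulN1r mulNr opprK.
Qed.
End PositiveSteps.

(** * Chains of weights from gamma to eta *)

Section Chains.
Variables (K : fieldType) (t : K) (l : nat).
Hypothesis t0 : t != 0.
Variables (comp : 'I_l -> nat) (eta : wt l) (sigma : 'S_l).
Hypothesis comp_mono : forall p q : 'I_l, (p <= q)%N -> (comp p <= comp q)%N.
Hypothesis eta_sorted : forall x y : 'I_l, (x <= y)%N -> eta (sigma x) <= eta (sigma y).
Hypothesis sigma_comp : forall p q : 'I_l, (p < q)%N -> comp p = comp q ->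
  ((sigma^-1)%g q < (sigma^-1)%g p)%N.
Variable D : nat.
Variable homV : nat -> nat -> zfield K l.
Hypothesis homV_elemV : forall m n,
  \sum_(i < n.+1) (-1) ^+ i * (elemV K l m i * homV m (n - i)) = (n == 0%N)%:R.
Local Notation kT := {ffun 'I_l -> 'I_D.+1}.
Implicit Types (p q : 'I_l) (f g : zfield K l) (la mu ga : wt l).
Implicit Types (S : {set 'I_l}) (w : 'S_l) (m n i : nat) (k : kT) (neg : bool).
Local Notation sc := (@zscal K l).
Local Notation act := (active sigma).
Local Notation reg := (regular comp sigma).
Local Notation ph := (phi t comp sigma).
Local Notation tsp := (tspan t eta sigma).

(** For a negative letter the interval runs backwards, from ga_q + k_q to ga_q: a point if k_q = 0,
    empty if k_q = 1. In this form both cases later become one interval from [pre] to [post]. *)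
Definition step_count neg m ga k : nat :=
  (\sum_(pq : 'I_l * 'I_l | (comp pq.1 < comp pq.2)%N && act m pq.2)
     \sum_(0 <= i < k pq.1) (if neg then
        ((ga pq.2 + (k pq.2 : nat)%:Z <= ga pq.1 + i%:Z) && (ga pq.1 + i%:Z <= ga pq.2))%R
      else ((ga pq.2 <= ga pq.1 + i%:Z) &&
        (ga pq.1 + i%:Z <= ga pq.2 + (k pq.2 : nat)%:Z))%R))%N.

Definition step_ok neg m ga k : bool :=
  if neg then [&& [forall p, (k p <= 1)%N], [forall p, ~~ act m p ==> (k p == 0 :> nat)]
                & reg m (wshift ga k)]
  else pos_ok comp sigma m ga k.

Definition step_wt neg m ga k : K :=
  (if neg then (-1) ^+ ksum k else 1) *
  t ^ ((ties sigma m (wshift ga k))%:Z - (ties sigma m ga)%:Z - (step_count neg m ga k)%:Z).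

Definition seriesV neg m n : zfield K l :=
  if neg then (-1) ^+ n * elemV K l m n else homV m n.

Definition kset k : {set 'I_l} := [set p | (0 < k p)%N].
Definition setk S : kT := [ffun p => inord (p \in S)].

Lemma step_count_neg m ga k : [forall p, (k p <= 1)%N] ->
  step_count true m ga k = comp_stat comp sigma m (ga + eps (kset k)) (kset k).
Proof.
move=> /forallP k1; rewrite comp_statE /step_count; apply: eq_bigr => -[p q] _ /=.
rewrite !ffunE !inE; have := k1 q; have := k1 p.
case kp : (k p : nat) => [|[|//]] _; case kq : (k q : nat) => [|[|//]] _ /=.
- by rewrite big_geq.
- by rewrite big_geq.
- by rewrite big_nat1; congr (nat_of_bool _); apply/andP/eqP; lia.
- rewrite big_nat1 (_ : (_ && _) = false) //; apply/negbTE/negP => /andP; lia.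
Qed.

Lemma step_neg m n ga g : (n <= D)%N -> reg m ga -> tsp m g ->
  ph m ga (seriesV true m n * g) =
  \sum_(k : kT | (ksum k == n) && step_ok true m ga k) step_wt true m ga k * ph m (wshift ga k) g.
Proof.
move=> nD r tg; have [te rec] := elemV_rec t0 comp_mono sigma_comp n tg.
rewrite /seriesV -mulrA sign_mul (phiZ t0 _ _ _ te) rec // mulr_sumr.
rewrite (reindex_onto kset setk) /=; last first.
  move=> S /and3P[_ /eqP cS _]; apply/setP => p; rewrite inE ffunE.
  case pS : (p \in S); last by rewrite inordK.
  have cS1 : (0 < #|S|)%N by apply/card_gt0P; exists p.
  by rewrite inordK // ltnS; apply: leq_trans nD; rewrite -cS.
have kk k : (setk (kset k) == k) = [forall p, (k p <= 1)%N].
  apply/eqP/forallP => [<- p|h].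
    rewrite ffunE; case: (p \in _) => /=; last by rewrite inordK.
    by rewrite /inord val_insubd; case: ifP.
  apply/ffunP => p; apply: val_inj; rewrite /= ffunE inE.
  have := h p; have := ltn_ord (k p); case kp : (k p : nat) => [|[|//]] /= h1 _; by rewrite inordK.
have ck k : [forall p, (k p <= 1)%N] -> #|kset k| = ksum k.
  move=> /forallP h; rewrite /ksum -sum1_card big_mkcond; apply: eq_bigr => p _.
  by rewrite inE; have := h p; case: (k p : nat) => [|[|]].
have ek k ga' : [forall p, (k p <= 1)%N] -> ga' + eps (kset k) = wshift ga' k.
  move=> /forallP h; apply/ffunP => p; rewrite !ffunE inE.
  by have := h p; case: (k p : nat) => [|[|]].
apply: eq_big => [k|k /andP[/and3P[_ /eqP cS _]]].
  rewrite kk /step_ok; case: (boolP [forall p, (k p <= 1)%N]) => h; rewrite ?andbF //=.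
  rewrite ck // ek // andbT; rewrite [in RHS]andbCA; congr (_ && _).
  by apply/subsetP/forall_inP => sub p; [move=> np|]; rewrite ?inE;
    [apply: contraNT np => kp; have := sub p; rewrite !inE lt0n => /(_ kp)
    |rewrite lt0n; apply: contraNT => np; have := sub p np].
rewrite kk => h; rewrite /step_wt step_count_neg // -ek // mulrA; congr (_ * _ * _).
  by rewrite -cS ck.
Qed.

Lemma step_pos m n ga g : (n <= D)%N -> reg m ga -> tsp m g ->
  ph m ga (seriesV false m n * g) =
  \sum_(k : kT | (ksum k == n) && step_ok false m ga k) step_wt false m ga k * ph m (wshift ga k) g.
Proof.
move=> nD r tg.
have [_ e] := homV_rec t0 comp_mono sigma_comp (homV_elemV m) nD tg.
by rewrite /seriesV e //; apply: eq_bigr => k _; rewrite /step_wt mul1r.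
Qed.

Definition inact_ok m ga := [forall p, ~~ act m p ==> (ga p == eta p)].

(* A step (neg, m, n) adds the letter with exponent n, at the level with m active rows. *)
Fixpoint chain_sum (L : seq (bool * nat * nat)) ga : K :=
  if L is (neg, m, n) :: L' then
    if inact_ok m ga then
      \sum_(k : kT | (ksum k == n) && step_ok neg m ga k)
        step_wt neg m ga k * chain_sum L' (wshift ga k)
    else 0
  else (ga == eta)%:R.

Fixpoint steps_wf m0 (L : seq (bool * nat * nat)) : bool :=
  if L is (_, m, n) :: L' then [&& (m <= m0)%N, (n <= D)%N & steps_wf m L'] else true.

Definition sprod (L : seq (bool * nat * nat)) g : zfield K l :=
  foldr (fun s x => seriesV s.1.1 s.1.2 s.2 * x) g L.

Local Notation z0 := (zmon K (wt_inc eta)).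

Lemma tspan_seriesV neg m n g : (n <= D)%N -> tsp m g -> tsp m (seriesV neg m n * g).
Proof.
move=> nD tg; case: neg; rewrite /seriesV.
  rewrite -mulrA sign_mul; apply: tspanZ => //.
  by case: (elemV_rec t0 comp_mono sigma_comp n tg).
by case: (homV_rec t0 comp_mono sigma_comp (homV_elemV m) nD tg).
Qed.

Lemma tspan_sprod m0 L : steps_wf m0 L -> tsp m0 (sprod L z0).
Proof.
elim: L m0 => [|[[neg m] n] L IH] m0 /=.
  by move=> _; exact: (tspan_le t0 eta_sorted (leq0n _) (tspan_eta t0 eta_sorted)).
case/and3P=> mm nD wf; apply: (tspan_le t0 eta_sorted mm).
by apply: tspan_seriesV => //; apply: IH.
Qed.

Lemma reg_le m n ga : (m <= n)%N -> reg n ga -> reg m ga.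
Proof.
move=> mn /regularP r; apply/regularP => p q pq e ap; apply: r => //.
by move: ap; rewrite /active => h; apply: leq_trans h mn.
Qed.

(** The rows sigma(m0 - 1), ..., sigma(m), counted from 0, are frozen one at a time by
    [phi_transition]; as the other inactive rows already carry [eta], the successive tests add up to
    [inact_ok m ga]. *)
Lemma phi_transitions m m0 ga g : (m <= m0)%N -> (m0 <= l)%N -> reg m0 ga -> inact_ok m0 ga ->
  tsp m g -> ph m0 ga g = (if inact_ok m ga then ph m ga g else 0).
Proof.
move=> /subnKC <-; elim: (m0 - m)%N => [|d IH]; first by rewrite addn0 => _ _ ->.
rewrite addnS => dl r ok tg; pose q := sigma (Ordinal dl).
have qm : (sigma^-1)%g q = (m + d)%N :> nat by rewrite permK.
rewrite (phi_transition t0 sigma_comp qm r (tspan_le t0 eta_sorted (leq_addr _ _) tg)).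
have -> : (ga q == eta q) = inact_ok (m + d) ga.
  apply/eqP/forallP => [e p|h]; last first.
    by have /implyP := h q; rewrite /active qm ltnn => /(_ isT)/eqP.
  apply/implyP => np; have [->|ne] := eqVneq p q; first by rewrite e.
  apply: (implyP (forallP ok p)); move: np; rewrite /active -!leqNgt leq_eqVlt => /orP[|//].
  by rewrite -qm eq_sym val_eqE (inj_eq perm_inj) (negbTE ne).
case: ifP => ok'.
  by apply: IH => //; [exact: ltnW|exact: reg_le (leqnSn _) r].
case: ifP => // ok2; case/negP: ok'; apply/forallP => p; apply/implyP => np.
apply: (implyP (forallP ok2 p)); apply: contra np; rewrite /active => h.
by apply: leq_trans h (leq_addr _ _).
Qed.

Lemma step_ok_reg neg m ga k : reg m ga -> step_ok neg m ga k -> reg m (wshift ga k).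
Proof. by case: neg => r; [rewrite /step_ok => /and3P[]|exact: (pos_ok_regular t0 r)]. Qed.

Lemma step_ok_inact neg m ga k p : step_ok neg m ga k -> ~~ act m p -> k p = 0%N :> nat.
Proof.
case: neg => /= => [/and3P[_ /forallP h _] np|/pos_okP[h _]]; last exact: h.
by apply/eqP/(implyP (h p)).
Qed.

Lemma phi_chain_sum m0 L ga : (m0 <= l)%N -> steps_wf m0 L -> reg m0 ga -> inact_ok m0 ga ->
  ph m0 ga (sprod L z0) = t ^- rties sigma eta * chain_sum L ga.
Proof.
elim: L m0 ga => [|[[neg m] n] L IH] m0 ga ml /=.
  (* When no letter is left, the passage to m = 0 freezes all rows, so only [ga = eta] survives. *)
  move=> _ r ok; rewrite (phi_transitions (leq0n _) ml r ok (tspan_eta t0 eta_sorted)) //.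
  rewrite phi_eta //; case: ifP => // n; case: eqP => [e|_]; last by rewrite mulr0.
  by case/negP: n; apply/forallP => p; rewrite e eqxx implybT.
case/and3P=> mm nD wf r ok.
have tL := tspan_sprod wf.
rewrite (phi_transitions mm ml r ok); last exact: tspan_seriesV.
case: ifP => okm; last by rewrite mulr0.
have rm := reg_le mm r.
have -> : ph m ga (seriesV neg m n * sprod L z0) = \sum_(k : kT | (ksum k == n) && step_ok neg m ga k)
    step_wt neg m ga k * ph m (wshift ga k) (sprod L z0).
  by case: neg; [apply: step_neg|apply: step_pos].
rewrite mulr_sumr; apply: eq_bigr => k /andP[_ sk].
rewrite (IH m) //; first by rewrite mulrCA.
- exact: leq_trans mm ml.
- exact: step_ok_reg sk.
- apply/forallP => p; apply/implyP => np; rewrite ffunE (step_ok_inact sk np) addr0.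
  exact: (implyP (forallP okm p)).
Qed.

Fixpoint kchains (L : seq (bool * nat * nat)) ga : seq (seq kT) :=
  if L is (neg, m, n) :: L' then
    if inact_ok m ga then
      flatten [seq [seq k :: c | c <- kchains L' (wshift ga k)] |
               k <- enum [pred k : kT | (ksum k == n) && step_ok neg m ga k]]
    else [::]
  else if ga == eta then [:: [::]] else [::].

Fixpoint chain_valid (L : seq (bool * nat * nat)) ga (c : seq kT) : bool :=
  match L, c with
  | (neg, m, n) :: L', k :: c' =>
      [&& inact_ok m ga, ksum k == n, step_ok neg m ga k & chain_valid L' (wshift ga k) c']
  | [::], [::] => ga == eta
  | _, _ => false
  end.

Fixpoint chain_wt (L : seq (bool * nat * nat)) ga (c : seq kT) : K :=
  match L, c with
  | (neg, m, n) :: L', k :: c' => step_wt neg m ga k * chain_wt L' (wshift ga k) c'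
  | _, _ => 1
  end.

Lemma mem_kchains L ga c : (c \in kchains L ga) = chain_valid L ga c.
Proof.
elim: L ga c => [|[[neg m] n] L IH] ga c /=.
  by case: eqP; rewrite inE; case: c.
case: ifP => ok; last by case: c.
apply/flatten_mapP/idP => [[k]|].
  rewrite mem_enum => /andP[kn ks] /mapP[c' hc ->].
  by rewrite /= kn ks -IH.
case: c => // k c /= /and3P[kn ks hc]; exists k; first by rewrite mem_enum inE kn ks.
by apply/mapP; exists c => //; rewrite IH.
Qed.

Lemma uniq_kchains L ga : uniq (kchains L ga).
Proof.
elim: L ga => [|[[neg m] n] L IH] ga /=; first by case: eqP.
case: ifP => // _; apply: (@allpairs_uniq_dep _ _ _ (fun k c => k :: c)).
- exact: enum_uniq.
- by move=> k _; exact: IH.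
- by move=> [k c] [k' c'] _ _ /= [-> ->].
Qed.

Lemma chain_sumE L ga : chain_sum L ga = \sum_(c <- kchains L ga) chain_wt L ga c.
Proof.
elim: L ga => [|[[neg m] n] L IH] ga /=.
  by case: eqP; rewrite ?big_seq1 ?big_nil.
case: ifP => _; last by rewrite big_nil.
rewrite big_flatten big_map big_enum; apply: eq_bigr => k _.
by rewrite big_map IH mulr_sumr.
Qed.
End Chains.

(** * Plethystic evaluation of the kernel *)

Section SeriesCoefficients.
Variables (V : choiceType) (R : comNzRingType).
Implicit Types (f g : fps V R) (x y : {cmonom V}) (a b : V) (s : nat -> R).
Local Notation cv := cmonom_val.

Definition cpow a n : {cmonom V} := iter n (mmul (ucm a)) mone.

Lemma cpowE a n b : cv (cpow a n) b = (n * (a == b))%N.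
Proof.
elim: n => [|n IH] /=; first by rewrite monalg.cm1.
by rewrite monalg.cmM monalg.cmU IH mulSn.
Qed.

Definition single a x : bool := [forall b : finsupp (cv x), val b == a].

Lemma singleP a x : reflect (forall b, b != a -> cv x b = 0%N) (single a x).
Proof.
apply: (iffP forallP) => [h b ba|h [b hb]] /=.
  apply/eqP; rewrite monalg.cmE_eq0; apply/negP => hb.
  by have := h [` hb]%fset; rewrite /= (negbTE ba).
by apply: contraLR hb => /h /eqP; rewrite monalg.cmE_eq0.
Qed.

Lemma single_cpow a x : single a x -> x = cpow a (cv x a).
Proof.
move=> /singleP h; apply: cm_ext => b; rewrite cpowE.
by case: eqVneq => [<-|ne]; rewrite ?muln1 // muln0 h // eq_sym.
Qed.

Lemma single_pow a n : single a (cpow a n).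
Proof. by apply/singleP => b ba; rewrite cpowE eq_sym (negbTE ba) muln0. Qed.

(* The power series with coefficient s n at x_a^n. *)
Definition osr a s : fps V R := fun x => if single a x then s (cv x a) else 0.

Definition sconv s s' : nat -> R := fun n => \sum_(i < n.+1) s i * s' (n - i)%N.
Definition sone : nat -> R := fun n => (n == 0%N)%:R.

Lemma fpsME f g x : (f * g) x = \sum_(p <- cm_pairs x) f p.1 * g p.2.
Proof. by []. Qed.
Lemma fps1E x : (1 : fps V R) x = (x == mone)%:R.
Proof. by []. Qed.
Lemma fps_sumE (I : Type) (r : seq I) (P : pred I) (F : I -> fps V R) x :
  (\sum_(i <- r | P i) F i) x = \sum_(i <- r | P i) F i x.
Proof.
apply: (big_morph (fun f : fps V R => f x)) => //.
by rewrite /GRing.zero /= /fpsC mul0rn.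
Qed.
Lemma fpsCM c f x : (fpsC c * f) x = c * f x.
Proof.
rewrite fpsME (bigD1_seq (mone, x)) ?uniq_cm_pairs ?mem_cm_pairs //= ?mul1m //.
rewrite {1}/fpsC eqxx mulr1n big_seq_cond big1 ?addr0 // => -[d e].
rewrite mem_cm_pairs /= => /andP[/eqP <- ne].
rewrite /fpsC; case: eqP => [d1|_]; last by rewrite mulr0n mul0r.
by rewrite d1 mul1m eqxx in ne.
Qed.

Lemma osr1 a : osr a sone = 1.
Proof.
apply: fpsP => x; rewrite /osr fps1E; have [->|ne] := eqVneq x mone.
  have -> : single a mone by apply/singleP => b _; rewrite monalg.cm1.
  by rewrite monalg.cm1.
case: ifP => // /single_cpow e; rewrite /sone; case: eqP => // e0.
by move: ne; rewrite e e0 eqxx.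
Qed.

Lemma osrM a s s' : osr a s * osr a s' = osr a (sconv s s').
Proof.
apply: fpsP => x; rewrite fpsME /osr; case: ifP => sx; last first.
  rewrite big_seq big1 // => -[d e]; rewrite mem_cm_pairs /= => /eqP de.
  case: ifP => [/singleP sd|_]; last by rewrite mul0r.
  case: ifP => [/singleP se|_]; last by rewrite mulr0.
  by move/negP: sx; case; apply/singleP => b ba; rewrite -de monalg.cmM sd // se.
have ex := single_cpow sx; set n := cv x a in ex *.
rewrite (perm_big (map (fun i : 'I_n.+1 => (cpow a i, cpow a (n - i)%N)) (enum 'I_n.+1))).
  rewrite big_map big_enum /=; apply: eq_bigr => i _.
  by rewrite !single_pow !cpowE eqxx !muln1.
apply: uniq_perm; rewrite ?uniq_cm_pairs //.
  rewrite map_inj_uniq ?enum_uniq // => i j [/(congr1 (fun y => cv y a))].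
  by rewrite !cpowE eqxx !muln1 => /val_inj.
move=> [d e]; rewrite mem_cm_pairs /=; apply/eqP/mapP => [de|[i _ [-> ->]]]; last first.
  rewrite ex; apply: cm_ext => b; rewrite monalg.cmM !cpowE -mulnDl subnKC //.
  by rewrite -ltnS.
have hn : (cv d a + cv e a)%N = n by rewrite -monalg.cmM de.
have hd : (cv d a < n.+1)%N by rewrite ltnS -hn leq_addr.
have hs b : b != a -> cv d b = 0%N /\ cv e b = 0%N.
  move=> ba; have := singleP _ _ sx b ba; rewrite -de monalg.cmM.
  by move/eqP; rewrite addn_eq0 => /andP[/eqP -> /eqP ->].
exists (Ordinal hd); rewrite ?mem_enum //=; congr pair.
  by apply: single_cpow; apply/singleP => b /hs[].
rewrite -hn addKn; apply: single_cpow; apply/singleP => b /hs[_] //.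
Qed.

Lemma osr_prod a (I : Type) (r : seq I) (F : I -> nat -> R) :
  \prod_(i <- r) osr a (F i) = osr a (foldr (fun i s => sconv (F i) s) sone r).
Proof.
elim: r => [|i r IH] /=; first by rewrite big_nil osr1.
by rewrite big_cons IH osrM.
Qed.

Lemma osr_coef a s n : osr a s (cpow a n) = s n.
Proof. by rewrite /osr single_pow cpowE eqxx muln1. Qed.

Lemma osr_poly a (p q : {poly R}) : osr a (fun n => (p * q)`_n) =
  osr a (fun n => p`_n) * osr a (fun n => q`_n).
Proof.
rewrite osrM; apply: fpsP => x; rewrite /osr; case: ifP => // _.
by rewrite coefM.
Qed.

Lemma osr_mul_free a s g x : (forall y, g y != 0 -> cv y a = 0%N) ->
  (osr a s * g) x = s (cv x a) * g (divcm x (cpow a (cv x a))).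
Proof.
move=> hg; set n := cv x a; set y := divcm x (cpow a n).
have xy : mmul (cpow a n) y = x.
  apply: cm_ext => b; rewrite monalg.cmM divcmE cpowE.
  by case: eqVneq => [<-|_]; rewrite ?muln0 ?subn0 // muln1 subnn addn0.
rewrite fpsME (bigD1_seq (cpow a n, y)) ?uniq_cm_pairs ?mem_cm_pairs /= ?xy //.
rewrite {1}/osr single_pow cpowE eqxx muln1 big_seq_cond big1 ?addr0 // => -[d e].
rewrite mem_cm_pairs /= => /andP[/eqP de ne]; rewrite /osr.
case: ifP => [sd|_]; last by rewrite mul0r.
have [->|ge] := eqVneq (g e) 0; first by rewrite mulr0.
have ea := hg e ge; case/negP: ne; apply/eqP.
have dn : cv d a = n by rewrite /n -de monalg.cmM ea addn0.
have ed : d = cpow a n by rewrite (single_cpow sd) dn.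
congr pair => //; apply: cm_ext => b; rewrite divcmE -de monalg.cmM -ed addKn //.
Qed.

Lemma osr_prod_coef (L : seq V) (s : V -> nat -> R) x : uniq L ->
  (\prod_(a <- L) osr a (s a)) x =
  if [forall b : finsupp (cv x), val b \in L] then \prod_(a <- L) s a (cv x a) else 0.
Proof.
elim: L x => [|a L IH] x /=.
  move=> _; rewrite !big_nil fps1E; have [->|ne] := eqVneq x mone.
    case: forallP => // -[] [b hb]; exfalso.
    by move: hb; rewrite monalg.mdom1.
  case: forallP => // h; case/eqP: ne; apply: cm_ext => b; rewrite monalg.cm1.
  by apply/eqP; rewrite monalg.cmE_eq0; apply/negP => hb; have := h [` hb]%fset.
case/andP=> aL uL; rewrite !big_cons osr_mul_free => [|y]; last first.
  rewrite IH //; case: forallP => [h _|_]; last by rewrite eqxx.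
  apply/eqP; rewrite monalg.cmE_eq0; apply/negP => hb.
  by have := h [` hb]%fset; rewrite /= (negbTE aL).
rewrite IH //.
have -> : [forall b : finsupp (cv (divcm x (cpow a (cv x a)))), val b \in L] =
          [forall b : finsupp (cv x), val b \in a :: L].
  apply/forallP/forallP => h -[b hb] /=.
    rewrite inE; have [//|ba] := eqVneq b a.
    have hb' : b \in finsupp (cv (divcm x (cpow a (cv x a)))).
      by rewrite -monalg.cmE_neq0 divcmE cpowE [a == b]eq_sym (negbTE ba) muln0 subn0 monalg.cmE_neq0.
    exact: (h [` hb']%fset).
  move: hb; rewrite -monalg.cmE_neq0 divcmE cpowE; have [<-|ab] := eqVneq a b.
    by rewrite muln1 subnn.
  rewrite muln0 subn0 monalg.cmE_neq0 => hb.
  by have := h [` hb]%fset; rewrite /= inE eq_sym (negbTE ab).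
case: ifP => _; last by rewrite mulr0.
congr (_ * _); rewrite big_seq [RHS]big_seq; apply: eq_bigr => b bL.
rewrite divcmE cpowE; have [e|_] := eqVneq a b; last by rewrite muln0 subn0.
by move: aL; rewrite e bL.
Qed.

(** Equality at all divisors of [x]. It is stable under products and determines the coefficient at
    [x], so that infinite alphabets and series can be cut down to the letters and the degree of
    [x]. *)
Definition agree x f g := forall d e, mmul d e = x -> f d = g d.

Lemma agreeM x f f' g g' : agree x f f' -> agree x g g' -> agree x (f * g) (f' * g').
Proof.
move=> h h' y z yz; rewrite !fpsME big_seq [RHS]big_seq; apply: eq_bigr => -[d e].
rewrite mem_cm_pairs /= => /eqP de; congr (_ * _).
  by apply: (h d (mmul e z)); rewrite mulmA de.
by apply: (h' e (mmul d z)); rewrite monalg.mulmC -mulmA [mmul z e]monalg.mulmC mulmA de.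
Qed.

Lemma agree_prod x (I : eqType) (r : seq I) (P : pred I) (F G : I -> fps V R) :
  (forall i, P i -> agree x (F i) (G i)) ->
  agree x (\prod_(i <- r | P i) F i) (\prod_(i <- r | P i) G i).
Proof.
move=> h; elim: r => [|i r IH]; first by rewrite !big_nil.
by rewrite !big_cons; case: ifP => // Pi; apply: agreeM => //; apply: h.
Qed.
End SeriesCoefficients.

Lemma coef_prod_linear (R : comNzRingType) (I : finType) (P : pred I) (w : I -> R) n :
  (\prod_(p | P p) (1 - w p *: 'X : {poly R}))`_n =
  (-1) ^+ n * \sum_(S : {set I} | (S \subset P) && (#|S| == n)) \prod_(p in S) w p.
Proof.
pose F p : {poly R} := if P p then - w p *: 'X else 0.
have -> : \prod_(p | P p) (1 - w p *: 'X : {poly R}) = \prod_p (F p + 1).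
  rewrite big_mkcond; apply: eq_bigr => p _; rewrite /F; case: ifP => _; last by rewrite add0r.
  by rewrite scaleNr addrC.
rewrite bigA_distr coef_sum mulr_sumr big_mkcond [RHS]big_mkcond /=.
apply: eq_bigr => S _.
have -> : \prod_p (if p \in S then F p else 1) = \prod_(p in S) F p by rewrite -big_mkcond.
case: (boolP (S \subset P)) => [sub|nsub] /=; last first.
  have /subsetPn[p pS np] := nsub; rewrite (bigD1 p) //= /F.
  by move: np; rewrite unfold_in => /negbTE ->; rewrite mul0r coef0.
have -> : \prod_(p in S) F p = \prod_(p in S) (- w p *: 'X).
  by apply: eq_bigr => p /(subsetP sub); rewrite unfold_in /F => ->.
rewrite scaler_prod prodr_const coefZ coefXn eq_sym.
case: eqP => [<-|_]; last by rewrite mulr0.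
by rewrite mulr1 prodrN.
Qed.

Section CompleteSymmetric.
Variables (K : fieldType) (l : nat).
Implicit Types (m n : nat) (p : 'I_l).
Local Notation Z := (zfield K l).

Definition geom (u : Z) (n : nat) : Z := u ^+ n.

Lemma osr_geom (V : choiceType) (a : V) (u : Z) :
  osr a (geom u) * osr a (fun n => (1 - u *: 'X : {poly Z})`_n) = 1.
Proof.
rewrite -(osr1 _ a) osrM; apply: fpsP => x; rewrite /osr; case: ifP => // _.
move: (cmonom_val x a) => n; rewrite /sconv.
under eq_bigr => i _ do rewrite coefB coef1 coefZ coefX /geom.
case: n => [|n]; first by rewrite big_ord1 /= !mulr0 subr0 expr0 mulr1.
rewrite big_ord_recr big_ord_recr /= big1 => [|i _].
  rewrite subnn subSnn /= mulr0 subr0 mulr1 sub0r mulr1 mulrN -exprSr add0r.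
  by rewrite /sone /= addrC subrr.
have [e1 e2] : (n.+1 - i == 0)%N = false /\ (n.+1 - i == 1)%N = false.
  by have := ltn_ord i; split; apply/eqP; lia.
by rewrite e1 e2 mulr0 subrr mulr0.
Qed.

Lemma poly_elemV m n :
  (\prod_(p : 'I_l | (p < m)%N) (1 - (zvar K p)^-1 *: 'X : {poly Z}))`_n = (-1) ^+ n * elemV K l m n.
Proof.
rewrite coef_prod_linear /elemV; congr (_ * _); apply: eq_bigr => S _.
rewrite /zmon [LHS]big_mkcond; apply: eq_bigr => p _.
by rewrite !ffunE; case: (p \in S) => /=; rewrite ?expr0z // -exprz_inv expr1z.
Qed.

(** h_n(z_1^-1, ..., z_m^-1), as an iterated convolution of geometric sequences. *)
Definition homV m : nat -> Z :=
  foldr (fun p s => sconv (geom (zvar K p)^-1) s) (@sone Z) (filter (fun p : 'I_l => (p < m)%N) (enum 'I_l)).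

Lemma osr_homV (V : choiceType) (a : V) m :
  osr a (homV m) = \prod_(p : 'I_l | (p < m)%N) osr a (geom (zvar K p)^-1).
Proof. by rewrite /homV -osr_prod big_filter big_enum_cond. Qed.

Lemma osr_elemV (V : choiceType) (a : V) m :
  osr a (fun n => (-1) ^+ n * elemV K l m n) =
  \prod_(p : 'I_l | (p < m)%N) osr a (fun n => (1 - (zvar K p)^-1 *: 'X : {poly Z})`_n).
Proof.
have -> : osr a (fun n => (-1) ^+ n * elemV K l m n) =
   osr a (fun n => (\prod_(p : 'I_l | (p < m)%N) (1 - (zvar K p)^-1 *: 'X : {poly Z}))`_n).
  by apply: fpsP => x; rewrite /osr poly_elemV.
apply: (big_morph (fun P : {poly Z} => osr a (fun n => P`_n))); first exact: osr_poly.
rewrite -(osr1 _ a); apply: fpsP => x; rewrite /osr; case: ifP => // _.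
by rewrite coef1.
Qed.

(** Compare coefficients in one variable, over the alphabet [unit]: the product of the polynomials 1
    - u/z_p is inverse to the product of the geometric series. *)
Lemma homV_elemV m n :
  \sum_(i < n.+1) (-1) ^+ i * (elemV K l m i * homV m (n - i)) = (n == 0%N)%:R.
Proof.
have : osr tt (fun n => (-1) ^+ n * elemV K l m n) * osr tt (homV m) = 1.
  rewrite osr_homV osr_elemV -big_split big1 //= => p _.
  by rewrite mulrC osr_geom.
rewrite -(osr1 _ tt) osrM => /(congr1 (fun f : fps unit Z => f (cpow tt n))).
by rewrite !osr_coef /sone => <-; apply: eq_bigr => i _; rewrite mulrA.
Qed.
End CompleteSymmetric.

Section CauchyProduct.
Variables (K : fieldType) (l : nat) (V : choiceType) (B : 'I_l -> pred V) (neg : pred V).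
Hypothesis B_disjoint : forall i j a, B i a -> B j a -> i = j.
Implicit Types (i j p : 'I_l) (a : V) (x y : {cmonom V}) (n d : nat).
Local Notation Z := (zfield K l).
Local Notation cv := cmonom_val.

(** The coefficient of x_a^n in the kernel. With indices from 0, i <= j means [rev_ord j < l - i],
    so a letter of [B i] meets the first l - i variables. *)
Definition letterV a : nat -> Z :=
  if [pick i | B i a] is Some i then seriesV (@homV K l) (neg a) (l - i) else @sone Z.

Definition wV j : Z := (zvar K (rev_ord j))^-1.

Lemma letter_coef0 (R : comNzRingType) (P : pred V) a : letter_coef R P neg a 0 = 1.
Proof. by rewrite /letter_coef; case: (P a) => //=; case: (neg a) => //=; rewrite subr0. Qed.

Lemma prod_osr_letter a :
  \prod_(ij : 'I_l * 'I_l | (ij.1 <= ij.2)%N)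
    osr a (fun n => letter_coef Z (B ij.1) neg a n * wV ij.2 ^+ n) = osr a (letterV a).
Proof.
rewrite -(pair_big_dep xpredT (fun i j : 'I_l => (i <= j)%N)
  (fun i j => osr a (fun n => letter_coef Z (B i) neg a n * wV j ^+ n))) /=.
have triv i : ~~ B i a -> \prod_(j : 'I_l | (i <= j)%N)
    osr a (fun n => letter_coef Z (B i) neg a n * wV j ^+ n) = 1.
  move=> nB; rewrite big1 // => j _; rewrite -(osr1 _ a); apply: fpsP => x.
  rewrite /osr /letter_coef nB /sone; case: ifP => // _.
  by case: eqP => [->|_]; rewrite ?expr0 ?mulr1 // mul0r.
rewrite /letterV; case: pickP => [i Bi|nB]; last first.
  by rewrite osr1 big1 // => i _; apply: triv; rewrite nB.
rewrite (bigD1 i) //= [X in _ * X]big1 ?mulr1 => [|j ji]; last first.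
  by apply: triv; apply: contra_neqN ji => Bj; apply: B_disjoint Bj Bi.
rewrite (reindex_inj rev_ord_inj) /=.
have cond p : (i <= l - p.+1)%N = (p < l - i)%N.
  by have := ltn_ord i; have := ltn_ord p; lia.
rewrite (eq_bigl (fun p : 'I_l => (p < l - i)%N)) => [|p]; last exact: cond.
rewrite /seriesV /letter_coef; case: (neg a).
  symmetry; apply: (etrans (@osr_elemV K l V a (l - i))); apply: eq_bigr => p _.
  apply: fpsP => x; rewrite /osr; case: ifP => // _.
  rewrite /wV rev_ordK Bi /=; move: (cv x a) => n; rewrite coefB coef1 coefZ coefX.
  case: n => [|[|n]] /=.
  - by rewrite mulr0 !subr0 expr0 mulr1.
  - by rewrite mulr1 !sub0r expr1 mulN1r.
  - by rewrite mulr0 !subrr mul0r.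
symmetry; apply: (etrans (@osr_homV K l V a (l - i))); apply: eq_bigr => p _.
apply: fpsP => x; rewrite /osr; case: ifP => // _.
by rewrite /wV rev_ordK Bi /= mul1r.
Qed.

Lemma mdeg_mul x y : monalg.mdeg (mmul x y) = (monalg.mdeg x + monalg.mdeg y)%N.
Proof. exact: monalg.mdegM. Qed.

(** At divisors of [x] only the degrees n <= deg x and the letters of [x] contribute, so the
    generating series of the h_n and its infinite product both become finite. *)
Lemma agree_h_signed x i j :
  agree x (\sum_(n < (monalg.mdeg x).+1) fpsC (wV j ^+ n) * h_signed Z (B i) neg n)
    (\prod_(a <- finsupp (cv x)) osr a (fun n => letter_coef Z (B i) neg a n * wV j ^+ n)).
Proof.
move=> y z yz; rewrite osr_prod_coef ?fset_uniq //.
have sub : (finsupp (cv y) `<=` finsupp (cv x))%fset.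
  by rewrite -yz monalg.mdomD fsubsetUl.
have -> : [forall b : finsupp (cv y), val b \in finsupp (cv x)].
  by apply/forallP => -[b hb] /=; apply: (fsubsetP sub).
have dy : (monalg.mdeg y < (monalg.mdeg x).+1)%N by rewrite -yz mdeg_mul ltnS leq_addr.
rewrite fps_sumE (bigD1 (Ordinal dy)) //= big1 ?addr0 => [|n ne]; last first.
  rewrite fpsCM /h_signed; case: eqP => [e|_]; last by rewrite mulr0.
  by case/eqP: ne; apply: val_inj; rewrite /= e.
rewrite fpsCM /h_signed eqxx big_split /= mulrC; congr (_ * _).
  rewrite (big_fset_incl _ sub) // => a _; rewrite memNfinsupp => /eqP ->.
  exact: letter_coef0.
by rewrite (monalg.mdegEw sub) -expr_sum.
Qed.

Definition fps_homog (R : comNzRingType) d (f : fps V R) := forall x, monalg.mdeg x != d -> f x = 0.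

Lemma fps_homogM (R : comNzRingType) d e (f g : fps V R) :
  fps_homog d f -> fps_homog e g -> fps_homog (d + e) (f * g).
Proof.
move=> hf hg x ne; rewrite fpsME big_seq big1 // => -[y z]; rewrite mem_cm_pairs /= => /eqP yz.
have [ey|ny] := eqVneq (monalg.mdeg y) d; last by rewrite hf // mul0r.
have [ez|nz] := eqVneq (monalg.mdeg z) e; last by rewrite hg // mulr0.
by rewrite -yz mdeg_mul ey ez eqxx in ne.
Qed.

Lemma fps_homog_prod (R : comNzRingType) (I : finType) (P : pred I) (c : I -> nat)
    (F : I -> fps V R) : (forall u, P u -> fps_homog (c u) (F u)) ->
  fps_homog (\sum_(u | P u) c u)%N (\prod_(u | P u) F u).
Proof.
move=> h; apply: (big_rec2 (fun n f => fps_homog n f)) => [x|u n f Pu hf].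
  by rewrite monalg.mdeg_eq0 fps1E => /negbTE ->.
exact: fps_homogM (h u Pu) hf.
Qed.

Lemma h_signed_homog (R : comNzRingType) (P : pred V) n : fps_homog n (h_signed R P neg n).
Proof. by move=> x /negbTE ne; rewrite /h_signed ne. Qed.

Lemma zscal_fps_prod (I : Type) (r : seq I) (P : pred I) (F : I -> fps V K) x :
  zscal l ((\prod_(u <- r | P u) F u) x) = (\prod_(u <- r | P u) ((fun y => zscal l (F u y)) : fps V Z)) x.
Proof.
elim: r x => [|u r IH] x; first by rewrite !big_nil !fps1E; case: eqP; rewrite ?zscal1 ?zscal0.
rewrite !big_cons; case: ifP => // _; rewrite !fpsME zscal_sum; apply: eq_bigr => p _.
by rewrite zscalM IH.
Qed.

Lemma zscal_h_signed (P : pred V) n x :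
  zscal l (h_signed K P neg n x) = h_signed Z P neg n x.
Proof.
rewrite /h_signed; case: ifP => _; last exact: zscal0.
rewrite (big_morph (@zscal K l) (@zscalM K l) (@zscal1 K l)); apply: eq_bigr => a _.
rewrite /letter_coef; case: (P a) => /=; case: (neg a) => /=; rewrite ?zscal1 //;
by case: (cv x a) => [|[|]] /=; rewrite ?subr0 ?sub0r ?oppr0 ?zscalN ?zscal1 ?zscal0 ?oppr0.
Qed.

(** Expanding the product of the truncated series yields all exponents k; those with a total other
    than deg x contribute 0 at [x] by homogeneity. Exchanging the products over pairs (i, j) and
    over letters gives the right side. *)
Lemma Cauchy_coef x (d := monalg.mdeg x) :
  \sum_(k : {ffun 'I_l * 'I_l -> 'I_d.+1} |
         (\sum_(ij : 'I_l * 'I_l) (k ij : nat) == d)%N &&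
         [forall ij : 'I_l * 'I_l, (ij.2 < ij.1)%N ==> (k ij == 0 :> nat)%N])
    (\prod_(ij : 'I_l * 'I_l | (ij.1 <= ij.2)%N) zvar K (rev_ord ij.2) ^- k ij) *
    zscal l ((\prod_(ij : 'I_l * 'I_l | (ij.1 <= ij.2)%N) h_signed K (B ij.1) neg (k ij)) x) =
  \prod_(a <- finsupp (cv x)) letterV a (cv x a).
Proof.
have e1 : (\prod_(ij : 'I_l * 'I_l | (ij.1 <= ij.2)%N)
    \sum_(n < d.+1) fpsC (wV ij.2 ^+ n) * h_signed Z (B ij.1) neg n) x =
    \prod_(a <- finsupp (cv x)) letterV a (cv x a).
  rewrite (@agree_prod _ _ x _ _ _ _ (fun ij : 'I_l * 'I_l => \prod_(a <- finsupp (cv x))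
      osr a (fun n => letter_coef Z (B ij.1) neg a n * wV ij.2 ^+ n)) _ x mone); last first.
  - by rewrite monalg.mulmC mul1m.
  - by move=> ij _; apply: agree_h_signed.
  rewrite exchange_big /=; under eq_bigr do rewrite prod_osr_letter.
  rewrite osr_prod_coef ?fset_uniq //.
  by case: forallP => // -[] [b hb].
rewrite -e1 (big_distr_big_dep ord0) fps_sumE.
pose P (ij : 'I_l * 'I_l) := (ij.1 <= ij.2)%N.
have sumP (k : {ffun 'I_l * 'I_l -> 'I_d.+1}) : (forall ij, ~~ P ij -> k ij = 0%N :> nat) ->
    (\sum_(ij | P ij) k ij = \sum_ij k ij)%N.
  by move=> h; rewrite [RHS](bigID P) /= [X in (_ + X)%N]big1 ?addn0 // => ij /h.
rewrite big_mkcond [RHS]big_mkcond; apply: eq_bigr => k _.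
have -> : (\prod_(ij | P ij) (fpsC (wV ij.2 ^+ k ij) * h_signed Z (B ij.1) neg (k ij))) x =
   (\prod_(ij | P ij) wV ij.2 ^+ k ij) * (\prod_(ij | P ij) h_signed Z (B ij.1) neg (k ij)) x.
  rewrite big_split /= -fpsCM.
  by rewrite [fpsC (\prod_(ij | P ij) _)](rmorph_prod (@fpsC V Z)).
have pf : (k \in pfamily ord0 P (fun _ _ => true)) =
    [forall ij : 'I_l * 'I_l, (ij.2 < ij.1)%N ==> (k ij == 0 :> nat)%N].
  apply/pfamilyP/forallP => [[/subsetP h _] ij|h].
    apply/implyP => lt; apply/eqP; apply: contraTeq lt => ne; rewrite -leqNgt.
    by apply: (h ij); rewrite unfold_in /=; apply: contra_neq ne => ->.
  split=> //; apply/subsetP => ij; rewrite unfold_in /= => ne.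
  rewrite unfold_in /P leqNgt; apply: contra_neqN ne => lt.
  by apply: val_inj; apply/eqP; apply: (implyP (h ij)).
rewrite pf; case: (boolP [forall ij : 'I_l * 'I_l, _]) => h; last by rewrite andbF.
have h' ij : ~~ P ij -> k ij = 0%N :> nat.
  by rewrite /P -ltnNge => lt; apply/eqP; apply: (implyP (forallP h ij)).
rewrite andbT; case: eqP => [e|ne].
  congr (_ * _); last first.
    rewrite zscal_fps_prod.
    suff -> : \prod_(ij | P ij) ((fun y => zscal l (h_signed K (B ij.1) neg (k ij) y)) : fps V Z) =
      \prod_(ij | P ij) h_signed Z (B ij.1) neg (k ij) by [].
    by apply: eq_bigr => ij _; apply: fpsP => y; apply: zscal_h_signed.
  by apply: eq_bigr => ij _; rewrite /wV exprVn.
have hom := @fps_homog_prod Z _ P (fun ij => k ij : nat) (fun ij => h_signed Z (B ij.1) neg (k ij))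
  (fun ij _ => @h_signed_homog Z (B ij.1) (k ij)).
rewrite hom ?mulr0 //; apply/eqP => e; case: ne.
by rewrite -(sumP k h') -e.
Qed.
End CauchyProduct.

Section PlethysmOfLLT.
Variables (K K' : comNzRingType) (l : nat).
Implicit Types (M N : {cmonom ('I_l * nat)%type}).

Lemma mkmalgUM (R : comNzRingType) M N (c d : R) :
  mkmalgU M c * mkmalgU N d = mkmalgU (mmul M N) (c * d) :> msymf R l.
Proof. exact: monalg.fgmulUU. Qed.

Lemma mkmalgUZ (R : comNzRingType) M (c d : R) :
  c *: (mkmalgU M d : msymf R l) = mkmalgU M (c * d).
Proof.
rewrite -monalg.mul_malgC; apply: (etrans (mkmalgUM _ _ _ _)).
by rewrite mul1m.
Qed.

Definition hmono (i : 'I_l) (k : nat) : {cmonom ('I_l * nat)%type} :=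
  if k is k'.+1 then ucm (i, k') else mone.

Lemma hXE (R : comNzRingType) i k : hX R i k = mkmalgU (hmono i k) 1.
Proof. by case: k. Qed.

Lemma prod_mkmalgU (R : comNzRingType) (I : Type) (r : seq I) (P : pred I) (c : I -> R)
    (M : I -> {cmonom ('I_l * nat)%type}) :
  \prod_(i <- r | P i) (mkmalgU (M i) (c i) : msymf R l) =
  mkmalgU (\big[mmul/mone]_(i <- r | P i) M i) (\prod_(i <- r | P i) c i).
Proof.
elim: r => [|i r IH].
  rewrite big_nil; rewrite big_nil; rewrite big_nil; reflexivity.
rewrite big_cons; rewrite [in RHS]big_cons; rewrite [X in _ = mkmalgU _ X]big_cons.
case: (P i); last exact: IH.
by rewrite IH; exact: mkmalgUM.
Qed.

(** Additivity is required only for the sums at hand, because [Fcoef] is additive on Laurent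
    polynomials and not on the whole field. The monomials M i may coincide, hence the grouping. *)
Lemma coefwise_sum (phi : K -> K') (I : eqType) (r : seq I) (P : pred I) (c : I -> K)
    (M : I -> {cmonom ('I_l * nat)%type}) : phi 0 = 0 ->
  (forall Q : pred I, phi (\sum_(i <- r | P i && Q i) c i) = \sum_(i <- r | P i && Q i) phi (c i)) ->
  coefwise phi (\sum_(i <- r | P i) mkmalgU (M i) (c i) : msymf K l) =
  \sum_(i <- r | P i) mkmalgU (M i) (phi (c i)).
Proof.
move=> phi0 phiS; set f := \sum_(i <- r | P i) _.
pose U := undup (map M [seq i <- r | P i] ++ monalg.msupp f).
have fE u : monalg.mcoeff u f = \sum_(i <- r | P i && (M i == u)) c i.
  rewrite raddf_sum big_mkcondr; apply: eq_bigr => i _ /=.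
  by rewrite monalg.mcoeffU; case: (M i == u).
transitivity (\sum_(u <- U) mkmalgU u (phi (monalg.mcoeff u f)) : msymf K' l).
  rewrite /coefwise [RHS](bigID (fun u => u \in monalg.msupp f)) /=.
  rewrite [X in _ = _ + X]big1 ?addr0 => [|u n]; last first.
    by rewrite monalg.mcoeff_outdom // phi0 monalg.monalgU0.
  rewrite -[RHS]big_filter; apply: perm_big; apply: uniq_perm; rewrite ?filter_uniq ?fset_uniq ?undup_uniq //.
  by move=> u; rewrite mem_filter mem_undup mem_cat; case: (u \in monalg.msupp f); rewrite ?orbT.
rewrite -[RHS]big_filter (@big_group_seq _ _ _ _ M U) ?undup_uniq //; last first.
  by move=> i hi; rewrite mem_undup mem_cat map_f.
apply: eq_bigr => u _; rewrite fE phiS -big_filter_cond big_filter_cond.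
rewrite (raddf_sum (@mkmalgU _ _ u)) big_filter_cond.
by apply: eq_bigr => i /andP[_ /eqP ->].
Qed.

Section Pleth.
Variables (V : choiceType) (H : 'I_l -> nat -> fps V K).
Hypothesis H0 : forall i, H i 0%N = 1.

Lemma plethM f g : pleth H (f * g) = pleth H f * pleth H g.
Proof. exact: (pleth_is_monoid_morphism H).2. Qed.
Lemma pleth1 : pleth H 1 = 1.
Proof. exact: (pleth_is_monoid_morphism H).1. Qed.
Lemma plethB f g : pleth H (f - g) = pleth H f - pleth H g.
Proof. exact: pleth_is_zmod_morphism. Qed.
Lemma pleth0 : pleth H 0 = 0.
Proof. by rewrite -[0 in LHS](subrr 0) plethB subrr. Qed.
Lemma plethD f g : pleth H (f + g) = pleth H f + pleth H g.
Proof. by rewrite -[g in LHS]opprK plethB -sub0r plethB pleth0 sub0r opprK. Qed.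
Lemma pleth_sum (I : Type) (r : seq I) (P : pred I) (F : I -> msymf K l) :
  pleth H (\sum_(i <- r | P i) F i) = \sum_(i <- r | P i) pleth H (F i).
Proof. by apply: (big_morph (pleth H) plethD pleth0). Qed.
Lemma plethZ c f : pleth H (c *: f) = fpsC c * pleth H f.
Proof. by rewrite -monalg.mul_malgC plethM plethC. Qed.

Lemma pleth_mkmalgU (I : Type) (r : seq I) (P : pred I) (i : I -> 'I_l) (k : I -> nat) c :
  pleth H (mkmalgU (\big[mmul/mone]_(u <- r | P u) hmono (i u) (k u)) c) =
  fpsC c * \prod_(u <- r | P u) H (i u) (k u).
Proof.
rewrite -[c in LHS]mulr1 -mkmalgUZ plethZ; congr (_ * _).
have -> : (1 : K) = \prod_(u <- r | P u) 1 by rewrite big1_eq.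
rewrite -prod_mkmalgU (big_morph (pleth H) plethM pleth1); apply: eq_bigr => u _.
by rewrite -hXE pleth_hX.
Qed.
End Pleth.
End PlethysmOfLLT.

Section OmegaCoefficients.
Variables (K : fieldType) (t : K) (l : nat).
Hypothesis t0 : t != 0.
Variable sigma : 'S_l.
Implicit Types (la mu ga : wt l) (d : nat).
Local Notation FF := (@Ffun K t l).
Local Notation ZM := (@zmon K l).

Lemma Tbar_zmon_deg la : wspan FF (fun mu => wdeg mu = wdeg la) (Tbar t sigma (ZM la)).
Proof.
have : wspan ZM (fun mu => wdeg mu = wdeg la) (Tbar t sigma (ZM la)).
  rewrite /Tbar; elim: (reduced_word sigma) => [|i u [s [hs e]]] /=; first exact: wspan_gen.
  rewrite e heckeTinv_sum //; apply: wspan_sum => x /hs h _; rewrite heckeTinvZ //.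
  apply: wspanZ; apply: wspan_sub (heckeTinv_zmon_le t0 i x.2) => mu [-> _]; exact: h.
move=> hs; apply: (wspan_trans _ hs) => mu h; have := zmon_in_Fspan t0 mu.
by apply: (@wspan_sub K l FF (lowe mu) (fun ka => wdeg ka = wdeg la)) => ka [-> _].
Qed.

Definition okk d (k : {ffun 'I_l * 'I_l -> 'I_d.+1}) :=
  (\sum_(ij : 'I_l * 'I_l) (k ij : nat) == d)%N &&
         [forall ij : 'I_l * 'I_l, (ij.2 < ij.1)%N ==> (k ij == 0 :> nat)%N].
Definition zk d (k : {ffun 'I_l * 'I_l -> 'I_d.+1}) : zfield K l :=
  \prod_(ij : 'I_l * 'I_l | (ij.1 <= ij.2)%N) zvar K (rev_ord ij.2) ^- k ij.

Lemma zk_zmon d k : @okk d k -> exists2 mu, zk k = ZM mu & wdeg mu = - d%:Z.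
Proof.
move=> /andP[/eqP kd /forallP h].
have -> : (- d%:Z) = \sum_(ij : 'I_l * 'I_l | (ij.1 <= ij.2)%N) - (k ij : nat)%:Z.
  rewrite sumrN; congr (- _); rewrite -[d in LHS]kd (big_morph Posz PoszD (erefl _)).
  rewrite [LHS](bigID (fun ij : 'I_l * 'I_l => ij.1 <= ij.2)%N) /= [X in _ + X]big1 ?addr0 // => ij.
  by rewrite -ltnNge => lt; have /eqP -> := implyP (h ij) lt.
rewrite /zk; apply: (big_rec2 (fun z n => exists2 mu, z = ZM mu & wdeg mu = n)).
  exists 0; first by rewrite /zmon big1 // => p _; rewrite ffunE expr0z.
  by rewrite /wdeg big1 // => p _; rewrite ffunE.
move=> ij n z _ [mu -> <-].
exists ([ffun p => if p == rev_ord ij.2 then - (k ij : nat)%:Z else 0] + mu).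
  rewrite zmonD; congr (_ * _); rewrite /zmon (bigD1 (rev_ord ij.2)) //= big1 => [|p ne].
    by rewrite ffunE eqxx mulr1 exprnN.
  by rewrite ffunE (negbTE ne) expr0z.
rewrite /wdeg; under eq_bigr do rewrite ffunE.
rewrite big_split /=; congr (_ + _); rewrite (bigD1 (rev_ord ij.2)) //= big1 => [|p ne].
  by rewrite ffunE eqxx addr0.
by rewrite ffunE (negbTE ne).
Qed.

Variables (ga eta : wt l).
Definition Fphi (c : zfield K l) : K := Fcoef t ga (Tbar t sigma (c * ZM eta)).

Lemma laurent_zk d k : @okk d k -> laurent t (Tbar t sigma (zk k * ZM eta)).
Proof.
move=> /zk_zmon[mu -> _]; rewrite -zmonD.
by apply: wspan_sub (Tbar_zmon_deg _).
Qed.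

Lemma Fphi_sum d (c : {ffun 'I_l * 'I_l -> 'I_d.+1} -> K) (Q : pred {ffun 'I_l * 'I_l -> 'I_d.+1}) :
  (forall k, Q k -> okk k) ->
  Fphi (\sum_(k | Q k) zk k * zscal l (c k)) = \sum_(k | Q k) Fphi (zk k) * c k.
Proof.
move=> h; rewrite /Fphi mulr_suml (Tbar_sum t0) (Fcoef_sum t0) => [|k _ /h ok].
  apply: eq_bigr => k /h ok.
  rewrite -mulrA mulrCA TbarZ // (FcoefZ t0); last exact: laurent_zk.
  exact: mulrC.
by rewrite -mulrA mulrCA TbarZ //; apply: laurentZ; exact: laurent_zk.
Qed.

Lemma Fphi0 : Fphi 0 = 0.
Proof.
have := @Fphi_sum 0 (fun _ => 0) pred0; rewrite !big_pred0 //; exact.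
Qed.

Lemma coefwise_Omega d : coefwise Fphi (Omega_deg K l d) =
  \sum_(k | @okk d k) mkmalgU (\big[mmul/mone]_(ij : 'I_l * 'I_l | (ij.1 <= ij.2)%N)
     hmono ij.1 (k ij)) (Fphi (zk k)).
Proof.
have E := @coefwise_sum (zfield K l) K l Fphi _ (index_enum {ffun 'I_l * 'I_l -> 'I_d.+1}) (@okk d)
  (@zk d) (fun k => \big[mmul/mone]_(ij : 'I_l * 'I_l | (ij.1 <= ij.2)%N) hmono ij.1 (k ij)) Fphi0.
apply: etrans (E _) => [|Q]; last first.
  have -> : \sum_(k | okk k && Q k) zk k = \sum_(k | okk k && Q k) zk k * zscal l 1.
    by apply: eq_bigr => k _; rewrite zscal1 mulr1.
  rewrite (@Fphi_sum d (fun _ => 1)) => [|k /andP[]//].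
  by apply: eq_bigr => k _; rewrite mulr1.
congr coefwise; rewrite /Omega_deg; apply: eq_bigr => k _.
under eq_bigr do rewrite hXE mkmalgUZ mulr1.
exact: prod_mkmalgU.
Qed.

(** The z-monomials of the part of degree d have degree -d, and the operators preserve degree; so at
    most one d contributes. *)
Lemma coefwise_Omega0 d : d%:Z != wdeg eta - wdeg ga -> coefwise Fphi (Omega_deg K l d) = 0.
Proof.
move=> ne; rewrite coefwise_Omega big1 // => k ok.
rewrite [Fphi _](_ : _ = 0) ?monalg.monalgU0 //.
have [mu e dm] := zk_zmon ok; rewrite /Fphi e -zmonD.
apply: (Fcoef_wspan0 t0 (Tbar_zmon_deg _)) => dg; case/eqP: ne.
have -> : wdeg ga = wdeg mu + wdeg eta by rewrite dg /wdeg -big_split; apply: eq_bigr => p _; rewrite ffunE.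
by rewrite dm; ring.
Qed.

Variables (V : choiceType) (B : 'I_l -> pred V) (neg : pred V).
Hypothesis B_disjoint : forall i j a, B i a -> B j a -> i = j.
Local Notation H := (fun i => h_signed K (B i) neg).

Lemma h_signed0 i : H i 0%N = 1.
Proof.
apply: fpsP => x; rewrite fps1E /h_signed monalg.mdeg_eq0; case: eqP => [->|//].
by rewrite monalg.mdom1 big_seq_fset0.
Qed.

Lemma pleth_Omega_coef d x : pleth H (coefwise Fphi (Omega_deg K l d)) x =
  if d == monalg.mdeg x then
    Fphi (\prod_(a <- finsupp (cmonom_val x)) letterV K B neg a (cmonom_val x a))
  else 0.
Proof.
rewrite coefwise_Omega pleth_sum fps_sumE.
rewrite (eq_bigr (fun k : {ffun 'I_l * 'I_l -> 'I_d.+1} =>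
    Fphi (zk k) * (\prod_(ij : 'I_l * 'I_l | (ij.1 <= ij.2)%N) H ij.1 (k ij)) x)); last first.
  move=> k _; rewrite (@pleth_mkmalgU K l V H h_signed0 _ _ (fun ij : 'I_l * 'I_l => ij.1 <= ij.2)%N
    (fun ij => ij.1) (fun ij => k ij : nat)).
  exact: fpsCM.
case: eqP => [e|ne]; last first.
  rewrite big1 // => k /andP[/eqP kd /forallP h].
  have hom := @fps_homog_prod V K _ (fun ij : 'I_l * 'I_l => ij.1 <= ij.2)%N (fun ij => k ij : nat)
    (fun ij => h_signed K (B ij.1) neg (k ij)) (fun ij _ => @h_signed_homog V neg K (B ij.1) (k ij)).
  rewrite hom ?mulr0 //; apply/eqP => e; case: ne; rewrite e -[LHS]kd.
  rewrite [LHS](bigID (fun ij : 'I_l * 'I_l => ij.1 <= ij.2)%N) /= [X in (_ + X)%N]big1 ?addn0 // => ij.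
  by rewrite -ltnNge => lt; have /eqP -> := implyP (h ij) lt.
by move: e => ->; rewrite -(Fphi_sum _ (fun k ok => ok)) -(@Cauchy_coef K l V B neg B_disjoint x).
Qed.
End OmegaCoefficients.

Section PlethysmOfFlaggedLLT.
Variables (K : fieldType) (t : K) (nu : seq (seq (int * int))) (sigma : 'S_(nrows nu)).
Hypothesis t0 : t != 0.
Variables (V : choiceType) (B : 'I_(nrows nu) -> pred V) (neg : pred V).
Hypothesis B_disjoint : forall i j a, B i a -> B j a -> i = j.
Local Notation H := (fun i => h_signed K (B i) neg).
Local Notation ph w := (Fphi t sigma (wt_act w (gamma nu)) (wt_inc (eta nu))).

Definition LLT_value (x : {cmonom V}) : K :=
  t ^+ (h_stat nu + e_stat sigma) * \sum_(w in young nu) (-1) ^+ ell w *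
    ph w (\prod_(a <- finsupp (cmonom_val x)) letterV K B neg a (cmonom_val x a)).

Lemma flagged_LLT_deg_eq0 d : d != `|wdeg (wt_inc (eta nu)) - wdeg (gamma nu)|%N ->
  flagged_LLT_deg t sigma d = 0.
Proof.
move=> ne; rewrite /flagged_LLT_deg big1 ?scaler0 // => w _.
rewrite [coefwise _ _](_ : _ = 0) ?scaler0 //; apply: (coefwise_Omega0 t0).
rewrite wdeg_act; apply: contra_neq ne => <- //.
Qed.

Lemma pleth_flagged_LLT_deg d x : pleth H (flagged_LLT_deg t sigma d) x =
  if d == monalg.mdeg x then LLT_value x else 0.
Proof.
rewrite /flagged_LLT_deg plethZ fpsCM pleth_sum fps_sumE.
rewrite (eq_bigr (fun w => (-1) ^+ ell w * (if d == monalg.mdeg x then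
   ph w (\prod_(a <- finsupp (cmonom_val x)) letterV K B neg a (cmonom_val x a)) else 0))); last first.
  by move=> w _; rewrite plethZ fpsCM (pleth_Omega_coef t0 _ _ _ _ B_disjoint).
rewrite /LLT_value; case: ifP => // _.
by rewrite big1 ?mulr0 // => w _; rewrite mulr0.
Qed.

Lemma pleth_flagged_LLT x : pleth H (flagged_LLT t sigma) x = LLT_value x.
Proof.
(* The support is finite, as it contains at most one degree; the default value of [finite_support]
   is not reached. *)
rewrite /flagged_LLT; case: fsbigop.finite_supportP => [inf|X _ F0 _].
  case: inf; apply: cardinality.sub_finite_set (cardinality.finite_set1 `|wdeg (wt_inc (eta nu)) - wdeg (gamma nu)|%N).
  move=> d [_ /= ne]; apply/eqP; apply: boolp.contrapT => /negP nd; apply: ne.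
  exact: flagged_LLT_deg_eq0.
rewrite pleth_sum fps_sumE.
rewrite (eq_bigr (fun d => if d == monalg.mdeg x then LLT_value x else 0)); last first.
  by move=> d _; exact: pleth_flagged_LLT_deg.
have [dX|dX] := boolP (monalg.mdeg x \in X).
  rewrite (bigD1_seq _ dX) ?fset_uniq //= eqxx big1 ?addr0 // => d /negbTE -> //.
(* Outside the support the part of degree deg x is 0, which forces [LLT_value x] to be 0. *)
have := pleth_flagged_LLT_deg (monalg.mdeg x) x; rewrite eqxx F0 // pleth0 => <-.
rewrite [RHS](_ : _ = 0); last by rewrite -[0 in LHS](@big_nil _ _ +%R nat xpredT (fun=> 0)) fps_sumE big_nil.
by rewrite big_seq big1 // => d dX'; case: eqP => // e; rewrite -e dX' in dX.
Qed.
End PlethysmOfFlaggedLLT.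

(** * Flagged tableaux *)

Section RowData.
Variable nu : seq (seq (int * int)).
Local Notation l := (nrows nu).
Implicit Types (p q r : 'I_l) (u y : box nu) (m : nat) (c : int).
Local Notation comp := (@row_comp nu).
Local Notation ga := (gamma nu).
Local Notation et := (eta nu).

Lemma row_comp_mono p q : (p <= q)%N -> (comp p <= comp q)%N.
Proof.
rewrite /row_comp (@reshape_leq (shape nu) p q) => /orP[/ltnW//|/andP[/eqP -> _]]; exact: leqnn.
Qed.

Lemma rowno_sub p q : comp p = comp q -> (rowno p + q)%N = (rowno q + p)%N.
Proof.
rewrite /row_comp /rowno => e.
have := reshape_indexK (shape nu) p; have := reshape_indexK (shape nu) q.
by rewrite /flatten_index e; lia.
Qed.

Lemma comp_between p q r : (p <= r)%N -> (r <= q)%N -> comp p = comp q -> comp r = comp p.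
Proof.
by move=> pr rq e; apply/eqP; rewrite eqn_leq {1}e !row_comp_mono.
Qed.

(** Since a component occupies consecutive rows, checking neighbours and transitivity is enough. *)
Lemma comp_row_ind (P : 'I_l -> 'I_l -> Prop) :
  (forall p q, val q = p.+1 -> comp p = comp q -> P p q) ->
  (forall p r q, (p < r)%N -> (r < q)%N -> comp p = comp r -> comp r = comp q -> P p r -> P r q -> P p q) ->
  forall p q, (p < q)%N -> comp p = comp q -> P p q.
Proof.
move=> P1 P2 p q pq; have [d dq] : exists d, (q = p + d.+1 :> nat)%N by exists (q - p).-1; lia.
elim: d q dq pq => [|d IH] q dq pq e; first by apply: P1 => //; apply: etrans dq (addn1 _).
have rl : (p + d.+1 < l)%N by have := ltn_ord q; lia.
pose r := Ordinal rl.
have pr : (p < r)%N by rewrite /=; lia.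
have rq : (r < q)%N by rewrite /=; lia.
have er : comp r = comp p by apply: (@comp_between p q) => //; apply: ltnW.
apply: (P2 p r q) => //; first by rewrite er.
  exact: IH.
by apply: P1; [apply: etrans dq (addnS _ _)|rewrite er].
Qed.

Lemma content_box u : content (inl u) = ga (tag u) + (tagged u : nat)%:Z.
Proof. by rewrite /content /= !ffunE; ring. Qed.

Lemma content_flag p : content (inr p : xbox nu) = et p.
Proof. by rewrite /content /= !ffunE. Qed.

Lemma box_inj u y : tag u = tag y -> content (inl u) = content (inl y) -> u = y.
Proof.
case: u y => [p n] [q m'] /= e; rewrite -{}e in m' * => /eqP; rewrite !content_box /= => /eqP h.
by congr existT; apply: val_inj => /=; lia.
Qed.

(** Within a component [rowno] differs from the global row number by a constant, so the column is
    the content plus the row number, up to that constant. *)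
Lemma same_column (u y : xbox nu) : row_comp (Defs.xrow u) = row_comp (Defs.xrow y) ->
  (Defs.xcol u == Defs.xcol y) = (content u + (Defs.xrow u : nat)%:Z == content y + (Defs.xrow y : nat)%:Z).
Proof. by move=> e; rewrite /content; have := rowno_sub e; lia. Qed.

Lemma rowno_lt p q : comp p = comp q -> (rowno p < rowno q)%N = (p < q)%N.
Proof. by move=> e; have := rowno_sub e; lia. Qed.

Lemma same_row_lt u y : tag u = tag y ->
  (Defs.xcol (inl u) < Defs.xcol (inl y)) = (content (inl u) < content (inl y)).
Proof. move=> e; have er : rowno (tag u) = rowno (tag y) by rewrite e.
by rewrite /content [Defs.xrow _]/(tag u) [Defs.xrow (inl y)]/(tag y) er ltrD2r. Qed.

Hypothesis Hnu : all ragged_right nu.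

Lemma row_sumn p : (p < sumn (shape nu))%N.
Proof. by rewrite -size_flatten ltn_ord. Qed.

Lemma row_nth p : nth (0, 0) (flatten nu) p = nth (0, 0) (nth [::] nu (comp p)) (rowno p).-1.
Proof. exact: nth_flatten. Qed.

Lemma row_diagram p : ragged_right (nth [::] nu (comp p)).
Proof.
apply: (allP Hnu); apply: mem_nth.
by rewrite -(size_map size); apply: reshape_indexP; exact: row_sumn.
Qed.

Lemma rowno_size p : ((rowno p).-1 < size (nth [::] nu (comp p)))%N.
Proof. by rewrite -nth_shape; apply: reshape_offsetP; exact: row_sumn. Qed.

Lemma alpha_le_beta p : alpha p <= beta p.
Proof.
have /and3P[_ /allP h _] := row_diagram p.
by apply: h; rewrite row_nth; apply: mem_nth; exact: rowno_size.
Qed.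

Lemma row_step p q : val q = p.+1 -> comp p = comp q -> alpha q <= alpha p /\ beta q <= beta p + 1.
Proof.
move=> pq e; have er : rowno q = (rowno p).+1 by have := rowno_sub e; rewrite pq; lia.
have /and3P[_ _ /(sortedP (0, 0)) h] := row_diagram p.
have := h (rowno p).-1; have := rowno_size q; rewrite -e er /= => sz /(_ sz).
by rewrite /alpha /beta !row_nth -e er /= => /andP[].
Qed.

Lemma gamma_le_eta p : ga p <= et p.
Proof. by rewrite !ffunE; have := alpha_le_beta p; lia. Qed.

Lemma gamma_comp p q : (p < q)%N -> comp p = comp q -> ga q < ga p.
Proof.
move: p q; apply: comp_row_ind => [p q pq e|p r q _ _ _ _ h1 h2]; last exact: lt_trans h1.
have [h _] := row_step pq e; have := rowno_sub e; rewrite pq !ffunE; lia.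
Qed.

(** This is the ragged-right condition on the right ends, read on contents. *)
Lemma eta_comp p q : (p < q)%N -> comp p = comp q -> et q <= et p.
Proof.
move: p q; apply: comp_row_ind => [p q pq e|p r q _ _ _ _ h1 h2]; last exact: le_trans h1.
have [_ h] := row_step pq e; have := rowno_sub e; rewrite pq !ffunE; lia.
Qed.

Lemma box_width p : (`|beta p - alpha p|%N)%:Z = et p - ga p.
Proof. by rewrite !ffunE; have := alpha_le_beta p; lia. Qed.

Lemma content_box_bound u : ga (tag u) <= content (inl u) < et (tag u).
Proof. by rewrite content_box; have := box_width (tag u); have := ltn_ord (tagged u); lia. Qed.

Lemma box_at p c : ga p <= c < et p -> exists2 u : box nu, tag u = p & content (inl u) = c.
Proof.
move=> h; have w := box_width p.
have lt : (`|c - ga p|%N < `|beta p - alpha p|%N)%N by lia.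
by exists (Tagged (fun p => 'I_`|beta p - alpha p|%N) (Ordinal lt)) => //; rewrite content_box /=; lia.
Qed.

Variable sigma : 'S_l.
Hypothesis Hsigma : compatible sigma.

Lemma sigma_comp p q : (p < q)%N -> comp p = comp q -> ((sigma^-1)%g q < (sigma^-1)%g p)%N.
Proof.
move=> pq e; move: p q pq e; apply: comp_row_ind => [p q pq e|p r q _ _ _ _ h1 h2]; last exact: ltn_trans h1.
have /andP[_ /forallP/(_ p)/forallP/(_ q)/implyP h] := Hsigma.
by apply: h; rewrite pq e !eqxx.
Qed.

Lemma eta_sigma_mono (i j : 'I_l) : (i <= j)%N -> et (sigma i) <= et (sigma j).
Proof. by move=> ij; have /andP[/forallP/(_ i)/forallP/(_ j)/implyP h _] := Hsigma; apply: h. Qed.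

End RowData.

(** * Chains correspond to flagged tableaux *)

Section ChainStates.
Variables (l : nat) (comp : 'I_l -> nat) (eta : wt l) (sigma : 'S_l) (D : nat).
Local Notation kT := {ffun 'I_l -> 'I_D.+1}.
Implicit Types (p q : 'I_l) (ga : wt l) (L : seq (bool * nat * nat)) (c : seq kT) (k : kT) (j : nat).
Local Notation s0 := (false, 0%N, 0%N).
Local Notation k0 := ([ffun=> ord0] : kT).

Definition kap ga c j : wt l := foldl (@wshift l D) ga (take j c).

Lemma kap0 ga c : kap ga c 0 = ga.
Proof. by rewrite /kap take0. Qed.

Lemma kapS ga c j p : (j < size c)%N -> kap ga c j.+1 p = kap ga c j p + (nth k0 c j p : nat)%:Z.
Proof. by move=> js; rewrite /kap (take_nth k0) // -cats1 foldl_cat /= ffunE. Qed.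

Lemma wshift_kap ga c j : (j < size c)%N -> wshift (kap ga c j) (nth k0 c j) = kap ga c j.+1.
Proof. by move=> js; apply/ffunP => p; rewrite kapS // ffunE. Qed.

Definition step_valid ga c j (s : bool * nat * nat) : bool :=
  [&& inact_ok eta sigma s.1.2 (kap ga c j), ksum (nth k0 c j) == s.2
    & step_ok comp sigma s.1.1 s.1.2 (kap ga c j) (nth k0 c j)].

Lemma chain_validP L ga c :
  reflect [/\ size c = size L, forall j, (j < size L)%N -> step_valid ga c j (nth s0 L j)
            & kap ga c (size L) = eta]
    (chain_valid comp eta sigma L ga c).
Proof.
elim: L ga c => [|[[neg m] n] L IH] ga [|k c] /=.
- by apply: (iffP eqP) => [e|[]].
- by constructor; case.
- by constructor; case.
have sh j : kap ga (k :: c) j.+1 = kap (wshift ga k) c j by [].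
apply: (iffP and4P) => [[h1 h2 h3 /IH[e1 h4 h5]]|[[e1] h4 h5]].
  split; rewrite ?e1 ?sh // => -[|j] js; last exact: h4.
  by rewrite /step_valid /= kap0 h1 h2 h3.
have /and3P[/= g1 g2 g3] := h4 0%N isT.
rewrite !kap0 in g1 g2 g3; split => //.
by apply/IH; split => // j js; exact: (h4 j.+1).
Qed.

Lemma chain_wtE (K : fieldType) (t : K) L ga c : size c = size L ->
  chain_wt t comp sigma L ga c =
  \prod_(0 <= j < size L) step_wt t comp sigma (nth s0 L j).1.1 (nth s0 L j).1.2 (kap ga c j) (nth k0 c j).
Proof.
elim: L ga c => [|[[neg m] n] L IH] ga [|k c] //=; first by rewrite big_geq.
move=> [e]; rewrite big_nat_recl //= kap0; congr (_ * _); rewrite IH //.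
Qed.
End ChainStates.

Lemma sum_shift_eq n (a b : int) : (\sum_(0 <= i < n) ((a + i%:Z == b)%R : nat) = (a <= b < a + n%:Z)%R)%N.
Proof.
elim: n => [|n IH]; first by rewrite big_geq //; case: (boolP (_ && _)) => //; lia.
rewrite big_nat_recr //= IH; case: (boolP (_ && _)); case: eqP; case: (boolP (_ && _)); lia.
Qed.

Lemma sum_shift_lt n (a b : int) : a <= b -> (\sum_(0 <= i < n) ((a + i%:Z < b)%R : nat) = minn n `|b - a|)%N.
Proof.
move=> ab; elim: n => [|n IH]; first by rewrite big_geq // min0n.
by rewrite big_nat_recr //= IH; case: (boolP (_ < _)); lia.
Qed.
Lemma sum_shift_between n (g a b : int) : g <= a -> a <= b -> b <= g + n%:Z ->
  (\sum_(0 <= i < n) (((a <= g + i%:Z) && (g + i%:Z < b))%R : nat) = `|b - a|)%N.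
Proof.
move=> ga ab bn; have e : (\sum_(0 <= i < n) ((g + i%:Z < b)%R : nat) =
    \sum_(0 <= i < n) ((g + i%:Z < a)%R : nat) + \sum_(0 <= i < n) (((a <= g + i%:Z) && (g + i%:Z < b))%R : nat))%N.
  rewrite -big_split; apply: eq_bigr => i _ /=.
  by case: (ltP (g + i%:Z) a) => h /=; [rewrite (lt_le_trans h ab)|].
by move: e; rewrite !sum_shift_lt //; lia.
Qed.

Lemma sum_shift_window n (g a b : int) (F : int -> nat) : g <= a -> a <= b -> b <= g + n%:Z ->
  (\sum_(0 <= i < n | ((a <= g + i%:Z) && (g + i%:Z < b))%R) F (g + i%:Z)%R =
   \sum_(0 <= i < `|b - a|) F (a + i%:Z)%R)%N.
Proof.
move=> ga ab bn; pose n1 := `|a - g|%N; pose d := `|b - a|%N.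
have n1d : (n1 + d <= n)%N by rewrite /n1 /d; lia.
rewrite (@big_cat_nat _ _ _ n1) //=; last exact: leq_trans (leq_addr _ _) n1d.
rewrite [X in (_ + X)%N](@big_cat_nat _ _ _ (n1 + d)) //= ?leq_addr //.
rewrite big_nat_cond big1 ?add0n; last by move=> i; rewrite /n1; lia.
rewrite addnC big_nat_cond big1 ?add0n; last by move=> i; rewrite /n1 /d; lia.
have eB := @big_addn nat 0%N addn 0 (n1 + d) n1; rewrite add0n addKn in eB.
rewrite eB big_nat_cond [RHS]big_nat_cond.
have eF i : g + (i + n1)%:Z = a + i%:Z by rewrite /n1; lia.
apply: eq_big => i; last by rewrite eF.
by rewrite eF andbT; case: (boolP (0 <= i < d)%N) => //=; rewrite /d; lia.
Qed.

Section ContentSums.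
Variable nu : seq (seq (int * int)).
Hypothesis Hnu : all ragged_right nu.
Local Notation l := (nrows nu).
Local Notation ga := (gamma nu).
Local Notation et := (eta nu).
Implicit Types (p q : 'I_l) (u y : box nu) (F : int -> nat) (a b c : int).

Lemma row_sum p F : (\sum_(y : box nu | tag y == p) F (content (inl y)) =
  \sum_(0 <= i < `|et p - ga p|) F (ga p + i%:Z)%R)%N.
Proof.
have -> : (`|et p - ga p| = `|beta p - alpha p|)%N by have := box_width Hnu p; lia.
have := @sig_big_dep _ 0%N addn _ _ (fun i : 'I_l => i == p) (fun=> xpredT)
  (fun (i : 'I_l) (j : 'I_`|beta i - alpha i|%N) => F (ga i + j%:Z)).
rewrite big_pred1_eq big_mkord => ->; apply: eq_big => [y|y _]; first by rewrite andbT.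
by rewrite content_box.
Qed.

Lemma row_sum_eq q c : (\sum_(y : box nu | tag y == q) ((content (inl y) == c)%R : nat) = (ga q <= c < et q)%R)%N.
Proof.
rewrite (row_sum q (fun d => (d == c) : nat)) sum_shift_eq.
have := gamma_le_eta Hnu q. case: (boolP (_ && _)); case: (boolP (_ && _)); lia.
Qed.

Lemma content_sum (G : 'I_l -> int -> nat) c :
  (\sum_(y : box nu | content (inl y) == c) G (tag y) c = \sum_q (ga q <= c < et q)%R * G q c)%N.
Proof.
rewrite (partition_big (fun y => tag y) xpredT) //=; apply: eq_bigr => q _.
rewrite -row_sum_eq big_distrl /= [LHS]big_mkcond [RHS]big_mkcond; apply: eq_bigr => y _.
case: (tag y =P q) => [->|_]; last by rewrite andbF.
by rewrite andbT; case: (_ == c); rewrite ?mul1n.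
Qed.
End ContentSums.

Section TableauStates.
Variable nu : seq (seq (int * int)).
Hypothesis Hnu : all ragged_right nu.
Local Notation l := (nrows nu).
Variables (disp : Order.disp_t) (A : orderType disp) (neg : pred A) (Asub : 'I_l -> pred A).
Local Notation comp := (@row_comp nu).
Local Notation ga := (gamma nu).
Local Notation et := (eta nu).
Implicit Types (p q r : 'I_l) (u y : box nu) (i : 'I_l) (a b : A) (T : {ffun box nu -> A}).
Local Notation ct u := (content (inl u)).

Definition lo T a p : int := ga p + (\sum_(y : box nu | tag y == p) (T y < a)%O)%N%:Z.
Definition hi T a p : int := ga p + (\sum_(y : box nu | tag y == p) (T y <= a)%O)%N%:Z.
Definition mult T a p : nat := (\sum_(y : box nu | tag y == p) (T y == a))%N.

Definition row_weak T : Prop := forall u y, tag u = tag y -> ct u <= ct y -> (T u <= T y)%O.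

Lemma hiE T a p : hi T a p = lo T a p + (mult T a p)%:Z.
Proof.
rewrite /hi /lo /mult -addrA -PoszD -big_split /=; congr (_ + Posz _); apply: eq_bigr => y _.
by rewrite le_eqVlt; case: ltgtP.
Qed.

Lemma lo_ge T a p : ga p <= lo T a p. Proof. by rewrite /lo lerDl. Qed.
Lemma lo_le_hi T a p : lo T a p <= hi T a p. Proof. by rewrite hiE lerDl. Qed.

Lemma row_width p : (\sum_(y : box nu | tag y == p) 1 = `|et p - ga p|)%N.
Proof. by rewrite (row_sum Hnu p (fun=> 1%N)) sum_nat_const_nat subn0 muln1. Qed.

Lemma hi_le T a p : hi T a p <= et p.
Proof.
have : (\sum_(y : box nu | tag y == p) (T y <= a)%O <= `|et p - ga p|)%N.
  by rewrite -row_width; apply: leq_sum => y _; case: (_ <= _)%O.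
by have := gamma_le_eta Hnu p; rewrite /hi; lia.
Qed.

(* A row increases, so the boxes satisfying a lower-set condition form an initial segment of it. *)
Lemma row_prefix (P : pred A) T u : row_weak T ->
  (forall a b, (a <= b)%O -> P b -> P a) ->
  P (T u) = (ct u < ga (tag u) + (\sum_(y : box nu | tag y == tag u) P (T y))%N%:Z).
Proof.
move=> wT dP; have /andP[b1 b2] := content_box_bound Hnu u.
have e : (\sum_(y : box nu | tag y == tag u) ((ct y < ct u)%R : nat) = `|ct u - ga (tag u)|)%N.
  by rewrite (row_sum Hnu (tag u) (fun c => (c < ct u)%R : nat)) sum_shift_lt //; lia.
move: e; rewrite (bigD1 u) //= ltxx add0n => e; rewrite (bigD1 u) //=.
case: (boolP (P (T u))) => Pu.
  have : (`|ct u - ga (tag u)| <= \sum_(y : box nu | (tag y == tag u) && (y != u)) P (T y))%N.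
    rewrite -e; apply: leq_sum => y /andP[/eqP ty _].
    by case: (boolP (_ < _)) => //= lt; rewrite (dP _ _ _ Pu) //; apply: wT => //; apply: ltW.
  by move: (\sum_(y | _) _)%N => S hS; symmetry; lia.
have : (\sum_(y : box nu | (tag y == tag u) && (y != u)) P (T y) <= `|ct u - ga (tag u)|)%N.
  rewrite -e; apply: leq_sum => y /andP[/eqP ty yu].
  case: (boolP (P (T y))) => //= Py; rewrite lt0b ltNge; apply: contra Pu => le.
  by apply: dP Py; apply: wT.
by move: (\sum_(y | _) _)%N => S hS; symmetry; lia.
Qed.

Lemma lt_lo T u a : row_weak T -> (T u < a)%O = (ct u < lo T a (tag u)).
Proof. by move=> wT; apply: (row_prefix (P := fun b => (b < a)%O)) => // b c; apply: le_lt_trans. Qed.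

Lemma le_hi T u a : row_weak T -> (T u <= a)%O = (ct u < hi T a (tag u)).
Proof. by move=> wT; apply: (row_prefix (P := fun b => (b <= a)%O)) => // b c; apply: le_trans. Qed.

Variable sigma : 'S_l.
Local Notation act i p := (active sigma (l - i) p).

(** [Asub i] is A_{i+1}, so the bound i + 1 <= flag number says that the row is among the l - i
    active ones. *)
Lemma flagno_active i p : (i < flagno sigma p)%N = act i p.
Proof. by rewrite /flagno /active; have := ltn_ord ((sigma^-1)%g p); have := ltn_ord i; lia. Qed.

Hypothesis HA : forall (i j : 'I_l) (a b : A), (i < j)%N -> Asub i a -> Asub j b -> (a < b)%O.

Lemma Asub_uniq i i' a : Asub i a -> Asub i' a -> i = i'.
Proof.
move=> h h'; apply: val_inj; case: (ltngtP i i') => // lt.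
  by have := HA lt h h'; rewrite ltxx.
by have := HA lt h' h; rewrite ltxx.
Qed.

Lemma Asub_mono i i' a b : Asub i a -> Asub i' b -> (a <= b)%O -> (i <= i')%N.
Proof. by move=> h h'; apply: contraTT; rewrite -ltnNge -ltNge => lt; apply: HA lt h' h. Qed.

Hypothesis Hsigma : compatible sigma.

Lemma act_comp i p q : (p < q)%N -> comp p = comp q -> act i p -> act i q.
Proof. by move=> pq e; apply: leq_trans; apply: ltnW; apply: (sigma_comp Hsigma). Qed.

Lemma act_mono i i' p : (i <= i')%N -> act i' p -> act i p.
Proof. by move=> le h; apply: leq_trans h (leq_sub2l _ le). Qed.

(** The conditions [inact_ok] and [step_ok] of the step of the letter a, expressed by T. They hold
    for every a lying in some A_i when T is a flagged tableau, and give one back when they hold for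
    the entries of a row-increasing T. *)
Record state_ok T a i : Prop := StateOk {
  state_inact : forall p, ~~ act i p -> lo T a p = et p;
  state_mult : neg a -> forall p, (mult T a p <= 1)%N;
  state_reg : forall p q, (p < q)%N -> comp p = comp q -> act i p ->
     hi T a q < (if neg a then hi T a p else lo T a p) }.

(** Strictness at each of the q - p rows climbed gains 1, which turns the comparison of contents
    into one of columns. *)
Lemma state_step T a i p q : state_ok T a i -> (p < q)%N -> comp p = comp q -> act i p ->
  hi T a q + (q : nat)%:Z <= (if neg a then hi T a p else lo T a p) + (p : nat)%:Z.
Proof.
move=> ok pq e; move: p q pq e.
apply: (@comp_row_ind nu (fun p q => act i p -> _)) => [p q pq e ap|p r q pr rq e1 e2 h1 h2 ap].
  by have := state_reg ok _ e ap; rewrite pq; move=> /(_ (ltnSn _)); lia.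
have ar := act_comp pr e1 ap; have := h1 ap; have := h2 ar; have := lo_le_hi T a r.
by case: (neg a); lia.
Qed.
Lemma row_ok_weak T : row_ok neg T -> row_weak T.
Proof.
move=> /forallP h u y e; rewrite le_eqVlt => /orP[/eqP ec|lt].
  by rewrite (box_inj e ec) lexx.
by have /forallP/(_ y)/implyP := h u; rewrite e eqxx /= same_row_lt // => /(_ lt)/andP[].
Qed.

Lemma box_column u y : comp (tag u) = comp (tag y) ->
  (Defs.xcol (inl u) == Defs.xcol (inl y)) = (ct u + (tag u : nat)%:Z == ct y + (tag y : nat)%:Z).
Proof. exact: (@same_column nu (inl u) (inl y)). Qed.

Lemma flag_column p u : comp p = comp (tag u) ->
  (Defs.xcol (inr p) == Defs.xcol (inl u)) = (et p + (p : nat)%:Z == ct u + (tag u : nat)%:Z).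
Proof. by move=> e; rewrite -content_flag; exact: (@same_column nu (inr p) (inl u)). Qed.

(** For the strict decrease it suffices to take neighbouring rows p below q. If it failed, the last
    box of row q with entry at most a would have directly below it either the flag box of row p,
    against admissibility, or a box of row p, against the column condition. *)
Lemma FST_state_ok T a i : FST sigma neg Asub T -> Asub i a -> state_ok T a i.
Proof.
case/and3P=> rT /forallP cT /forallP fT ia; have wT := row_ok_weak rT.
have flag y : exists2 i', Asub i' (T y) & admissible sigma i'.+1 y.
  by have /andP[/existsP[i' h] /forallP/(_ i')/implyP h'] := fT y; exists i' => //; apply: h'.
split=> [p np|na p|].
- have all y : tag y = p -> (T y < a)%O.
    move=> ty; have [i' hi' /andP[f _]] := flag y.
    rewrite flagno_active ty in f; rewrite ltNge; apply: contra np => le.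
    exact: act_mono (Asub_mono ia hi' le) f.
  rewrite /lo (eq_bigr (fun=> 1%N)) => [|y /eqP /all -> //].
  by rewrite row_width; have := gamma_le_eta Hnu p; lia.
- rewrite /mult leqNgt; apply/negP.
  rewrite (eq_bigr (fun y => if T y == a then 1 else 0)%N) => [|y _]; last by case: (T y == a).
  rewrite -big_mkcondr sum1_card => /card_gt1P[u [y [/andP[/eqP tu /eqP Tu] /andP[/eqP ty /eqP Ty] uy]]].
  wlog lt : u y tu Tu ty Ty uy / ct u < ct y.
    move=> W; case: (ltgtP (ct u) (ct y)) => [lt|lt|e].
    + exact: (W u y).
    + by apply: (W y u) => //; rewrite eq_sym.
    + by rewrite (box_inj _ e) ?eqxx // tu ty in uy.
  have /forallP/(_ u)/forallP/(_ y)/implyP := rT.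
  by rewrite tu ty eqxx same_row_lt ?tu ?ty //= lt Tu Ty eqxx na /= andbF => /(_ isT).
apply: comp_row_ind => [p q pq e|p r q pr rq e1 e2 h1 h2] ap; last first.
  have := h1 ap; have := h2 (act_comp pr e1 ap); have := lo_le_hi T a r.
  by case: (neg a); lia.
have pq' : (p < q)%N by rewrite pq.
rewrite ltNge; apply/negP => le.
have g1 := gamma_comp Hnu pq' e; have g2 := lo_ge T a p; have g3 := hi_le T a q.
have g4 := eta_comp Hnu pq' e; have g5 := lo_le_hi T a p.
have le' : lo T a p <= hi T a q by move: le; case: (neg a); lia.
(* Row q lies one above row p, so below the box of content hi - 1 in row q is the place of content
   hi in row p. *)
have [|y ty cy] := @box_at nu Hnu q (hi T a q - 1); first by lia.
have Ty : (T y <= a)%O by rewrite le_hi // ty; lia.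
have [i' hi' /andP[_ /forallP/(_ p)/implyP adm]] := flag y.
have ii := Asub_mono hi' ia Ty.
case: (ltgtP (hi T a q) (et p)) => [lt|lt|ec]; last 2 first.
- by lia.
- suff : ~~ act i' p by rewrite (act_mono ii ap).
  rewrite -flagno_active -leqNgt -ltnS; apply: adm; rewrite flag_column ty // e eqxx rowno_lt // pq'.
  by rewrite -ec cy pq andbT; apply/eqP; lia.
have [|z tz cz] := @box_at nu Hnu p (hi T a q); first by lia.
have /forallP/(_ y)/implyP := cT z; rewrite box_column tz ty // e eqxx rowno_lt // pq' cz cy pq.
have -> : hi T a q + p%:Z == hi T a q - 1 + p.+1%:Z by rewrite -addn1 PoszD; apply/eqP; ring.
move=> /(_ isT)/andP[Tzy eqn]; move: le eqn; case: (boolP (neg a)) => na le eqn.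
  by have := le_trans Tzy Ty; rewrite le_hi // tz cz ltNge le.
have Tza : (a <= T z)%O by rewrite leNgt lt_lo // tz cz -leNgt.
have Tz : T z = a by apply/le_anti; rewrite Tza (le_trans Tzy).
have Tya : T y = a by apply/le_anti; rewrite Ty -{1}Tz.
by move: eqn; rewrite Tz Tya eqxx (negbTE na).
Qed.

(** Each tableau condition is read off at one letter: column conditions at the entry of the upper
    box, flag conditions at the entry of the box itself. *)
Lemma state_ok_FST T : row_weak T -> (forall u, exists i, Asub i (T u)) ->
  (forall u i, Asub i (T u) -> state_ok T (T u) i) -> FST sigma neg Asub T.
Proof.
move=> wT sT ok.
have Tu u : ct u < hi T (T u) (tag u) by rewrite -le_hi.
apply/and3P; split.
- apply/forallP => u; apply/forallP => y; apply/implyP => /andP[/eqP e].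
  rewrite same_row_lt // => lt; rewrite wT ?(ltW lt) //=; apply/implyP => /eqP Tuy.
  apply/negP => na; have [i hi'] := sT u; have := state_mult (ok u i hi') na (tag u).
  rewrite /mult (bigD1 u) // (bigD1 y) /=; last by rewrite e eqxx; apply: contraTneq lt => ->; rewrite ltxx.
  by rewrite Tuy eqxx.
- apply/forallP => u; apply/forallP => y; apply/implyP => /and3P[/eqP e]; rewrite box_column //.
  rewrite rowno_lt // => /eqP ec lt; have [i iy] := sT y; have oky := ok y i iy.
  have := Tu y; have := content_box_bound Hnu u.
  case: (boolP (act i (tag u))) => au; last first.
    by have := state_inact oky au => <- /andP[_ h] _; move: h; rewrite -lt_lo // => h; rewrite ltW //= lt_eqF.
  have := state_step oky lt e au; case: (boolP (neg (T y))) => ny le _ hy.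
    have -> : (T u <= T y)%O by rewrite le_hi //; lia.
    by apply/implyP => /eqP ->.
  have h : (T u < T y)%O by rewrite lt_lo //; lia.
  by rewrite ltW //= lt_eqF.
apply/forallP => u; apply/andP; split; first by apply/existsP.
apply/forallP => i; apply/implyP => iu; have oku := ok u i iu; apply/andP; split.
  rewrite flagno_active; apply/negPn/negP => na.
  by have := content_box_bound Hnu u; rewrite -(state_inact oku na) -lt_lo // ltxx andbF.
apply/forallP => q; apply/implyP => /and3P[/eqP e]; rewrite flag_column // rowno_lt // => /eqP ec lt.
rewrite ltnS leqNgt flagno_active; apply/negP => aq.
have := state_step oku lt e aq; have := Tu u; have := hi_le T (T u) q; have := lo_le_hi T (T u) q.
by case: (neg _); lia.
Qed.
End TableauStates.

Section ChainsOfTableaux.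
Variable nu : seq (seq (int * int)).
Hypothesis Hnu : all ragged_right nu.
Local Notation l := (nrows nu).
Variable sigma : 'S_l.
Hypothesis Hsigma : compatible sigma.
Variables (disp : Order.disp_t) (A : orderType disp) (neg : pred A) (Asub : 'I_l -> pred A).
Hypothesis HA : forall (i j : 'I_l) (a b : A), (i < j)%N -> Asub i a -> Asub j b -> (a < b)%O.
Variable x : {cmonom A}.
Local Notation comp := (@row_comp nu).
Local Notation ga := (gamma nu).
Local Notation et := (eta nu).
Implicit Types (p q r : 'I_l) (u y : box nu) (i : 'I_l) (a b : A) (T : {ffun box nu -> A}) (j : nat).
Local Notation ct u := (content (inl u)).
Local Notation act i p := (active sigma (l - i) p).
Local Notation D := (monalg.mdeg x).
Local Notation kT := {ffun 'I_l -> 'I_D.+1}.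
Local Notation s0 := (false, 0%N, 0%N).
Local Notation k0 := ([ffun=> ord0] : kT).

Definition letters : seq A := sort <=%O (finsupp (cmonom_val x)).
(* The number of variables z_p^-1 in the factor of the letter a; junk value 0 if a lies in no A_i. *)
Definition level a : nat := if [pick i | Asub i a] is Some i then (l - i)%N else 0%N.
Definition letter_step a := (neg a, level a, cmonom_val x a).
(** For x^T = x no multiplicity exceeds the degree of x ([mult_le]), so [inord] is harmless. *)
Definition chain_of T : seq kT := map (fun a => [ffun p => inord (mult T a p)] : kT) letters.

Lemma mem_letters a : (a \in letters) = (a \in finsupp (cmonom_val x)).
Proof. exact: mem_sort. Qed.

Lemma letters_uniq : uniq letters.
Proof. by rewrite sort_uniq fset_uniq. Qed.

Lemma letters_sorted : sorted <=%O letters.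
Proof. by apply: sort_sorted; exact: le_total. Qed.

Lemma index_le a b : a \in letters -> b \in letters ->
  (index a letters <= index b letters)%N = (a <= b)%O.
Proof.
move=> ha hb; apply/idP/idP.
  exact: (sorted_leq_index le_trans le_refl letters_sorted).
apply: contraTT; rewrite -ltnNge => lt; rewrite -ltNge lt_neqAle.
rewrite (sorted_leq_index le_trans le_refl letters_sorted) ?(ltnW lt) // andbT.
by apply: contraTneq lt => ->; rewrite ltnn.
Qed.

Lemma index_lt a b : a \in letters -> b \in letters ->
  (index a letters < index b letters)%N = (a < b)%O.
Proof. by move=> ha hb; rewrite ltnNge index_le // ltNge. Qed.

Lemma nth_letters j : (j < size letters)%N -> exists2 a, a \in letters & index a letters = j.
Proof.
by case: letters letters_uniq => // a s us js; exists (nth a (a :: s) j); rewrite ?mem_nth ?index_uniq.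
Qed.

Lemma levelE i a : Asub i a -> level a = (l - i)%N.
Proof.
rewrite /level; case: pickP => [i' h' h|/(_ i) -> //].
by rewrite (Asub_uniq HA h' h).
Qed.

Lemma xmonE T a : cmonom_val (xmon T) a = (\sum_u (T u == a))%N.
Proof.
have M (m m' : {cmonom A}) : cmonom_val (mmul m m') a = (cmonom_val m a + cmonom_val m' a)%N.
  exact: monalg.cmM.
rewrite /xmon (big_morph (fun m : {cmonom A} => cmonom_val m a) M (monalg.cm1 a)).
by apply: eq_bigr => u _; rewrite monalg.cmU.
Qed.

Section FixedTableau.
Variable T : {ffun box nu -> A}.
Hypothesis Tx : xmon T = x.

Lemma xcount a : cmonom_val x a = (\sum_u (T u == a))%N.
Proof. by rewrite -Tx xmonE. Qed.

Lemma T_letters u : T u \in letters.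
Proof. by rewrite mem_letters -monalg.cmE_neq0 xcount (bigD1 u) //= eqxx. Qed.

Lemma sum_mult a : (\sum_p mult T a p = cmonom_val x a)%N.
Proof. by rewrite xcount (partition_big (fun y : box nu => tag y) xpredT). Qed.

Lemma mult_le a p : (mult T a p <= D)%N.
Proof.
apply: (@leq_trans (cmonom_val x a)); first by rewrite -(sum_mult a) (bigD1 p) //= leq_addr.
have [h|/fsfun_dflt -> //] := boolP (a \in finsupp (cmonom_val x)).
by rewrite monalg.mdegE (big_fsetD1 a) //= leq_addr.
Qed.

Lemma size_chain_of : size (chain_of T) = size letters.
Proof. exact: size_map. Qed.

Lemma nth_chain_of a p : a \in letters -> nth k0 (chain_of T) (index a letters) p = mult T a p :> nat.
Proof.
by move=> ha; rewrite (nth_map a) ?index_mem // ffunE nth_index // inordK // ltnS mult_le.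
Qed.

Lemma kap_chain_of j p : (j <= size letters)%N ->
  kap ga (chain_of T) j p = ga p + (\sum_(y : box nu | tag y == p) (index (T y) letters < j))%N%:Z.
Proof.
elim: j => [_|j IH js]; first by rewrite kap0 big1 ?addr0.
have [a ha ja] := nth_letters js.
move: ja IH js => <- IH js; rewrite kapS ?size_chain_of // IH 1?ltnW //.
rewrite nth_chain_of // -addrA -PoszD; congr (_ + Posz _).
rewrite /mult -big_split; apply: eq_bigr => y _ /=; rewrite ltnS [in RHS]leq_eqVlt.
have -> : (index (T y) letters == index a letters) = (T y == a).
  apply/eqP/eqP => [e|-> //]; rewrite -(nth_index a (T_letters y)) e; exact: nth_index.
by case: eqP => [->|_]; rewrite ?ltnn ?addn0.
Qed.

Lemma kap_lo a : a \in letters -> kap ga (chain_of T) (index a letters) =1 lo T a.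
Proof.
move=> ha p; rewrite kap_chain_of ?index_size // /lo; congr (_ + Posz _).
by apply: eq_bigr => y _; rewrite index_lt // T_letters.
Qed.

Lemma kap_hi a : a \in letters -> kap ga (chain_of T) (index a letters).+1 =1 hi T a.
Proof.
move=> ha p; rewrite kap_chain_of ?index_mem // /hi; congr (_ + Posz _).
by apply: eq_bigr => y _; rewrite ltnS index_le // T_letters.
Qed.

Lemma kap_end : kap ga (chain_of T) (size letters) = et.
Proof.
apply/ffunP => p; rewrite kap_chain_of // (eq_bigr (fun=> 1%N)) => [|y _].
  rewrite row_width // gez0_abs; last by rewrite subr_ge0 gamma_le_eta.
  by rewrite addrCA subrr addr0.
by rewrite index_mem T_letters.
Qed.

Lemma step_valid_state a i : a \in letters -> Asub i a ->
  reflect (state_ok neg sigma T a i)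
    (step_valid comp et sigma ga (chain_of T) (index a letters) (letter_step a)).
Proof.
move=> ha ia; rewrite /step_valid /= (levelE ia).
have kE := nth_chain_of _ ha; have loE := kap_lo ha; have hiE' := kap_hi ha.
have ws : wshift (kap ga (chain_of T) (index a letters)) (nth k0 (chain_of T) (index a letters)) =1 hi T a.
  by move=> p; rewrite wshift_kap ?size_chain_of ?index_mem.
move: (kap _ _ _) (nth _ _ _) kE loE ws => la k kE loE ws.
have -> : (ksum k == cmonom_val x a) = true.
  by apply/eqP; rewrite -sum_mult; apply: eq_bigr => p _; rewrite kE.
(* An inactive row is already full and receives no entry equal to a. *)
have k00 p : lo T a p = et p -> mult T a p = 0%N.
  by move=> e; have := hi_le Hnu T a p; rewrite hiE e; lia.
apply: (iffP andP) => [[/forallP h1 /= h2]|[h1 h2 h3]].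
  have h1' p : ~~ act i p -> lo T a p = et p.
    by move=> np; rewrite -loE; apply/eqP/(implyP (h1 p)).
  move: h2; rewrite /step_ok; case: (boolP (neg a)) => na.
    case/and3P=> /forallP g1 _ /regularP g3; split=> // [_ p|p q pq e ap]; first by rewrite -kE.
    by rewrite na -!ws; apply: g3.
  case/pos_okP=> _ g2; split; rewrite ?(negbTE na) // => p q pq e ap.
  by rewrite hiE -kE -!loE; apply: g2.
split; first by apply/forallP => p; apply/implyP => np; rewrite loE h1.
rewrite /= /step_ok; case: (boolP (neg a)) => na.
  apply/and3P; split.
  - by apply/forallP => p; rewrite kE h2.
  - by apply/forallP => p; apply/implyP => np; rewrite kE k00 // h1.
  by apply/regularP => p q pq e ap; rewrite !ws; have := h3 p q pq e ap; rewrite na.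
apply/pos_okP; split=> [p np|p q pq e ap]; first by rewrite kE k00 // h1.
by rewrite kE !loE -hiE; have := h3 p q pq e ap; rewrite (negbTE na).
Qed.
End FixedTableau.

Definition letter_steps := map letter_step letters.

Lemma nth_letter_steps a : a \in letters -> nth s0 letter_steps (index a letters) = letter_step a.
Proof. by move=> ha; rewrite (nth_map a) ?index_mem // nth_index. Qed.

Lemma size_letter_steps : size letter_steps = size letters.
Proof. exact: size_map. Qed.

Hypothesis letters_Asub : forall a, a \in letters -> exists i, Asub i a.

Lemma chain_of_valid T : FST sigma neg Asub T -> xmon T = x ->
  chain_valid comp et sigma letter_steps ga (chain_of T).
Proof.
move=> hT Tx; apply/chain_validP; rewrite size_letter_steps; split.
- exact: size_chain_of.
- move=> j /nth_letters[a ha <-]; rewrite nth_letter_steps //.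
  have [i ia] := letters_Asub ha; apply/(step_valid_state Tx ha ia).
  exact: (FST_state_ok Hnu HA Hsigma hT ia).
exact: kap_end.
Qed.

(** The chain determines [hi] at all letters, and T u <= a is equivalent to the content of u lying
    below [hi] in its row. *)
Lemma chain_of_inj T T' : row_weak T -> row_weak T' -> xmon T = x -> xmon T' = x ->
  chain_of T = chain_of T' -> T = T'.
Proof.
move=> wT wT' Tx Tx' e; apply/ffunP => u; apply/le_anti.
have hh a p : a \in letters -> hi T a p = hi T' a p by move=> ha; rewrite -!kap_hi // e.
rewrite (le_hi Hnu) // hh ?T_letters // -(le_hi Hnu) // lexx.
by rewrite (le_hi Hnu) // -hh ?T_letters // -(le_hi Hnu) // lexx.
Qed.
Lemma chain_of_surj c : chain_valid comp et sigma letter_steps ga c ->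
  exists T, [/\ FST sigma neg Asub T, xmon T = x & chain_of T = c].
Proof.
move=> vc; have /chain_validP[sc vj ec] := vc; rewrite size_letter_steps in sc vj ec.
pose K j := kap ga c j.
have KS j p : (j < size letters)%N -> K j.+1 p = K j p + (nth k0 c j p : nat)%:Z by rewrite -sc; apply: kapS.
have Kle j j' p : (j <= j')%N -> (j' <= size letters)%N -> K j p <= K j' p.
  move=> /subnKC <-; elim: (j' - j)%N => [|d IH]; rewrite ?addn0 // addnS => h.
  by apply: (le_trans (IH (ltnW h))); rewrite KS // lerDl.
have K0 p : K 0%N p = ga p by rewrite /K kap0.
have KN p : K (size letters) p = et p by rewrite /K ec.
(* The entry of a box is the letter of the step at which the weight of its row passes the content of
   the box. It is found as the first j whose weight exceeds the content; j = 0 is impossible, as the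
   row starts at gamma. *)
have E u : exists j : 'I_(size letters), K j (tag u) <= ct u < K j.+1 (tag u).
  have /andP[b1 b2] := content_box_bound Hnu u.
  have ex : exists j, ct u < K j (tag u) by exists (size letters); rewrite KN.
  case: (ex_minnP ex) => -[|j] hj mj; first by rewrite K0 ltNge b1 in hj.
  have js : (j < size letters)%N by apply: mj; rewrite KN.
  exists (Ordinal js); rewrite hj andbT leNgt; apply/negP => /mj; by rewrite ltnn.
have [jo hjo] := fin_all_exists E.
pose T : {ffun box nu -> A} := [ffun u => tnth (in_tuple letters) (jo u)].
have Tl u : T u \in letters by rewrite ffunE; apply: mem_tnth.
have Ti u : index (T u) letters = jo u.
  by rewrite ffunE (tnth_nth (T u)) index_uniq ?letters_uniq.
have wT : row_weak T.
  move=> u y e le; rewrite -index_le // !Ti leqNgt; apply/negP => lt.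
  have /andP[h1 _] := hjo u; have /andP[_ h2] := hjo y.
  have := Kle (jo y).+1 (jo u) (tag y) lt (ltnW (ltn_ord _)).
  by rewrite leNgt (le_lt_trans _ h2) // (le_trans _ le) // -e.
have mT a p : a \in letters -> mult T a p = nth k0 c (index a letters) p :> nat.
  move=> ha; have js : (index a letters < size letters)%N by rewrite index_mem.
  have eq y : tag y = p -> (T y == a) = (K (index a letters) p <= ct y) && (ct y < K (index a letters).+1 p).
    move=> ty; have /andP[h1 h2] := hjo y; rewrite ty in h1 h2.
    have -> : (T y == a) = (jo y == index a letters :> nat).
      rewrite -Ti; apply/eqP/eqP => [-> //|e]; rewrite -(nth_index a (Tl y)) e; exact: nth_index.
    case: ltngtP => [lt|lt|e]; last by rewrite -e h1 h2.
      by symmetry; apply/negbTE/nandP; left; rewrite -ltNge; apply: lt_le_trans h2 (Kle _ _ _ lt (ltnW js)).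
    by symmetry; apply/negbTE/nandP; right; rewrite -leNgt; apply: le_trans (Kle _ _ _ lt (ltnW (ltn_ord _))) h1.
  rewrite /mult (eq_bigr (fun y => ((K (index a letters) p <= ct y) && (ct y < K (index a letters).+1 p))%R : nat)).
    rewrite (row_sum Hnu p (fun d => ((K (index a letters) p <= d) && (d < K (index a letters).+1 p))%R : nat)).
    rewrite sum_shift_between.
    - by rewrite KS //; lia.
    - by rewrite -K0 Kle // ltnW.
    - exact: Kle.
    - have := Kle _ _ p js (leqnn _); rewrite KN; have := gamma_le_eta Hnu p; lia.
  by move=> y /eqP ty; rewrite eq.
have Tx : xmon T = x.
  apply: cm_ext => a; rewrite xmonE (partition_big (fun y : box nu => tag y) xpredT) //=.
  case: (boolP (a \in letters)) => ha.
    rewrite (eq_bigr (fun p => nth k0 c (index a letters) p : nat)) => [|p _]; last exact: mT.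
    have := vj (index a letters); rewrite index_mem ha nth_letter_steps // => /(_ isT).
    by case/and3P=> _ /eqP.
  rewrite [RHS](_ : _ = 0%N); last by move: ha; rewrite mem_letters => /fsfun_dflt.
  apply: big1 => p _; apply: big1 => y _.
  by case: eqP => // e; rewrite -e Tl in ha.
have cT : chain_of T = c.
  apply: (@eq_from_nth _ k0); first by rewrite size_chain_of sc.
  move=> j; rewrite size_chain_of => /nth_letters[a ha <-]; apply/ffunP => p; apply: val_inj.
  by rewrite /= nth_chain_of // mT.
exists T; split=> //; apply: state_ok_FST => // [u|u i iu]; first exact: letters_Asub.
apply/(step_valid_state Tx (Tl u) iu); rewrite cT -nth_letter_steps //.
by apply: vj; rewrite index_mem.
Qed.
End ChainsOfTableaux.

(** As pr <= po + 1, the conditions c < pr, pr <= c <= po and po <= c - 1 exclude each other and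
    exhaust all c. In an inactive row pr = po = e, and at c = e the flag box takes the place of the
    middle case. *)
Lemma pair_count (g e pr po c : int) (ac : bool) : g <= pr <= e -> g <= po <= e -> pr <= po + 1 ->
  (~~ ac -> pr = e /\ po = e) ->
  (((g <= c < e) && (c < pr) : nat) + ((c == e) && ~~ ac : nat) +
   ((g <= c - 1 < e) && (po <= c - 1) : nat) + (ac && (pr <= c <= po) : nat) = (g <= c <= e) :> nat)%R%N.
Proof.
move=> h1 h2 h3; case: ac => [_|/(_ isT)[-> ->]]; rewrite ?andbT ?andbF ?addn0 /=.
  case: (boolP (_ && (c < pr))); case: (boolP (_ && (po <= _))); case: (boolP (pr <= _ <= _));
    case: (boolP (g <= c <= e)); lia.
case: (boolP (_ && (c < e))); case: (boolP (_ && (e <= _))); case: eqP;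
  case: (boolP (g <= c <= e)); lia.
Qed.

Lemma closed_interval (g e c : int) : g <= e ->
  (((g <= c < e)%R : nat) + (c == e) = (g <= c <= e)%R :> nat)%N.
Proof. by move=> h; case: (ltgtP c e) => [_|_|->]; rewrite ?andbT ?andbF ?addn0 // h. Qed.

Lemma card_pairs (I J : finType) (P : I -> J -> bool) :
  #|[set uz : I * J | P uz.1 uz.2]| = (\sum_(u : I) \sum_(z : J) P u z)%N.
Proof.
rewrite -sum1dep_card pair_bigA /= big_mkcond; apply: eq_bigr => uz _.
by case: (P _ _).
Qed.

(** * Comparison of the powers of t *)

Section Statistics.
Variable nu : seq (seq (int * int)).
Hypothesis Hnu : all ragged_right nu.
Local Notation l := (nrows nu).
Variable sigma : 'S_l.
Hypothesis Hsigma : compatible sigma.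
Variables (disp : Order.disp_t) (A : orderType disp) (neg : pred A) (Asub : 'I_l -> pred A).
Hypothesis HA : forall (i j : 'I_l) (a b : A), (i < j)%N -> Asub i a -> Asub j b -> (a < b)%O.
Variable T : {ffun box nu -> A}.
Hypothesis hT : FST sigma neg Asub T.
Local Notation comp := (@row_comp nu).
Local Notation ga := (gamma nu).
Local Notation et := (eta nu).
Implicit Types (p q r : 'I_l) (u y : box nu) (i : 'I_l) (a b : A) (c : int).
Local Notation ct u := (content (inl u)).
Local Notation act u p := (active sigma (level Asub (T u)) p).

(** An entry a has an inversion with the boxes of row q of content below [pre a q] ([later_pre]),
    and the boxes of row q of content at least [post a q] have one with a ([later_post]). Equal
    negative entries count as inversions, which exchanges the roles of [lo] and [hi]. *)
Definition pre a q : int := if neg a then hi T a q else lo T a q.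
Definition post a q : int := if neg a then lo T a q else hi T a q.

Let wT : row_weak T.
Proof. by case/and3P: hT => /row_ok_weak. Qed.

Lemma box_letter u : exists2 i, Asub i (T u) & level Asub (T u) = (l - i)%N.
Proof.
case/and3P: hT => _ _ /forallP/(_ u)/andP[/existsP[i iu] _].
by exists i => //; apply: (levelE HA).
Qed.

Lemma box_pair_count u q :
  (((ga q <= ct u < et q) && (ct u < pre (T u) q) : nat) + ((ct u == et q) && ~~ act u q : nat) +
   ((ga q <= ct u - 1 < et q) && (post (T u) q <= ct u - 1) : nat) +
   (act u q && (pre (T u) q <= ct u <= post (T u) q) : nat) = (ga q <= ct u <= et q) :> nat)%R%N.
Proof.
have [i iu ->] := box_letter u; have ok := FST_state_ok Hnu HA Hsigma hT iu.
have h1 := lo_ge T (T u) q; have h2 := lo_le_hi T (T u) q; have h3 := hi_le Hnu T (T u) q.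
apply: pair_count; rewrite /pre /post.
- by case: (neg _); apply/andP; split=> //; [apply: le_trans h2|apply: le_trans h3].
- by case: (neg _); apply/andP; split=> //; [apply: le_trans h3|apply: le_trans h2].
- case: (boolP (neg _)) => na; last by apply: (le_trans h2); rewrite lerDl.
  by rewrite hiE lerD2l; have := state_mult ok na q; case: (mult _ _ _) => [|[]].
move=> /(state_inact ok) e; have eh : hi T (T u) q = et q by apply/le_anti; rewrite h3 -e h2.
by rewrite e eh; case: (neg _).
Qed.

Lemma sum_xbox (F : xbox nu -> nat) :
  (\sum_(z : xbox nu) F z = \sum_(y : box nu) F (inl y) + \sum_(q : 'I_l) F (inr q))%N.
Proof. exact: big_sumType. Qed.

Lemma content_sum_cond (G : 'I_l -> int -> bool) c :
  (\sum_(y : box nu) ((ct y == c) && G (tag y) (ct y) : nat) = \sum_(q : 'I_l) ((ga q <= c < et q)%R && G q c : nat))%N.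
Proof.
rewrite (eq_bigr (fun y => if ct y == c then (G (tag y) c : nat) else 0%N)) => [|y _]; last first.
  by case: eqP => //= ->.
rewrite -big_mkcond (content_sum Hnu (fun q d => G q d : nat)); apply: eq_bigr => q _.
exact: mulnb.
Qed.

Definition pair_weight (F : box nu -> 'I_l -> bool) : nat :=
  (\sum_(u : box nu) \sum_(q : 'I_l) ((comp (tag u) < comp q)%N && F u q))%N.

(** [ties_sum] and [good_sum] are the increments of [ties] and the values of [step_count], summed
    over all steps of the chain and distributed over the boxes. *)
Definition ties_sum : nat :=
  (\sum_(u : box nu) \sum_(p : 'I_l) [&& (p < tag u)%N, ~~ act u p & (ct u + 1 == et p)%R])%N.
Definition good_sum : nat := pair_weight (fun u q => act u q && (pre (T u) q <= ct u <= post (T u) q)).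

(** The boxes of row q and its flag box together fill the contents from gamma_q to eta_q, each
    once. *)
Lemma h_statE : h_stat nu = pair_weight (fun u q => ga q <= ct u <= et q).
Proof.
apply: etrans (card_pairs (fun (u : box nu) (z : xbox nu) =>
  (comp (tag u) < comp (Defs.xrow z))%N && (content (inl u) == content z))) _.
apply: eq_bigr => u _; rewrite sum_xbox.
rewrite (eq_bigr (fun y => (ct y == ct u) && (comp (tag u) < comp (tag y))%N : nat)) => [|y _]; last first.
  by rewrite /= eq_sym andbC.
rewrite (content_sum_cond (fun q _ => comp (tag u) < comp q)%N) -big_split /=; apply: eq_bigr => q _.
rewrite /= content_flag andbC; case: (_ < comp q)%N; rewrite ?andbF ?andbT //=.
exact: closed_interval (gamma_le_eta Hnu q).
Qed.

Definition later u y : bool := (T y < T u)%O || (T u == T y) && neg (T u).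

Lemma later_pre u y : later u y = (ct y < pre (T u) (tag y)).
Proof.
rewrite /later /pre; case: (boolP (neg _)) => na; rewrite ?andbT ?andbF ?orbF -?(lt_lo Hnu) // -?(le_hi Hnu) //.
by rewrite le_eqVlt orbC eq_sym.
Qed.

Lemma later_post u y : later u y = (post (T y) (tag u) <= ct u).
Proof.
rewrite /post; have -> : later u y = ~~ (if neg (T y) then T u < T y else T u <= T y)%O.
  by rewrite /later; case: (ltgtP (T u) (T y)) => [h|h|->] /=; case: (neg (T y)).
by case: (neg (T y)); rewrite ?(lt_lo Hnu) // ?(le_hi Hnu) // -leNgt.
Qed.

Lemma flag_later u q : [exists s : 'I_l, (flagno sigma q < s.+1)%N && Asub s (T u)] = ~~ act u q.
Proof.
have [i iu ->] := box_letter u; have -> : ~~ active sigma (l - i) q = (flagno sigma q <= i)%N.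
  by rewrite leqNgt flagno_active.
apply/existsP/idP.
  by case=> s /andP[h /(Asub_uniq HA iu) e]; rewrite e.
by move=> h; exists i; rewrite ltnS h.
Qed.

(** The first two sums are attacks on boxes and flag boxes of later components. In the third the
    attacked box of an earlier component plays the role of [u], so that again the row q is the later
    one. The last sum, attacks on flag boxes of earlier components, has no such form and is matched
    with [ties_sum]. *)
Lemma inv_statE : inv_stat sigma neg Asub T =
  (pair_weight (fun u q => ((ga q <= ct u < et q) && (ct u < pre (T u) q))%R) +
   pair_weight (fun u q => (ct u == et q)%R && ~~ act u q) +
   pair_weight (fun u q => ((ga q <= ct u - 1 < et q) && (post (T u) q <= ct u - 1))%R) +
   \sum_(u : box nu) \sum_(q : 'I_l) [&& (comp q < comp (tag u))%N, (ct u + 1 == et q)%R & ~~ act u q])%N.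
Proof.
pose R1 u y := (comp (tag u) < comp (tag y))%N; pose R2 u y := (comp (tag y) < comp (tag u))%N.
have swap : (\sum_u \sum_(y : box nu) [&& R2 u y, (ct y == (ct u + 1)%R) & later u y] =
  pair_weight (fun u q => ((ga q <= ct u - 1 < et q) && (post (T u) q <= ct u - 1))%R))%N.
  rewrite exchange_big; apply: eq_bigr => y _ /=.
  rewrite (eq_bigr (fun u =>
    (ct u == ct y - 1) && ((comp (tag y) < comp (tag u))%N && (post (T y) (tag u) <= ct u)) : nat)) => [|u _].
    rewrite (content_sum_cond (fun q c => (comp (tag y) < comp q)%N && (post (T y) q <= c))).
    by apply: eq_bigr => q _; rewrite andbCA.
  by rewrite later_post andbCA; congr (nat_of_bool (_ && _)); rewrite [RHS]eq_sym (subr_eq (ct y) (ct u) 1).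
rewrite -swap; apply: etrans (card_pairs (fun (u : box nu) (z : xbox nu) =>
  attacking_inversion sigma neg Asub T u z)) _.
rewrite /pair_weight -!big_split /=; apply: eq_bigr => u _; rewrite sum_xbox.
rewrite (eq_bigr (fun y => ((ct y == ct u) && ((comp (tag u) < comp (tag y))%N && (ct y < pre (T u) (tag y))%R) : nat) +
    ([&& R2 u y, (ct y == (ct u + 1)%R) & later u y] : nat))%N) => [|y _]; last first.
  rewrite /attacking_inversion /attacking /= -/(later u y) /R2 -later_pre.
  by case: (ltngtP (comp (tag u)) (comp (tag y))) => _; rewrite ?andbF ?andbT ?orbF /= ?addn0 ?add0n;
    case: (later u y); rewrite ?andbF ?andbT //; case: (_ == _).
rewrite [X in (_ + X)%N = _](eq_bigr (fun q => ([&& (comp (tag u) < comp q)%N, (ct u == et q)%R & ~~ act u q] : nat) +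
    ([&& (comp q < comp (tag u))%N, (ct u + 1 == et q)%R & ~~ act u q] : nat))%N) => [|q _]; last first.
  have -> : attacking_inversion sigma neg Asub T u (inr q) = attacking u (inr q) && ~~ act u q by rewrite -flag_later.
  rewrite /attacking content_flag /=.
  case: (ltngtP (comp (tag u)) (comp q)) => _; rewrite ?andbF ?andbT ?orbF /= ?addn0 ?add0n //;
    by rewrite eq_sym; case: (_ && _).
rewrite !big_split /= (content_sum_cond (fun q c => (comp (tag u) < comp q)%N && (c < pre (T u) q))).
rewrite addnACA addnA; congr (_ + _ + _ + _)%N.
by apply: eq_bigr => q _; rewrite andbCA.
Qed.

Lemma h_stat_inv : (h_stat nu + \sum_(u : box nu) \sum_(q : 'I_l)
   [&& (comp q < comp (tag u))%N, (ct u + 1 == et q)%R & ~~ act u q] = inv_stat sigma neg Asub T + good_sum)%N.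
Proof.
rewrite inv_statE h_statE addnAC; congr (_ + _)%N; rewrite /good_sum /pair_weight -!big_split; apply: eq_bigr => u _ /=.
rewrite -!big_split; apply: eq_bigr => q _ /=.
by case: (_ < comp q)%N => //=; apply: esym (box_pair_count u q).
Qed.

(** Split both [ties_sum] and [rties] by whether the two rows share a component. Across components
    they give the attacks on earlier flag boxes and e(nu, sigma). Inside a component all pairs are
    inverted, and a box u of row q with content eta_p - 1 counts exactly if eta_p = eta_q; it is
    then the last box of its row. *)
Lemma ties_sum_flags : (ties_sum + e_stat sigma = rties sigma et + \sum_(u : box nu) \sum_(q : 'I_l)
   [&& (comp q < comp (tag u))%N, (ct u + 1 == et q)%R & ~~ act u q])%N.
Proof.
pose E p q := [&& (p < q)%N, comp p == comp q & et p == et q].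
have -> : rties sigma et = (e_stat sigma + \sum_(q : 'I_l) \sum_(p : 'I_l) E p q)%N.
  rewrite exchange_big; apply: etrans (card_pairs (fun p q : 'I_l =>
    [&& (p < q)%N, ((sigma^-1)%g q < (sigma^-1)%g p)%N & et p == et q])) _.
  rewrite /e_stat (card_pairs (fun p q : 'I_l => [&& (p < q)%N, comp p != comp q, et p == et q
    & ((sigma^-1)%g q < (sigma^-1)%g p)%N])).
  rewrite -big_split; apply: eq_bigr => p _; rewrite -big_split; apply: eq_bigr => q _ /=.
  rewrite /E; case: (boolP (p < q)%N) => //= pq; case: (comp p =P comp q) => e /=; last by rewrite addn0 andbC.
  by rewrite (sigma_comp Hsigma pq e); case: eqP.
have S : (\sum_(u : box nu) \sum_(p : 'I_l)
   [&& (p < tag u)%N, comp p == comp (tag u), ~~ act u p & (ct u + 1 == et p)%R] =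
   \sum_(q : 'I_l) \sum_(p : 'I_l) E p q)%N.
  rewrite (partition_big (fun u : box nu => tag u) xpredT) //=; apply: eq_bigr => q _.
  rewrite exchange_big; apply: eq_bigr => p _ /=.
  rewrite (eq_bigr (fun u => E p q * ((ct u == et p - 1)%R : nat))%N) => [|u /eqP tu].
    rewrite -big_distrr (row_sum_eq Hnu) /E; case: (boolP (p < q)%N) => //= pq; case: eqP => //= e; case: eqP => //= ee.
    have := gamma_comp Hnu pq e; have := gamma_le_eta Hnu p; rewrite ee mul1n => h1 h2.
    by rewrite (_ : _ && _ = true) //; lia.
  rewrite /E tu; case: (boolP (p < q)%N) => //= pq; case: eqP => //= e.
  have h1 := eta_comp Hnu pq e; have /andP[_ h2] := content_box_bound Hnu u; rewrite tu in h2.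
  have -> : (ct u + 1 == et p) = (ct u == et p - 1) by rewrite eq_sym -subr_eq eq_sym.
  case: eqP => cu; rewrite ?andbF ?muln0 // andbT muln1; congr nat_of_bool; apply/idP/eqP => [na|ee].
    by apply/le_anti; rewrite h1 andbT; lia.
  have [i iu lv] := box_letter u; rewrite lv; apply/negP => ap.
  have ok := FST_state_ok Hnu HA Hsigma hT iu.
  have g1 := state_reg ok pq e ap; have : (T u <= T u)%O by [].
  rewrite (le_hi Hnu) // tu => g2; have := hi_le Hnu T (T u) p; have := lo_le_hi T (T u) p.
  by move: g1; case: (neg _) => g1; lia.
rewrite -addnA addnC; congr (_ + _)%N; rewrite -S /ties_sum -big_split; apply: eq_bigr => u _ /=.
rewrite -big_split; apply: eq_bigr => p _ /=.
rewrite [(_ == _) && ~~ _]andbC; case: (_ && (_ == _)); rewrite ?andbF ?andbT //.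
case: (ltngtP (comp p) (comp (tag u))) => c; rewrite ?andbF ?andbT ?addn0 //=.
  case: (ltnP p (tag u)) => // h; have := row_comp_mono h; by rewrite leqNgt c.
by case: (ltnP p (tag u)) => // /ltnW/row_comp_mono; rewrite leqNgt c.
Qed.
End Statistics.

Section TableauWeight.
Variable nu : seq (seq (int * int)).
Hypothesis Hnu : all ragged_right nu.
Local Notation l := (nrows nu).
Variable sigma : 'S_l.
Hypothesis Hsigma : compatible sigma.
Variables (disp : Order.disp_t) (A : orderType disp) (neg : pred A) (Asub : 'I_l -> pred A).
Hypothesis HA : forall (i j : 'I_l) (a b : A), (i < j)%N -> Asub i a -> Asub j b -> (a < b)%O.
Variables (x : {cmonom A}) (T : {ffun box nu -> A}).
Hypothesis hT : FST sigma neg Asub T.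
Hypothesis Tx : xmon T = x.
Local Notation comp := (@row_comp nu).
Local Notation ga := (gamma nu).
Local Notation et := (eta nu).
Implicit Types (p q : 'I_l) (u y : box nu) (i : 'I_l) (a b : A) (c : int).
Local Notation ct u := (content (inl u)).
Local Notation D := (monalg.mdeg x).
Local Notation k0 := ([ffun=> ord0] : {ffun 'I_l -> 'I_D.+1}).
Local Notation lev := (level Asub).

Let wT : row_weak T.
Proof. by case/and3P: hT => /row_ok_weak. Qed.

Lemma letter_box_sum (F : 'I_l -> int -> nat) a :
  (\sum_(u : box nu | T u == a) F (tag u) (ct u) =
   \sum_(p : 'I_l) \sum_(0 <= i < mult T a p) F p (lo T a p + i%:Z)%R)%N.
Proof.
rewrite (partition_big (fun u : box nu => tag u) xpredT) //=; apply: eq_bigr => p _.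
have -> : mult T a p = `|hi T a p - lo T a p|%N by rewrite hiE addrC addKr.
rewrite -(@sum_shift_window `|et p - ga p| (ga p)); last 3 first.
- exact: lo_ge.
- exact: lo_le_hi.
- by rewrite gez0_abs ?subr_ge0 ?gamma_le_eta // addrCA subrr addr0; apply: hi_le.
rewrite [RHS]big_mkcond -(row_sum Hnu p (fun c => if (lo T a p <= c) && (c < hi T a p) then F p c else 0%N)).
rewrite [LHS]big_mkcond [RHS]big_mkcond; apply: eq_bigr => u _.
case: (tag u =P p) => [<-|_]; last by rewrite andbF.
have -> : (lo T a (tag u) <= ct u) = (a <= T u)%O by rewrite [LHS]leNgt -(lt_lo Hnu) // -leNgt.
by rewrite andbT -(le_hi Hnu) // eq_le andbC.
Qed.

Lemma box_sum_letters (F : box nu -> nat) :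
  (\sum_(u : box nu) F u = \sum_(a <- letters x) \sum_(u : box nu | T u == a) F u)%N.
Proof.
rewrite (exchange_big_dep xpredT) //=; apply: eq_bigr => u _.
rewrite big_mkcond (bigD1_seq (T u) (T_letters Tx u)) ?letters_uniq //= eqxx big1 ?addn0 // => a.
by rewrite eq_sym => /negbTE ->.
Qed.

(** Adding a box to an active row q creates a tie with the inactive row p exactly when the new
    weight is eta_p. No tie is lost, since eta_q <= eta_p: a tied row q is already full. *)
Lemma ties_step a i (la mu : wt l) : Asub i a -> la =1 lo T a -> mu =1 hi T a ->
  ties sigma (l - i) mu = (ties sigma (l - i) la + \sum_(u : box nu | T u == a)
    \sum_(p : 'I_l) ([&& (p < tag u)%N, ~~ active sigma (l - i) p & (ct u + 1 == et p)%R] : nat))%N.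
Proof.
move=> ia laE muE; have ok := FST_state_ok Hnu HA Hsigma hT ia.
rewrite (letter_box_sum (fun q c => \sum_(p : 'I_l)
  ([&& (p < q)%N, ~~ active sigma (l - i) p & (c + 1 == et p)%R] : nat))%N).
have tE (ka : wt l) : ties sigma (l - i) ka = (\sum_(q : 'I_l) \sum_(p : 'I_l)
    [&& (p < q)%N, ~~ active sigma (l - i) p, active sigma (l - i) q & (ka p == ka q)%R])%N.
  by rewrite exchange_big; apply: etrans (card_pairs (fun p q : 'I_l =>
    [&& (p < q)%N, ~~ active sigma (l - i) p, active sigma (l - i) q & (ka p == ka q)%R])) _.
rewrite !tE -big_split; apply: eq_bigr => q _ /=.
rewrite [X in (_ + X)%N]exchange_big -big_split; apply: eq_bigr => p _ /=.
case: (boolP (p < q)%N) => pq /=; last by rewrite big1.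
case: (boolP (active sigma (l - i) p)) => ap /=; first by rewrite big1.
have lop := state_inact ok ap; have hip : hi T a p = et p.
  by apply/le_anti; rewrite hi_le // -lop lo_le_hi.
rewrite !laE !muE lop hip; case: (boolP (active sigma (l - i) q)) => aq /=; last first.
  have := hi_le Hnu T a q; rewrite hiE (state_inact ok aq) gerDl => h.
  by rewrite (_ : mult T a q = 0%N) ?big_geq //; lia.
rewrite (eq_bigr (fun j => ((lo T a q + 1 + j%:Z == et p)%R : nat))) => [|j _]; last by rewrite addrAC.
rewrite sum_shift_eq hiE; have := hi_le Hnu T a q; rewrite hiE.
have : et q <= et p.
  rewrite -(permKV sigma q) -(permKV sigma p); apply: (eta_sigma_mono Hsigma).
  by move: aq ap; rewrite /active => h1 h2; lia.
move: (et p) (et q) (lo T a q) (mult T a q) => e1 e2 e3 n h1 h2.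
by case: eqP; case: eqP; case: (boolP (_ <= _ < _)); lia.
Qed.

Lemma count_step a i (la : wt l) (k : {ffun 'I_l -> 'I_D.+1}) : Asub i a -> la =1 lo T a ->
  (forall p, k p = mult T a p :> nat) ->
  step_count comp sigma (neg a) (l - i) la k = (\sum_(u : box nu | T u == a) \sum_(q : 'I_l)
    ([&& comp (tag u) < comp q, active sigma (l - i) q & (pre neg T a q <= ct u <= post neg T a q)%R] : nat))%N.
Proof.
move=> ia laE kE; rewrite (letter_box_sum (fun p c => \sum_(q : 'I_l)
  ([&& comp p < comp q, active sigma (l - i) q & (pre neg T a q <= c <= post neg T a q)%R] : nat))%N).
rewrite /step_count big_mkcond -(pair_bigA _ (fun p q : 'I_l => if (comp p < comp q)%N && active sigma (l - i) q then
  \sum_(0 <= j < k p) (if neg a then (la q + (k q : nat)%:Z <= la p + j%:Z) && (la p + j%:Z <= la q)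
    else (la q <= la p + j%:Z) && (la p + j%:Z <= la q + (k q : nat)%:Z))%R else 0)%N) /=.
apply: eq_bigr => p _; rewrite [RHS]exchange_big; apply: eq_bigr => q _ /=.
case: (boolP (_ < comp q)%N) => //= pq; last by rewrite big1.
case: (boolP (active _ _ q)) => //= aq; last by rewrite big1.
rewrite kE; apply: eq_bigr => j _; rewrite !laE kE -hiE /pre /post.
by case: (neg a).
Qed.
Hypothesis letters_Asub : forall a, a \in letters x -> exists i, Asub i a.
Variables (K : fieldType) (t : K).
Hypothesis t0 : t != 0.

Lemma mneg_letters : mneg neg T = (\sum_(a <- letters x) if neg a then cmonom_val x a else 0)%N.
Proof.
rewrite /mneg -sum1dep_card big_mkcond box_sum_letters; apply: eq_bigr => a _.
rewrite (xcount Tx); case: (boolP (neg a)) => na.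
  by rewrite [RHS]big_mkcond [LHS]big_mkcond; apply: eq_bigr => u _; case: eqP => // ->; rewrite na.
by apply: big1 => u /eqP ->; rewrite (negbTE na).
Qed.

Lemma letter_step_wt a : a \in letters x ->
  step_wt t comp sigma (neg a) (lev a) (kap ga (chain_of x T) (index a (letters x)))
    (nth k0 (chain_of x T) (index a (letters x))) =
  (-1) ^+ (if neg a then cmonom_val x a else 0%N) * t ^
   ((\sum_(u : box nu | T u == a) \sum_(p : 'I_l)
      ([&& (p < tag u)%N, ~~ active sigma (lev (T u)) p & (ct u + 1 == et p)%R] : nat))%N%:Z -
    (\sum_(u : box nu | T u == a) \sum_(q : 'I_l)
    ([&& comp (tag u) < comp q, active sigma (lev (T u)) q &
      (pre neg T (T u) q <= ct u <= post neg T (T u) q)%R] : nat))%N%:Z).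
Proof.
move=> ha; have [i ia] := letters_Asub ha.
rewrite [X in X%:Z - _](eq_bigr (fun u : box nu => \sum_(p : 'I_l)
      ([&& (p < tag u)%N, ~~ active sigma (l - i) p & (ct u + 1 == et p)%R] : nat))%N); last first.
  by move=> u /eqP ->; rewrite (levelE HA ia).
rewrite [X in _ - X%:Z](eq_bigr (fun u : box nu => \sum_(q : 'I_l)
    ([&& comp (tag u) < comp q, active sigma (l - i) q &
      (pre neg T a q <= ct u <= post neg T a q)%R] : nat))%N); last first.
  by move=> u /eqP ->; rewrite (levelE HA ia).
have kE p := nth_chain_of Tx p ha; have loE := kap_lo Tx ha.
rewrite /step_wt (levelE HA ia) (count_step ia loE kE); congr (_ * t ^ (_ - _)).
  case: (neg a) => //; congr (_ ^+ _); rewrite -(sum_mult Tx); apply: eq_bigr => p _; exact: kE.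
have hiE' : wshift (kap ga (chain_of x T) (index a (letters x)))
    (nth k0 (chain_of x T) (index a (letters x))) =1 hi T a.
  by move=> p; rewrite wshift_kap ?size_chain_of ?index_mem // kap_hi.
by rewrite (ties_step ia loE hiE') PoszD addrAC subrr add0r.
Qed.

Lemma chain_of_wt : chain_wt t comp sigma (letter_steps neg Asub x) ga (chain_of x T) =
  (-1) ^+ mneg neg T * t ^ ((ties_sum sigma Asub T)%:Z - (good_sum sigma neg Asub T)%:Z).
Proof.
rewrite chain_wtE ?size_letter_steps ?size_chain_of //.
have e (F : nat -> K) : \prod_(0 <= j < size (letters x)) F j = \prod_(a <- letters x) F (index a (letters x)).
  case es : (letters x) => [|a0 s]; first by rewrite big_geq // big_nil.
  rewrite -es (big_nth a0) !big_mkord; apply: eq_bigr => j _.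
  by rewrite index_uniq ?letters_uniq.
rewrite e big_seq; under eq_bigr => a ha do rewrite nth_letter_steps // letter_step_wt //.
rewrite -big_seq big_split /= -expr_sum -mneg_letters; congr (_ * _).
have te : {morph (fun n : int => t ^ n) : m n / m + n >-> m * n} by move=> m n; apply: expfzDr.
rewrite -(big_morph (fun n : int => t ^ n) te (expr0z t)) sumrB; congr (t ^ (_ - _)).
  by rewrite /ties_sum box_sum_letters (big_morph Posz PoszD (erefl _)).
by rewrite /good_sum /pair_weight box_sum_letters (big_morph Posz PoszD (erefl _)).
Qed.

Lemma tableau_wt : t ^+ (h_stat nu + e_stat sigma) * (t ^- rties sigma et *
  chain_wt t comp sigma (letter_steps neg Asub x) ga (chain_of x T)) =
  (-1) ^+ mneg neg T * t ^+ inv_stat sigma neg Asub T.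
Proof.
rewrite chain_of_wt (mulrCA (t ^- _)) (mulrCA (t ^+ _)); congr (_ * _).
have -> : t ^- rties sigma et = t ^ (- (rties sigma et)%:Z) by rewrite -invr_expz.
rewrite !exprnP -!expfzDr //; congr (t ^ _).
(* The attacks on flag boxes of earlier components occur in both identities and cancel. *)
have := h_stat_inv Hnu Hsigma HA hT; have := ties_sum_flags Hnu Hsigma HA hT.
by lia.
Qed.
End TableauWeight.

(** * The coefficient of a fixed monomial as a sum over tableaux *)

Section TableauEnumeration.
Variable nu : seq (seq (int * int)).
Variables (sigma : 'S_(nrows nu)) (disp : Order.disp_t) (A : orderType disp) (neg : pred A).
Variables (Asub : 'I_(nrows nu) -> pred A) (x : {cmonom A}).

Definition tableau_of (f : {ffun box nu -> seq_sub (letters x)}) : {ffun box nu -> A} := [ffun u => ssval (f u)].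

(** The alphabet may be infinite, but a tableau with x^T = x uses only letters of x. *)
Definition tableaux : seq {ffun box nu -> A} :=
  [seq T <- map tableau_of (enum {ffun box nu -> seq_sub (letters x)}) | FST sigma neg Asub T && (xmon T == x)].

Lemma mem_tableaux T : (T \in tableaux) = FST sigma neg Asub T && (xmon T == x).
Proof.
rewrite mem_filter; case: (FST sigma neg Asub T) => //=.
case: (xmon T =P x) => //= Tx; apply/mapP.
exists [ffun u => SeqSub (T_letters Tx u)]; first by rewrite mem_enum.
by apply/ffunP => u; rewrite !ffunE.
Qed.

Lemma uniq_tableaux : uniq tableaux.
Proof.
apply: filter_uniq; rewrite map_inj_uniq ?enum_uniq // => f g /ffunP e.
by apply/ffunP => u; apply: val_inj; have := e u; rewrite !ffunE.
Qed.
End TableauEnumeration.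

Section LLTValue.
Variables (K : fieldType) (t : K) (nu : seq (seq (int * int))) (sigma : 'S_(nrows nu)).
Hypothesis t0 : t != 0.
Hypotheses (Hnu : all ragged_right nu) (Hsigma : compatible sigma).
Variables (disp : Order.disp_t) (A : orderType disp) (neg : pred A) (Asub : 'I_(nrows nu) -> pred A).
Hypothesis HA : forall (i j : 'I_(nrows nu)) (a b : A), (i < j)%N -> Asub i a -> Asub j b -> (a < b)%O.
Variable x : {cmonom A}.
Local Notation l := (nrows nu).
Local Notation comp := (@row_comp nu).
Local Notation steps := (letter_steps neg Asub x).
Implicit Types (i : 'I_l) (a b : A) (p q : 'I_l).

Lemma active_all p : active sigma l p.
Proof. exact: ltn_ord. Qed.

Lemma LLT_value_phi : LLT_value t sigma Asub neg x = t ^+ (h_stat nu + e_stat sigma) *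
  phi t comp sigma l (gamma nu)
    ((\prod_(a <- letters x) letterV K Asub neg a (cmonom_val x a)) * zmon K (wt_inc (eta nu))).
Proof.
rewrite /LLT_value /phi; congr (_ * _).
rewrite (perm_big (letters x)) /=; last by rewrite /letters perm_sym perm_sort.
apply: eq_bigl => w; rewrite inE; apply: eq_forallb => p.
by rewrite active_all implyFb andbT.
Qed.

Hypothesis letters_Asub : forall a, a \in letters x -> exists i, Asub i a.

Lemma letterV_steps :
  (\prod_(a <- letters x) letterV K Asub neg a (cmonom_val x a)) * zmon K (wt_inc (eta nu)) =
  sprod (@homV K l) steps (zmon K (wt_inc (eta nu))).
Proof.
move: letters_Asub; rewrite /letter_steps; elim: (letters x) => [|a s IH] h; first by rewrite big_nil mul1r.
rewrite big_cons /= -mulrA IH => [|b bs]; last by apply: h; rewrite inE bs orbT.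
congr (_ * _); rewrite /letterV /level.
by have [i ia] := h a (mem_head _ _); case: pickP => [//|/(_ i)]; rewrite ia.
Qed.

Lemma letter_steps_wf : steps_wf (monalg.mdeg x) l steps.
Proof.
have lev_le a : (level Asub a <= l)%N by rewrite /level; case: pickP => // i _; apply: leq_subr.
suff wf s m : (forall a, a \in s -> (level Asub a <= m)%N) -> (forall a, a \in s -> exists i, Asub i a) ->
    sorted <=%O s -> steps_wf (monalg.mdeg x) m (map (letter_step neg Asub x) s).
  by apply: wf => //; exact: letters_sorted.
elim: s m => //= a s IH m h hA ps; apply/and3P; split.
- by apply: h; rewrite mem_head.
- have [ha|/fsfun_dflt -> //] := boolP (a \in finsupp (cmonom_val x)).
  by rewrite monalg.mdegE (big_fsetD1 a) //= leq_addr.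
apply: IH; last exact: path_sorted ps.
  move=> b bs; have ab : (a <= b)%O.
    by move: ps; rewrite (path_sortedE le_trans) => /andP[/allP h' _]; apply: h'.
  have [i ia] := hA a (mem_head _ _); have [|j jb] := hA b; first by rewrite inE bs orbT.
  rewrite (levelE HA ia) (levelE HA jb); apply: leq_sub2l; exact: (Asub_mono HA ia jb).
by move=> b bs; apply: hA; rewrite inE bs orbT.
Qed.

Lemma LLT_value_chains : LLT_value t sigma Asub neg x = t ^+ (h_stat nu + e_stat sigma) *
  (t ^- rties sigma (eta nu) *
   \sum_(c <- kchains comp (eta nu) sigma (monalg.mdeg x) steps (gamma nu)) chain_wt t comp sigma steps (gamma nu) c).
Proof.
rewrite LLT_value_phi letterV_steps (phi_chain_sum t0 (@row_comp_mono nu) (eta_sigma_mono Hsigma)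
  (sigma_comp Hsigma) (@homV_elemV K l) (leqnn l) letter_steps_wf) ?chain_sumE //.
  by apply/regularP => p q pq e _; apply: (gamma_comp Hnu).
by apply/forallP => p; rewrite active_all.
Qed.

Lemma LLT_value_tableaux : LLT_value t sigma Asub neg x =
  \sum_(T <- tableaux sigma neg Asub x) FST_term sigma neg Asub t T x.
Proof.
rewrite LLT_value_chains (perm_big (map (chain_of x) (tableaux sigma neg Asub x))) /=.
  rewrite big_map !mulr_sumr big_seq [RHS]big_seq; apply: eq_bigr => T.
  rewrite mem_tableaux => /andP[hT /eqP Tx].
  by rewrite (tableau_wt Hnu Hsigma HA hT Tx letters_Asub t0) /FST_term Tx eqxx mulr1n.
apply: uniq_perm; first exact: uniq_kchains.
  rewrite map_inj_in_uniq ?uniq_tableaux // => T T'; rewrite !mem_tableaux.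
  move=> /andP[/and3P[/row_ok_weak wT _ _] /eqP Tx] /andP[/and3P[/row_ok_weak wT' _ _] /eqP Tx'].
  exact: (chain_of_inj Hnu).
move=> c; rewrite mem_kchains; apply/idP/mapP => [vc|[T]].
  have [T [hT Tx <-]] := chain_of_surj Hnu Hsigma HA letters_Asub vc.
  by exists T => //; rewrite mem_tableaux hT Tx eqxx.
rewrite mem_tableaux => /andP[hT /eqP Tx] ->; exact: (chain_of_valid Hnu Hsigma HA letters_Asub hT Tx).
Qed.
End LLTValue.

(** A letter in no A_i contributes the constant series 1, whose coefficient at a positive exponent
    is 0. *)
Lemma LLT_value_stray (K : fieldType) (t : K) (nu : seq (seq (int * int))) (sigma : 'S_(nrows nu))
    (V : choiceType) (neg : pred V) (B : 'I_(nrows nu) -> pred V) (x : {cmonom V}) a :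
  t != 0 -> a \in finsupp (cmonom_val x) -> (forall i, ~~ B i a) -> LLT_value t sigma B neg x = 0.
Proof.
move=> t0 ax nB; rewrite /LLT_value big1 ?mulr0 // => w _.
rewrite (big_fsetD1 a) //= {1}/letterV; case: pickP => [i|_]; first by rewrite (negbTE (nB i)).
by rewrite /sone monalg.cmE_eq0 ax mul0r Fphi0 ?mulr0.
Qed.

Lemma FST_term_neq0 (K : fieldType) (t : K) (nu : seq (seq (int * int))) (sigma : 'S_(nrows nu))
    (disp : Order.disp_t) (A : orderType disp) (neg : pred A) (Asub : 'I_(nrows nu) -> pred A)
    (T : {ffun box nu -> A}) (x : {cmonom A}) :
  t != 0 -> (FST_term sigma neg Asub t T x != 0) = (xmon T == x).
Proof.
move=> t0; rewrite /FST_term [x == _]eq_sym; case: (xmon T =P x) => _; last by rewrite mulr0n eqxx.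
by rewrite mulr1n mulf_neq0 ?expf_neq0 ?oppr_eq0 ?oner_neq0.
Qed.

Theorem theorem6p4p10
    (nu : seq (seq (int * int))) (sigma : 'S_(nrows nu))
    (Hnu : all ragged_right nu) (Hsigma : compatible sigma)
    (disp : Order.disp_t) (A : orderType disp) (neg : pred A)
    (Asub : 'I_(nrows nu) -> pred A)
    (HA : forall (i j : 'I_(nrows nu)) (a b : A),
        (i < j)%N -> Asub i a -> Asub j b -> (a < b)%O) :
  fps_sum (FST sigma neg Asub)
    (fun T => FST_term sigma neg Asub tQ T)
    (pleth (fun i => h_signed Qt (Asub i) neg) (flagged_LLT tQ sigma)).
Proof.
have t0 : tQ != 0 by rewrite /tQ tofrac_eq0 polyX_eq0.
move=> x; exists (tableaux sigma neg Asub x); split; first exact: uniq_tableaux.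
  by move=> T; rewrite mem_tableaux (FST_term_neq0 sigma neg Asub T x t0).
rewrite (pleth_flagged_LLT sigma t0) => [|i j a]; last exact: (Asub_uniq HA).
(* If some letter of the monomial lies in no A_i, both sides are 0: on the right because no flagged
   tableau contains that letter. *)
have [/allP ok|/allPn[a ax na]] := boolP (all (fun a => [exists i, Asub i a]) (letters x)).
  by apply: LLT_value_tableaux => // a /ok /existsP.
rewrite (@LLT_value_stray Qt tQ nu sigma A neg Asub x a t0); last 2 first.
- by rewrite -mem_letters.
- by move=> i; apply: contra na => ia; apply/existsP; exists i.
rewrite big_seq big1 // => T; rewrite mem_tableaux => /andP[/and3P[_ _ /forallP hT] /eqP Tx].
move: ax; rewrite mem_letters -monalg.cmE_neq0 (xcount Tx) sum_nat_eq0 => /forallPn[u].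
rewrite /= eqb0 negbK => /eqP Tu; case/negP: na.
by have /andP[] := hT u; rewrite Tu.
Qed.
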